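(* Suppose that $\Pi_{\ell^1}(X)$ is compact; this is certainly the case if $X$ is metrizable or $X=\mathrm{Per}(\sigma)$. Furthermore, assume that $S_1,\ldots,S_n$ are mutually disjoint invariant closed subsets of $X$ such that $S_i\subset\mathrm{Per}_{p_i}(\sigma)$ for not necessarily different integers $p_1,\ldots,p_n\geq1$. Let $S=\bigcup_{i=1}^nS_i$. Then the map $\Psi:(S/\mathbb{Z})\times\mathbb{T}\to\Pi_{\ell^1}(S)$, sending $(\overline{\mathfrak{o}},\lambda)$ to $P_{\overline{\mathfrak{o}},\lambda}$, is a homeomorphism between compact Hausdorff spaces. As a topological space, the codomain is also homeomorphic to the disjoint union of the topological spaces $\Pi_{\ell^1}(S_i)$, and each such space is homeomorphic to $(S_i/\mathbb{Z})\times\mathbb{T}$.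
   Context: $X$ is a non-empty compact Hausdorff space, $\sigma:X\to X$ is a homeomorphism, $\Sigma=(X,\sigma)$, and $\mathbb{Z}$ acts on $X$ via $n\mapsto\sigma^n$. A subset $S$ is invariant if $\sigma(S)=S$. $\mathrm{Per}(\sigma)$ and $\mathrm{Aper}(\sigma)$ are the sets of points with finite, respectively infinite, orbit; $\mathrm{Per}_p(\sigma)$ is the set of points whose orbit has exactly $p$ elements. $\overline{\mathfrak{o}}$ is the closure of an orbit $\mathfrak{o}$ (so $\overline{\mathfrak{o}}=\mathfrak{o}$ for finite orbits). For invariant $S\subset\mathrm{Per}(\sigma)$, $S/\mathbb{Z}$ is the orbit space with the quotient topology. $\mathbb{T}$ is the unit circle in $\mathbb{C}$. $C(X)$ carries the supremum norm and $\alpha(f)=f\circ\sigma^{-1}$. $\ell^1(\Sigma)$ is the Banach space of all $a:\mathbb{Z}\to C(X)$ with $\|a\|=\sum_n\|a(n)\|<\infty$, with multiplication $(aa')(n)=\sum_{k\in\mathbb{Z}}a(k)\,\alpha^k(a'(n-k))$. Elements are written $a=\sum_nf_n\delta^n$ with $f_n=a(n)$, where $\delta(1)=1$ and $\delta(m)=0$ for $m\ne1$. A representation of an algebra $A$ on a complex vector space $E$ is algebraically irreducible if $\pi(A)E\ne\{0\}$ and the only invariant subspaces are $\{0\}$ and $E$; a primitive ideal is the kernel of such a representation. $\Pi_{\ell^1}$ is the set of all primitive ideals of $\ell^1(\Sigma)$ with the hull-kernel topology: the closure of $E\subset\Pi_{\ell^1}$ is $\{P\in\Pi_{\ell^1}:P\supset\bigcap_{Q\in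 E}Q\}$. Subsets of $\Pi_{\ell^1}$ carry the induced topologies. Compactness does not include the Hausdorff property. For $x\in\mathrm{Per}(\sigma)$ of period $p$ with orbit $\mathfrak{o}=\overline{\mathfrak{o}}$, and $\lambda\in\mathbb{T}$, $P_{\overline{\mathfrak{o}},\lambda}$ is the kernel of the algebraically irreducible representation $\pi_{x,\lambda}$ on $\mathbb{C}^p$ (basis $e_0,\dots,e_{p-1}$) given by $\pi_{x,\lambda}(f)e_j=f(\sigma^jx)e_j$ for $f\in C(X)$, $\pi_{x,\lambda}(\delta)e_j=e_{j+1}$ for $0\le j\le p-2$, $\pi_{x,\lambda}(\delta)e_{p-1}=\lambda e_0$; it depends only on $\overline{\mathfrak{o}}$ and $\lambda$. For $x\in\mathrm{Aper}(\sigma)$ with orbit closure $\overline{\mathfrak{o}}$, $P_{\overline{\mathfrak{o}}}$ is the kernel of the algebraically irreducible contractive representation $\pi_x^1$ on $\ell^1(\mathbb{Z})$ with $\pi_x^1(f)e_k=f(\sigma^kx)e_k$, $\pi_x^1(\delta)e_k=e_{k+1}$ ($k\in\mathbb{Z}$); it depends only on $\overline{\mathfrak{o}}$. For invariant $S\subset X$, $\Pi_{\ell^1}(S)$ is the set of all $P_{\overline{\mathfrak{o}},\lambda}$ with $\mathfrak{o}\subset S$ a finite orbit and $\lambda\in\mathbb{T}$, together with all $P_{\overline{\mathfrak{o}}}$ with $\mathfrak{o}\subset S$ an infinite orbit. *)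

(* Defs.v *)
Set Warnings "-notation-overridden,-ambiguous-paths,-notation-incompatible-prefix,-redundant-canonical-projection".
From HB Require Import structures.
From mathcomp Require Import all_boot all_order all_algebra finmap.
From mathcomp Require Import generic_quotient.
From mathcomp Require Import all_classical all_reals all_analysis.
From mathcomp Require Import complex summability lra.

Set Implicit Arguments.
Unset Strict Implicit.
Unset Printing Implicit Defensive.
Import Order.TTheory GRing.Theory Num.Theory numFieldNormedType.Exports.

Local Open Scope classical_set_scope.
Local Open Scope ring_scope.
Local Open Scope complex_scope.

Local Notation normc := (@ComplexField.Normc.normc _).

Section HasSum.
Context {K : numFieldType}.

(* Unconditional (unordered) convergence of a family to s. *)
Definition has_sum {I : choiceType} (f : I -> K) (s : K) := forall e : K, 0 < e ->
  exists A : {fset I}, forall B : {fset I}, (A `<=` B)%fset ->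
    `| \sum_(i <- B) f i - s | < e.

Lemma has_sum_unique {I : choiceType} (f : I -> K) s t :
  has_sum f s -> has_sum f t -> s = t.
Proof.
move=> hs ht; apply/eqP; rewrite -subr_eq0 -normr_le0; apply/ler_addgt0Pl => e e0.
rewrite addr0.
have [A hA] := hs _ (divr_gt0 e0 (ltr0Sn K 1)).
have [B hB] := ht _ (divr_gt0 e0 (ltr0Sn K 1)).
have h1 := hA (A `|` B)%fset (fsubsetUl _ _).
have h2 := hB (A `|` B)%fset (fsubsetUr _ _).
rewrite (splitr e) ltW //; apply: le_lt_trans (ltrD h1 h2).
by rewrite [X in _ <= X + _]distrC; apply: le_trans (ler_normD _ _); rewrite addrA subrK.
Qed.

Lemma has_sumD {I : choiceType} (f g : I -> K) s t :
  has_sum f s -> has_sum g t -> has_sum (fun i => f i + g i) (s + t).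
Proof.
move=> hs ht e e0.
have [A hA] := hs _ (divr_gt0 e0 (ltr0Sn K 1)).
have [B hB] := ht _ (divr_gt0 e0 (ltr0Sn K 1)).
exists (A `|` B)%fset => C; rewrite fsubUset => /andP[/hA h1 /hB h2].
rewrite (splitr e) big_split/= opprD addrACA.
by apply: le_lt_trans (ltrD h1 h2); exact: ler_normD.
Qed.

Lemma has_sumZ {I : choiceType} (c : K) (f : I -> K) s :
  has_sum f s -> has_sum (fun i => c * f i) (c * s).
Proof.
move=> hs e e0.
have c0 : 0 < `|c| + 1 by rewrite ltr_wpDl.
have [A hA] := hs _ (divr_gt0 e0 c0).
exists A => B /hA h; rewrite -mulr_sumr -mulrBr normrM.
apply: (@le_lt_trans _ _ ((`|c| + 1) * `|\sum_(i <- B) f i - s|)).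
  by rewrite ler_wpM2r// lerDl.
by rewrite mulrC -ltr_pdivlMr.
Qed.

Lemma has_sum0 {I : choiceType} : has_sum (fun _ : I => 0 : K) 0.
Proof. by move=> e e0; exists fset0 => B _; rewrite big1// subrr normr0. Qed.

Lemma has_sumN {I : choiceType} (f : I -> K) s :
  has_sum f s -> has_sum (fun i => - f i) (- s).
Proof.
move/(has_sumZ (-1)); rewrite mulN1r; congr has_sum.
by apply/funext => i; rewrite mulN1r.
Qed.

Lemma has_sum_sum {I J : choiceType} (r : seq J) (F : J -> I -> K) (g : J -> K) :
  (forall j, has_sum (F j) (g j)) ->
  has_sum (fun i => \sum_(j <- r) F j i) (\sum_(j <- r) g j).
Proof.
move=> h; elim: r => [|j r ih].
  rewrite big_nil (_ : (fun _ => _) = fun=> 0); first exact: has_sum0.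
  by apply/funext => i; rewrite big_nil.
rewrite big_cons (_ : (fun _ => _) = fun i => F j i + \sum_(j <- r) F j i).
  exact: has_sumD.
by apply/funext => i; rewrite big_cons.
Qed.

Lemma has_sum1 {I : choiceType} (i0 : I) (f : I -> K) :
  (forall i, i != i0 -> f i = 0) -> has_sum f (f i0).
Proof.
move=> h e e0; exists [fset i0]%fset => B; rewrite fsub1set => iB.
by rewrite (bigD1_seq i0)//= big1 ?addr0 ?subrr ?normr0// => i /h.
Qed.

Lemma has_sum_reindex {I J : choiceType} (h : I -> J) (h' : J -> I) (f : J -> K) s :
  cancel h h' -> cancel h' h -> has_sum f s -> has_sum (f \o h) s.
Proof.
move=> hK h'K hs e e0; have [A hA] := hs _ e0.
exists [fset h' x | x in A]%fset => B AB.
have := hA [fset h x | x in B]%fset; rewrite big_imfset/=; last first.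
  by move=> x y _ _; exact: can_inj.
apply; apply/fsubsetP => x xA; apply/imfsetP; exists (h' x) => //=.
by move/fsubsetP: AB; apply; apply/imfsetP; exists x.
Qed.

Lemma has_sum_le {I : choiceType} (f : I -> K) s (A : {fset I}) M : 
  has_sum f s -> (forall B, (A `<=` B)%fset -> `|\sum_(i <- B) f i| <= M) -> `|s| <= M.
Proof.
move=> hs hM; apply/ler_addgt0Pr => e e0; have [B hB] := hs _ e0.
have := hB (A `|` B)%fset (fsubsetUr _ _); set S := \sum_(_ <- _) _ => h.
have -> : s = S - (S - s) by rewrite opprB addrC subrK.
apply: le_trans (ler_normB _ _) _; apply: lerD; last exact: ltW.
by apply: hM; exact: fsubsetUl.
Qed.

Lemma big_fsetM {I J : choiceType} (A : {fset I}) (B : {fset J}) (F : I * J -> K) :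
  \sum_(p <- (A `*` B)%fset) F p = \sum_(i <- A) \sum_(j <- B) F (i, j).
Proof.
rewrite -[RHS](@big_allpairs _ _ _ _ _ (enum_fset A) (enum_fset B) F).
apply: perm_big; apply: uniq_perm => //.
  by apply: allpairs_uniq => // -[? ?] [? ?].
move=> [i j]; rewrite in_fsetM/=; apply/andP/allpairsP => [[iA jB]|[[i' j']/=]].
  by exists (i, j).
by move=> [? ? [-> ->]].
Qed.

Lemma has_sum_fubini {I J : choiceType} (F : I * J -> K) (g : I -> K) s :
  has_sum F s -> (forall i, has_sum (fun j => F (i, j)) (g i)) -> has_sum g s.
Proof.
move=> hs hg e e0; have [A hA] := hs _ (divr_gt0 e0 (ltr0Sn K 1)).
exists [fset x.1 | x in A]%fset => B AB.
have [C hC] := has_sum_sum B hg (divr_gt0 e0 (ltr0Sn K 1)).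
set D := (C `|` [fset x.2 | x in A])%fset.
have h1 := hC D (fsubsetUl _ _).
have h2 : `|\sum_(p <- (B `*` D)%fset) F p - s| < e / 2.
  apply: hA; apply/fsubsetP => -[x y] xyA; rewrite in_fsetM/=; apply/andP; split.
    by move/fsubsetP: AB; apply; apply/imfsetP; exists (x, y).
  by rewrite in_fsetU; apply/orP; right; apply/imfsetP; exists (x, y).
rewrite big_fsetM exchange_big/= in h2.
rewrite (splitr e); apply: le_lt_trans (ltrD h1 h2).
by rewrite [X in _ <= X + _]distrC; apply: le_trans (ler_normD _ _); rewrite addrA subrK.
Qed.

End HasSum.

Section Bounded.
Context {R : realType}.

(* For g >= 0 this is summability, by esum_bsum below. *)
Definition bsum {I : choiceType} (g : I -> R) :=
  exists M, forall A : {fset I}, \sum_(i <- A) g i <= M.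

Lemma esum_bsum {I : choiceType} (g : I -> R) : (forall i, 0 <= g i) ->
  (\esum_(i in [set: I]) (g i)%:E < +oo)%E <-> bsum g.
Proof.
move=> g0; split=> [h|[M hM]].
  have h0 : (0 <= \esum_(i in [set: I]) (g i)%:E)%E.
    by apply: esum_ge0 => i _; rewrite lee_fin.
  have hf : (\esum_(i in [set: I]) (g i)%:E)%E \is a fin_num.
    by rewrite ge0_fin_numE.
  exists (fine (\esum_(i in [set: I]) (g i)%:E)%E) => A.
  rewrite -lee_fin fineK//; apply: esum_ge; exists [set` A].
    by split => //; exact: finite_fset.
  by rewrite fsbig_finite//= set_fsetK sumEFin.
apply: (@le_lt_trans _ _ M%:E); last exact: ltry.
apply: ge_ereal_sup => _ [X [fX _] <-]; rewrite fsbig_finite//= sumEFin lee_fin.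
exact: hM.
Qed.

Lemma bsum_le {I : choiceType} (f g : I -> R) :
  (forall i, f i <= g i) -> bsum g -> bsum f.
Proof. by move=> fg [M hM]; exists M => A; apply: le_trans (hM A); exact: ler_sum. Qed.

Lemma bsumD {I : choiceType} (f g : I -> R) :
  bsum f -> bsum g -> bsum (fun i => f i + g i).
Proof.
by move=> [M hM] [N hN]; exists (M + N) => A; rewrite big_split/= lerD.
Qed.

Lemma bsumZ {I : choiceType} (c : R) (f : I -> R) : 0 <= c ->
  bsum f -> bsum (fun i => c * f i).
Proof.
by move=> c0 [M hM]; exists (c * M) => A; rewrite -mulr_sumr ler_wpM2l.
Qed.

Lemma bsum_inj {I J : choiceType} (h : I -> J) (g : J -> R) :
  injective h -> bsum g -> bsum (g \o h).
Proof.
move=> hi [M hM]; exists M => A; have := hM [fset h x | x in A]%fset.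
by rewrite big_imfset//= => x y _ _; exact: hi.
Qed.

Lemma ler_sum_fset {I : choiceType} (g : I -> R) (A B : {fset I}) :
  (forall i, 0 <= g i) -> (A `<=` B)%fset ->
  \sum_(i <- A) g i <= \sum_(i <- B) g i.
Proof.
move=> g0 AB; rewrite [leRHS](big_fsetID _ (mem A))/=.
rewrite (_ : [fset x | x in B & x \in A]%fset = A); last first.
  apply/fsetP => x; rewrite !inE/= andbC; case: (boolP (x \in A)) => //= xA.
  by move/fsubsetP: AB; exact.
by rewrite lerDl sumr_ge0.
Qed.

Lemma bsum_prod {I J : choiceType} (f : I -> R) (g : J -> R) :
  (forall i, 0 <= f i) -> (forall i, 0 <= g i) ->
  bsum f -> bsum g -> bsum (fun p : I * J => f p.1 * g p.2).
Proof.
move=> f0 g0 [M hM] [N hN]; exists (M * N) => A.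
have N0 : 0 <= N by have := hN fset0; rewrite big_nil.
pose B := ([fset x.1 | x in A] `*` [fset x.2 | x in A])%fset.
apply: (@le_trans _ _ (\sum_(p <- B) f p.1 * g p.2)).
  apply: ler_sum_fset => [p|]; first exact: mulr_ge0.
  apply/fsubsetP => p pA; rewrite in_fsetM.
  by apply/andP; split; apply/imfsetP; exists p.
rewrite big_fsetM /=.
under eq_bigr do rewrite -mulr_sumr.
rewrite -mulr_suml; apply: le_trans (ler_wpM2r N0 (hM _)).
by apply: ler_wpM2l (hN _); exact: sumr_ge0.
Qed.

Lemma bsum_has_sum0 {I : choiceType} (g : I -> R) :
  (forall i, 0 <= g i) -> bsum g -> exists s, has_sum g s.
Proof.
move=> g0 [M hM]; pose E := [set \sum_(i <- A) g i | A in [set: {fset I}]].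
have Eub : has_sup E.
  by split; [exists (\sum_(i <- fset0) g i), fset0|exists M => _ [A _ <-]].
exists (sup E) => e e0.
have [_ [A _ <-] hA] := sup_adherent e0 Eub.
exists A => B AB; rewrite ler0_norm; last first.
  by rewrite subr_le0; apply: ub_le_sup; [case: Eub|exists B].
rewrite opprB ltrBlDl -ltrBlDr; apply: lt_le_trans hA _; exact: ler_sum_fset.
Qed.

Lemma bsum_has_sumR {I : choiceType} (f g : I -> R) :
  (forall i, `|f i| <= g i) -> bsum g -> exists s, has_sum f s.
Proof.
move=> fg bg; have g0 i : 0 <= g i by apply: le_trans (fg i).
have [s hs] := bsum_has_sum0 g0 bg.
have [||t ht] := @bsum_has_sum0 I (fun i => g i + f i).
- by move=> i; rewrite -lerBlDl sub0r; have := fg i; rewrite ler_norml => /andP[].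
- apply: (bsum_le _ (bsumD bg bg)) => i; rewrite lerD2l.
  exact: le_trans (ler_norm _) (fg i).
exists (t - s); have := has_sumD ht (has_sumN hs).
by congr has_sum; apply/funext => i; rewrite addrAC subrr add0r.
Qed.

Lemma normcE' (z : R[i]) : `|z| = (normc z)%:C.
Proof. by case: z. Qed.

Lemma normcD' (z w : R[i]) : normc (z + w) <= normc z + normc w.
Proof. exact: le_normcD. Qed.

Lemma normc_ge0 (z : R[i]) : 0 <= normc z.
Proof. by rewrite -ler0c -normcE' normr_ge0. Qed.

Lemma has_sumC {I : choiceType} (g : I -> R) s :
  has_sum g s -> has_sum (fun i => (g i)%:C) s%:C.
Proof.
move=> hs e e0; have e_real : e = (complex.Re e)%:C.
  by move: (ger0_Im (ltW e0)); case: (e) => a b /= ->.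
have e0' : 0 < complex.Re e by rewrite -ltcR -e_real.
have [A hA] := hs _ e0'; exists A => B /hA h.
by rewrite -rmorph_sum/= -rmorphB/= normcE' e_real ltcR/= expr0n/= addr0 sqrtr_sqr.
Qed.

Lemma bsum_has_sum {I : choiceType} (f : I -> R[i]) (g : I -> R) :
  (forall i, normc (f i) <= g i) -> bsum g -> exists s, has_sum f s.
Proof.
move=> fg bg.
have hre (z : R[i]) : `|complex.Re z| <= normc z.
  by rewrite -lecR -normcE'; exact: normc_ge_Re.
have him (z : R[i]) : `|complex.Im z| <= normc z.
  case: z => a b /=; rewrite -sqrtr_sqr ler_wsqrtr// lerDr; exact: sqr_ge0.
have [s hs] := bsum_has_sumR (fun i => le_trans (hre _) (fg i)) bg.
have [t ht] := bsum_has_sumR (fun i => le_trans (him _) (fg i)) bg.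
exists (s%:C + 'i * t%:C); have := has_sumD (has_sumC hs) (has_sumZ 'i (has_sumC ht)).
by congr has_sum; apply/funext => i; rewrite [RHS]complexE.
Qed.

Lemma has_sum_normc {I : choiceType} (f : I -> R[i]) s M :
  has_sum f s -> (forall A : {fset I}, \sum_(i <- A) normc (f i) <= M) -> normc s <= M.
Proof.
move=> hs hM; rewrite -lecR -normcE'; apply: (has_sum_le hs (A := fset0)) => B _.
apply: le_trans (ler_norm_sum _ _ _) _.
by under eq_bigr do rewrite normcE'; rewrite -rmorph_sum/= lecR.
Qed.

End Bounded.

(* The topology of the complex numbers is that of their norm. *)
HB.instance Definition _ (R : realType) := NormedModule.copy R[i] R[i]^o.

#[local] Existing Instance totally_filter.

Section ZSum.
Context {R : realType}.

(* The sum over all integers, as the limit along the finite subsets of Z. *)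
Definition zsum (f : int -> R[i]) : R[i] :=
  lim ((fun A : {fset int} => \sum_(k <- A) f k) @ totally).

Lemma zsumE (f : int -> R[i]) s : has_sum f s -> zsum f = s.
Proof.
move=> h; apply: cvg_lim => //; apply/(@cvgrPdist_lt _ R[i] _ totally) => e /h[A hA].
by exists A => // B AB; rewrite distrC; exact: hA.
Qed.

Lemma bsum_zsum (f : int -> R[i]) (g : int -> R) :
  (forall i, normc (f i) <= g i) -> bsum g -> has_sum f (zsum f).
Proof. by move=> fg bg; have [s hs] := bsum_has_sum fg bg; rewrite (zsumE hs). Qed.

End ZSum.

(* The inverse of the homeomorphism is part of the data; it is unique. *)
Record dynsys := DynSys {
  dyn_space :> topologicalType;
  dyn_map : dyn_space -> dyn_space;
  dyn_inv : dyn_space -> dyn_space;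
  dyn_compact : compact [set: dyn_space];
  dyn_hausdorff : hausdorff_space dyn_space;
  dyn_nonempty : [set: dyn_space] !=set0;
  dyn_mapK : cancel dyn_map dyn_inv;
  dyn_invK : cancel dyn_inv dyn_map;
  dyn_map_continuous : continuous dyn_map;
  dyn_inv_continuous : continuous dyn_inv }.

Section Dyn.
Context {X : dynsys}.

(* sigma ^ n for an integer n *)
Definition dyn_iter (n : int) (x : X) : X :=
  match n with
  | Posz m => iter m (dyn_map (d:=X)) x
  | Negz m => iter m.+1 (dyn_inv (d:=X)) x
  end.

Lemma dyn_iterS n x : dyn_iter (n + 1) x = dyn_map (dyn_iter n x).
Proof.
case: n => [m|[|m]].
- by rewrite -PoszD addn1.
- by rewrite /= dyn_invK.
- rewrite (_ : Negz m.+1 + 1 = Negz m); first by rewrite /= dyn_invK.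
  by rewrite !NegzE -[m.+2]addn1 PoszD opprD subrK.
Qed.

Lemma dyn_iterD m n x : dyn_iter (m + n) x = dyn_iter m (dyn_iter n x).
Proof.
have mapI := can_inj (@dyn_mapK X).
elim/int_rect: m => [|m ih|m ih]; first by rewrite add0r.
  by rewrite intS -addrA addrC dyn_iterS ih [1 + _]addrC dyn_iterS.
apply: mapI; rewrite -!dyn_iterS -addrA [n + 1]addrC addrA.
by rewrite (_ : - (m.+1)%:Z + 1 = - m%:Z) ?ih// intS opprD addrAC addNr add0r.
Qed.

Lemma dyn_iter0 x : dyn_iter 0 x = x. Proof. by []. Qed.

Lemma dyn_iter_continuous n : continuous (dyn_iter n).
Proof.
have it (f : X -> X) (cf : continuous f) m : continuous (iter m f).
  elim: m => [|m ih] x /=; first exact: cvg_id.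
  by apply: continuous_comp; [exact: ih|exact: cf].
by case: n => m; apply: it; [exact: dyn_map_continuous|exact: dyn_inv_continuous].
Qed.

End Dyn.

Lemma gt0_realC (R : realType) (z : R[i]) : 0 < z -> exists2 e : R, z = e%:C & 0 < e.
Proof.
move=> z0; exists (complex.Re z).
  by move: (ger0_Im (ltW z0)); case: (z) => u v /= ->.
by move: z0; rewrite ltcE => /andP[].
Qed.

Lemma continuousCD (R : realType) (X : topologicalType) (f g : X -> R[i]) :
  continuous f -> continuous g -> continuous (fun x => f x + g x).
Proof.
by move=> cf cg x; exact: (@cvgD R[i] R[i] X (nbhs x) _ f g _ _ (cf x) (cg x)).
Qed.

Lemma continuousCM (R : realType) (X : topologicalType) (f g : X -> R[i]) :
  continuous f -> continuous g -> continuous (fun x => f x * g x).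
Proof.
by move=> cf cg x; exact: (@cvgM R[i] X (nbhs x) _ f g _ _ (cf x) (cg x)).
Qed.

Section Ell1.
Context {R : realType} {X : dynsys}.
Implicit Types f g : X -> R[i].

Definition supnorm f : R := sup (range (fun x => normc (f x))).

Lemma normc_continuous : continuous (normc : R[i] -> R).
Proof.
move=> z; rewrite /continuous_at. apply/(@cvgrPdist_lt _ R _ (nbhs z)) => e e0.
have eC : 0 < e%:C :> R[i] by rewrite -[0]/(0%:C) ltcR.
near=> w.
have : `|z - w| < e%:C by near: w; exact: (@cvgr_dist_lt _ _ _ _ _ id z).
rewrite normcE' ltcR; apply: le_lt_trans.
have tri u v : normc u - normc v <= normc (u - v :> R[i]).
  by rewrite lerBlDr; apply: le_trans (normcD' _ _); rewrite subrK.
rewrite ler_norml tri andbT lerNl opprB; apply: le_trans (tri _ _) _.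
by rewrite -opprB -lecR -!normcE' normrN.
Unshelve. all: by end_near. Qed.

Lemma normc_le_supnorm f x : continuous f -> normc (f x) <= supnorm f.
Proof.
move=> cf; apply: ub_le_sup; last by exists x.
have : compact (range (fun x => normc (f x))).
  apply: continuous_compact; last exact: dyn_compact.
  apply: continuous_subspaceT => y; apply: continuous_comp; first exact: cf.
  exact: normc_continuous.
move=> /compact_bounded[M [_ hM]]; exists (M + 1) => _ [y _ <-].
by apply: le_trans (ler_norm _) _; apply: hM; [rewrite ltrDl|exists y].
Qed.

Lemma supnorm_le f M : (forall x, normc (f x) <= M) -> supnorm f <= M.
Proof.
move=> h; apply: ge_sup; last by move=> _ [x _ <-].
by have [x _] := dyn_nonempty X; exists (normc (f x)), x.
Qed.

Lemma supnorm_ge0 f : 0 <= supnorm f.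
Proof.
have [x _] := dyn_nonempty X.
have [h|h] := pselect (has_sup (range (fun x => normc (f x)))).
  apply: le_trans (normc_ge0 (f x)) _; apply: ub_le_sup; first by case: h.
  by exists x.
by rewrite /supnorm sup_out.
Qed.

Record ell1 := Ell1 {
  ell1_fun :> int -> X -> R[i];
  ell1_continuous : forall n, continuous (ell1_fun n);
  ell1_summable : (\esum_(n in [set: int]) (supnorm (ell1_fun n))%:E < +oo)%E }.

Lemma ell1P (a b : ell1) : (forall n x, a n x = b n x) -> a = b.
Proof.
case: a b => [a ca sa] [b cb sb] /= ab.
have {ab} ? : a = b by apply/funext => n; apply/funext.
by subst b; congr Ell1; exact: Prop_irrelevance.
Qed.

Lemma ell1_bsum (a : ell1) : bsum (fun n => supnorm (a n)).
Proof. by apply/esum_bsum; [move=> ?; exact: supnorm_ge0|exact: ell1_summable]. Qed.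

Lemma bsum_ell1 (a : int -> X -> R[i]) : bsum (fun n => supnorm (a n)) ->
  (\esum_(n in [set: int]) (supnorm (a n))%:E < +oo)%E.
Proof. by move=> h; apply/esum_bsum => // ?; exact: supnorm_ge0. Qed.

Lemma ell1_le (a : ell1) n x : normc (a n x) <= supnorm (a n).
Proof. by apply: normc_le_supnorm; exact: ell1_continuous. Qed.

Lemma ell1_add_continuous (a b : ell1) n : continuous (fun x => a n x + b n x).
Proof. by apply: continuousCD; exact: ell1_continuous. Qed.

Lemma ell1_add_bsum (a b : ell1) : bsum (fun n => supnorm (fun x => a n x + b n x)).
Proof.
apply: bsum_le (bsumD (ell1_bsum a) (ell1_bsum b)) => n.
apply: supnorm_le => x; apply: le_trans (normcD' _ _) _.
by apply: lerD; exact: ell1_le.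
Qed.

Lemma ell1_scale_continuous c (a : ell1) n : continuous (fun x => c * a n x).
Proof. by apply: continuousCM; [exact: cst_continuous|exact: ell1_continuous]. Qed.

Lemma ell1_scale_bsum c (a : ell1) : bsum (fun n => supnorm (fun x => c * a n x)).
Proof.
apply: bsum_le (bsumZ (normc_ge0 c) (ell1_bsum a)) => n.
apply: supnorm_le => x; rewrite ComplexField.Normc.normcM.
by rewrite ler_wpM2l ?normc_ge0//; exact: ell1_le.
Qed.

Definition ell1_add (a b : ell1) : ell1 :=
  Ell1 (@ell1_add_continuous a b) (bsum_ell1 (ell1_add_bsum a b)).

Definition ell1_scale (c : R[i]) (a : ell1) : ell1 :=
  Ell1 (@ell1_scale_continuous c a) (bsum_ell1 (ell1_scale_bsum c a)).

Lemma supnorm0 : supnorm (fun _ => 0) = 0.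
Proof.
apply/eqP; rewrite eq_le supnorm_ge0 andbT; apply: supnorm_le => x.
by rewrite ComplexField.Normc.normc0.
Qed.

Lemma bsum_single (n : int) f :
  bsum (fun m => supnorm (if m == n then f else fun _ => 0)).
Proof.
pose F m := supnorm (if m == n then f else fun _ => 0).
have F0 m : m != n -> F m = 0 by move=> /negPf mn; rewrite /F mn supnorm0.
have Fn : F n = supnorm f by rewrite /F eqxx.
exists (supnorm f) => A; rewrite -[leLHS]/(\sum_(i <- A) F i).
clearbody F; case: (boolP (n \in A)) => nA.
  by rewrite (bigD1_seq n nA (fset_uniq A))/= Fn big1 ?addr0// => i /F0.
rewrite big_seq_cond big1 ?supnorm_ge0// => i /andP[iA _]; apply: F0.
by apply: contraNneq nA => <-.
Qed.

Lemma ell1_single_continuous f (n : int) : continuous f ->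
  forall m : int, continuous (if m == n then f else fun _ => 0).
Proof.
move=> cf m; case: (m == n); first exact: cf.
exact: (@cst_continuous X R[i] 0).
Qed.

(* f delta^n *)
Definition ell1_single f (cf : continuous f) (n : int) : ell1 :=
  Ell1 (@ell1_single_continuous f n cf) (bsum_ell1 (bsum_single n f)).

Definition ell1_zero : ell1 := ell1_single (@cst_continuous X R[i] 0) 0.
Definition ell1_one : ell1 := ell1_single (@cst_continuous X R[i] 1) 0.

(* The series sum_k a(k) alpha^k(b(n - k)) converges absolutely in C(X), where
   alpha^k(f) = f o sigma^(-k), so its sum is computed pointwise. *)
Definition ell1_conv (a b : int -> X -> R[i]) (n : int) (x : X) : R[i] :=
  zsum (fun k => a k x * b (n - k) (dyn_iter (- k) x)).

Lemma ell1_conv_le (a b : ell1) n x k : 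
  normc (a k x * b (n - k) (dyn_iter (- k) x)) <= supnorm (a k) * supnorm (b (n - k)).
Proof.
rewrite ComplexField.Normc.normcM ler_pM ?normc_ge0//; exact: ell1_le.
Qed.

Lemma ell1_convB (a b : ell1) :
  bsum (fun p : int * int => supnorm (a p.2) * supnorm (b (p.1 - p.2))).
Proof.
have h : injective (fun p : int * int => (p.2, p.1 - p.2)).
  by move=> [i j] [i' j'] /= [-> /addIr ->].
have := bsum_inj h (bsum_prod (fun=> supnorm_ge0 _) (fun=> supnorm_ge0 _)
  (ell1_bsum a) (ell1_bsum b)).
by apply: bsum_le => p; exact: lexx.
Qed.

Lemma ell1_convB1 (a b : ell1) n :
  bsum (fun k => supnorm (a k) * supnorm (b (n - k))).
Proof.
have h : injective (fun k : int => (n, k)) by move=> i j [].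
exact: bsum_inj h (ell1_convB a b).
Qed.

Lemma ell1_conv_sum (a b : ell1) n x :
  has_sum (fun k => a k x * b (n - k) (dyn_iter (- k) x)) (ell1_conv a b n x).
Proof. exact: bsum_zsum (ell1_conv_le a b n x) (ell1_convB1 a b n). Qed.

Lemma ell1_conv_continuous (a b : ell1) n : continuous (ell1_conv a b n).
Proof.
move=> x; apply/(@cvgrPdist_lt _ R[i] _ (nbhs x)) => e' /gt0_realC[e -> e0].
pose g k := supnorm (a k) * supnorm (b (n - k)).
have g0 k : 0 <= g k by rewrite mulr_ge0 ?supnorm_ge0.
have [S hS] := bsum_has_sum0 g0 (ell1_convB1 a b n).
have e3 : 0 < e / 3 by rewrite divr_gt0.
have e6 : 0 < e / 3 / 2 by rewrite divr_gt0.
have [A hA] := hS _ e6.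
pose p y := \sum_(k <- A) a k y * b (n - k) (dyn_iter (- k) y).
have hp y : normc (ell1_conv a b n y - p y) <= e / 3.
  rewrite -lecR -normcE'.
  have hc : has_sum (fun k => a k y * b (n - k) (dyn_iter (- k) y) -
      (if k \in A then a k y * b (n - k) (dyn_iter (- k) y) else 0))
     (ell1_conv a b n y - p y).
    apply: (has_sumD (ell1_conv_sum a b n y) (t := - p y)
      (g := fun k => - if k \in A then _ else _)).
    apply: has_sumN => d d0; exists A => B AB.
    rewrite -big_mkcond /= (_ : \sum_(i <- B | i \in A) _ = p y) ?subrr ?normr0//.
    rewrite -big_filter; apply: perm_big; apply: uniq_perm => //.
      by rewrite filter_uniq.
    move=> k; rewrite mem_filter; case: (boolP (k \in A)) => // kA.
    by move/fsubsetP: AB => ->.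
  apply: (has_sum_le hc (A := A)) => B AB.
  apply: le_trans (ler_norm_sum _ _ _) _.
  under eq_bigr do rewrite normcE'.
  rewrite -rmorph_sum/= lecR.
  apply: (@le_trans _ _ (\sum_(k <- B) (g k - (if k \in A then g k else 0)))).
    apply: ler_sum => k _; case: ifP => _; first by rewrite !subrr ComplexField.Normc.normc0.
    by rewrite !subr0; exact: ell1_conv_le.
  rewrite sumrB -big_mkcond/= (_ : \sum_(i <- B | i \in A) _ = \sum_(i <- A) g i).
    have h1 := hA _ (fsubset_refl A); have h2 := hA _ AB.
    rewrite (splitr (e / 3)).
    rewrite -[X in X - _](subrK S) -addrA; apply: lerD.
      by apply: le_trans (ler_norm _) (ltW h2).
    by apply: le_trans (ler_norm _) _; rewrite distrC ltW.
  rewrite -big_filter; apply: perm_big; apply: uniq_perm => //.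
    by rewrite filter_uniq.
  move=> k; rewrite mem_filter; case: (boolP (k \in A)) => // kA.
  by move/fsubsetP: AB => ->.
have cp : continuous p.
  rewrite /p; elim: (enum_fset A) => [|k r ih].
    by under eq_fun do rewrite big_nil; exact: cst_continuous.
  under eq_fun do rewrite big_cons.
  apply: continuousCD ih; apply: continuousCM; first exact: ell1_continuous.
  move=> y; apply: continuous_comp; first exact: dyn_iter_continuous.
  exact: ell1_continuous.
have e3C : 0 < (e / 3)%:C :> R[i] by rewrite -[0]/(0%:C) ltcR.
near=> y.
have : `|p x - p y| < (e / 3)%:C.
  by near: y; move/cvgrPdist_lt : (cp x) => /(_ _ e3C).
rewrite !normcE' !ltcR => h1.
have -> : ell1_conv a b n x - ell1_conv a b n y =
   (ell1_conv a b n x - p x) + (p x - p y) + (- (ell1_conv a b n y - p y)).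
  by rewrite addrA subrK opprB addrA subrK.
apply: le_lt_trans (normcD' _ _) _.
have -> : e = e / 3 + e / 3 + e / 3 by lra.
apply: ltr_leD; last by rewrite -lecR -normcE' normrN normcE' lecR.
by apply: le_lt_trans (normcD' _ _) _; exact: ler_ltD.
Unshelve. all: by end_near. Qed.

Lemma ell1_conv_supnorm (a b : ell1) :
  bsum (fun n => supnorm (ell1_conv a b n)).
Proof.
have g0 k n : 0 <= supnorm (a k) * supnorm (b (n - k)).
  by rewrite mulr_ge0 ?supnorm_ge0.
have /boolp.choice[h hh] (n : int) : exists s,
    has_sum (fun k => supnorm (a k) * supnorm (b (n - k))) s.
  exact: bsum_has_sum0 (ell1_convB1 a b n).
have hle n : supnorm (ell1_conv a b n) <= h n.
  apply: supnorm_le => x; apply: (has_sum_normc (ell1_conv_sum a b n x)) => A.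
  apply: le_trans (ler_sum _ (fun k _ => ell1_conv_le a b n x k)) _.
  apply/ler_addgt0Pr => e e0; have [B hB] := hh n _ e0.
  apply: (@le_trans _ _ (\sum_(k <- (A `|` B)%fset) supnorm (a k) * supnorm (b (n - k)))).
    by apply: ler_sum_fset => //; exact: fsubsetUl.
  rewrite -lerBlDl; apply: le_trans (ler_norm _) (ltW (hB _ _)).
  exact: fsubsetUr.
apply: (bsum_le hle).
have [M hM] := ell1_convB a b; exists M => A.
have h0 n : 0 <= h n by apply: le_trans (hle n); exact: supnorm_ge0.
have hs := has_sum_sum A hh.
apply: le_trans (ler_norm _) _.
apply: (has_sum_le hs (A := fset0)) => B _; rewrite ger0_norm; last first.
  by apply: sumr_ge0 => k _; apply: sumr_ge0 => m _; exact: g0.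
rewrite exchange_big/=.
have := hM (A `*` B)%fset; rewrite big_fsetM; exact.
Qed.

Definition ell1_mul (a b : ell1) : ell1 :=
  Ell1 (@ell1_conv_continuous a b) (bsum_ell1 (ell1_conv_supnorm a b)).

End Ell1.
Arguments ell1 : clear implicits.

Section Ell1Algebra.
Context {R : realType} {X : dynsys}.
Local Notation A := (ell1 R X).
Implicit Types a b c : A.

HB.instance Definition _ := gen_eqMixin A.
HB.instance Definition _ := gen_choiceMixin A.

Lemma ell1_zeroE n x : (ell1_zero : A) n x = 0.
Proof. by rewrite /ell1_zero/=; case: ifP. Qed.

Fact ell1_addA : associative (@ell1_add R X).
Proof. by move=> a b c; apply: ell1P => n x /=; rewrite addrA. Qed.
Fact ell1_addC : commutative (@ell1_add R X).
Proof. by move=> a b; apply: ell1P => n x /=; rewrite addrC. Qed.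
Fact ell1_add0 : left_id (ell1_zero : A) (@ell1_add R X).
Proof. by move=> a; apply: ell1P => n x; rewrite -[LHS]/(ell1_zero n x + a n x) ell1_zeroE add0r. Qed.
Fact ell1_addN : left_inverse (ell1_zero : A) (ell1_scale (-1)) (@ell1_add R X).
Proof. by move=> a; apply: ell1P => n x; rewrite ell1_zeroE /= mulN1r addNr. Qed.

HB.instance Definition _ :=
  GRing.isZmodule.Build A ell1_addA ell1_addC ell1_add0 ell1_addN.

Lemma ell1_addE a b n x : (a + b) n x = a n x + b n x. Proof. by []. Qed.

Fact ell1_scaleA s t a : ell1_scale s (ell1_scale t a) = ell1_scale (s * t) a.
Proof. by apply: ell1P => n x /=; rewrite mulrA. Qed.
Fact ell1_scale1 : left_id 1 (@ell1_scale R X).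
Proof. by move=> a; apply: ell1P => n x /=; rewrite mul1r. Qed.
Fact ell1_scaleDr : right_distributive (@ell1_scale R X) +%R.
Proof. by move=> s a b; apply: ell1P => n x /=; rewrite mulrDr. Qed.
Fact ell1_scaleDl a : {morph (ell1_scale^~ a) : s t / s + t}.
Proof. by move=> s t; apply: ell1P => n x /=; rewrite mulrDl. Qed.

HB.instance Definition _ := GRing.Zmodule_isLmodule.Build R[i] A
  ell1_scaleA ell1_scale1 ell1_scaleDr ell1_scaleDl.

Lemma ell1_scaleE s a n x : (s *: a) n x = s * a n x. Proof. by []. Qed.

Lemma ell1_oneE n x : (ell1_one : A) n x = if n == 0 then 1 else 0.
Proof. by rewrite /ell1_one/=; case: ifP. Qed.

Fact ell1_mul1 : left_id (ell1_one : A) (@ell1_mul R X).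
Proof.
move=> a; apply: ell1P => n x; apply: has_sum_unique (ell1_conv_sum _ _ _ _) _.
rewrite [X in has_sum _ X](_ : _ =
    (ell1_one : A) 0 x * a (n - 0) (dyn_iter (- 0) x)); last first.
  by rewrite ell1_oneE eqxx mul1r subr0 oppr0 dyn_iter0.
apply: (has_sum1 (i0 := 0 : int)) => k /negPf k0.
by rewrite ell1_oneE k0 mul0r.
Qed.

Fact ell1_mulr1 : right_id (ell1_one : A) (@ell1_mul R X).
Proof.
move=> a; apply: ell1P => n x; apply: has_sum_unique (ell1_conv_sum _ _ _ _) _.
rewrite [X in has_sum _ X](_ : _ =
    a n x * (ell1_one : A) (n - n) (dyn_iter (- n) x)); last first.
  by rewrite ell1_oneE subrr eqxx mulr1.
apply: (has_sum1 (i0 := n)) => k kn.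
by rewrite ell1_oneE subr_eq0 eq_sym (negPf kn) mulr0.
Qed.

Fact ell1_mulDl : left_distributive (@ell1_mul R X) +%R.
Proof.
move=> a b c; apply: ell1P => n x; apply: has_sum_unique (ell1_conv_sum _ _ _ _) _.
have := has_sumD (ell1_conv_sum a c n x) (ell1_conv_sum b c n x).
by congr has_sum; apply/funext => k; rewrite -mulrDl.
Qed.

Fact ell1_mulDr : right_distributive (@ell1_mul R X) +%R.
Proof.
move=> a b c; apply: ell1P => n x; apply: has_sum_unique (ell1_conv_sum _ _ _ _) _.
have := has_sumD (ell1_conv_sum a b n x) (ell1_conv_sum a c n x).
by congr has_sum; apply/funext => k; rewrite -mulrDr.
Qed.

Fact ell1_scaleAl s a b : s *: ell1_mul a b = ell1_mul (s *: a) b.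
Proof.
apply: ell1P => n x; apply: esym.
apply: has_sum_unique (ell1_conv_sum _ _ _ _) _.
have := has_sumZ s (ell1_conv_sum a b n x).
by congr has_sum; apply/funext => k; rewrite mulrA.
Qed.

Fact ell1_scaleAr s a b : s *: ell1_mul a b = ell1_mul a (s *: b).
Proof.
apply: ell1P => n x; apply: esym.
apply: has_sum_unique (ell1_conv_sum _ _ _ _) _.
have := has_sumZ s (ell1_conv_sum a b n x).
by congr has_sum; apply/funext => k; rewrite mulrCA.
Qed.

Fact ell1_mulA : associative (@ell1_mul R X).
Proof.
move=> a b c; apply: ell1P => n x.
pose F (p : int * int) := a p.2 x * b (p.1 - p.2) (dyn_iter (- p.2) x) *
   c (n - p.1) (dyn_iter (- p.1) x).
pose G (p : int * int) := supnorm (a p.2) * supnorm (b (p.1 - p.2)).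
have [M hM] := ell1_bsum c.
have cM k : supnorm (c k) <= M.
  by have := hM [fset k]%fset; rewrite big_seq_fset1.
have M0 : 0 <= M := le_trans (supnorm_ge0 _) (cM 0).
have FG p : normc (F p) <= M * G p.
  rewrite /F !ComplexField.Normc.normcM mulrC; apply: ler_pM.
  - exact: normc_ge0.
  - by rewrite mulr_ge0 ?normc_ge0.
  - exact: le_trans (ell1_le _ _ _) (cM _).
  - by apply: ler_pM; rewrite ?normc_ge0//; exact: ell1_le.
have [s hs] := bsum_has_sum FG (bsumZ M0 (ell1_convB a b)).
transitivity s.
  apply: has_sum_unique (ell1_conv_sum _ _ _ _) _.
  pose hh (q : int * int) := (q.1 + q.2, q.1).
  pose hh' (q : int * int) := (q.2, q.1 - q.2).
  have hK : cancel hh hh' by move=> [u v]; rewrite /hh/hh'/= addrAC subrr add0r.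
  have hK' : cancel hh' hh by move=> [u v]; rewrite /hh/hh'/= addrC subrK.
  apply: (has_sum_fubini (has_sum_reindex hK hK' hs)) => k.
  have := has_sumZ (a k x) (ell1_conv_sum b c (n - k) (dyn_iter (- k) x)).
  congr has_sum; apply/funext => l; rewrite /F/= mulrA -dyn_iterD.
  by rewrite [k + l - k]addrAC subrr add0r opprD addrA [- k - l]addrC.
apply: esym; apply: has_sum_unique (ell1_conv_sum _ _ _ _) _.
apply: (has_sum_fubini hs) => l.
have := has_sumZ (c (n - l) (dyn_iter (- l) x)) (ell1_conv_sum a b l x).
by rewrite mulrC; congr has_sum; apply/funext => k; rewrite mulrC.
Qed.

Fact ell1_one_neq0 : (ell1_one : A) != 0.
Proof.
apply/eqP => h; have [x _] := dyn_nonempty X.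
have := congr1 (fun a : A => a 0 x) h; rewrite /= => /eqP.
by rewrite oner_eq0.
Qed.

HB.instance Definition _ := GRing.Zmodule_isNzRing.Build A
  ell1_mulA ell1_mul1 ell1_mulr1 ell1_mulDl ell1_mulDr ell1_one_neq0.
HB.instance Definition _ := GRing.Lmodule_isLalgebra.Build R[i] A ell1_scaleAl.
HB.instance Definition _ := GRing.Lalgebra_isAlgebra.Build R[i] A ell1_scaleAr.

Lemma ell1_mulE a b n x :
  (a * b) n x = zsum (fun k => a k x * b (n - k) (dyn_iter (- k) x)).
Proof. by []. Qed.

End Ell1Algebra.

Section PrimitiveSpectrum.
Context {K : fieldType} {A : algType K}.

Definition representation (E : lmodType K) (pi : A -> E -> E) :=
  [/\ forall a, linear (pi a),
      forall v, linear (pi ^~ v) &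
      forall a b v, pi (a * b) v = pi a (pi b v)].

Definition invariant_subspace (E : lmodType K) (pi : A -> E -> E) (W : set E) :=
  [/\ W 0,
      forall c u v, W u -> W v -> W (c *: u + v) &
      forall a v, W v -> W (pi a v)].

Definition alg_irreducible (E : lmodType K) (pi : A -> E -> E) :=
  [/\ representation pi,
      exists a v, pi a v <> 0 &
      forall W, invariant_subspace pi W -> W = [set 0] \/ W = [set: E]].

Definition rep_ker (E : lmodType K) (pi : A -> E -> E) : set A :=
  [set a | forall v, pi a v = 0].

Definition primitive_ideal (P : set A) :=
  exists (E : lmodType K) (pi : A -> E -> E), alg_irreducible pi /\ P = rep_ker pi.

Lemma rep_ker_idealr (E : lmodType K) (pi : A -> E -> E) a b :
  representation pi -> rep_ker pi a -> rep_ker pi (a * b).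
Proof. by move=> [_ _ pM] ha v; rewrite pM ha. Qed.

Lemma rep_ker_ideall (E : lmodType K) (pi : A -> E -> E) a b :
  representation pi -> rep_ker pi b -> rep_ker pi (a * b).
Proof.
move=> [pl _ pM] hb v; rewrite pM hb.
by have := pl a (-1) 0 0; rewrite scaler0 addr0 scaleN1r addNr.
Qed.

Lemma primitive_prime (P : set A) a b : primitive_ideal P ->
  ~ P a -> ~ P b -> exists c, ~ P (a * c * b).
Proof.
move=> [E [pi [[[pl pr pM] [a0 [v0 nz]] irr] ->]]] /existsNP[u hu] /existsNP[w hw].
apply: contrapT => /forallNP h0.
have h c v : pi a (pi c (pi b v)) = 0.
  by have /contrapT/(_ v) := h0 c; rewrite !pM.
have pl0 d : pi d 0 = 0.
  by have := pl d (-1) 0 0; rewrite scaler0 addr0 scaleN1r addNr.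
have pr0 v : pi 0 v = 0.
  by have := pr v (-1) 0 0; rewrite scaler0 addr0 scaleN1r addNr.
pose W := [set pi c (pi b w) | c in [set: A]].
case: (irr W) => [|W0|WT].
- split; first by exists 0; rewrite ?pr0.
    by move=> k _ _ [c _ <-] [d _ <-]; exists (k *: c + d); rewrite ?pr.
  by move=> d _ [c _ <-]; exists (d * c); rewrite ?pM.
- pose N := [set v | forall c, pi c v = 0].
  have bN : N (pi b w).
    move=> c; suff : W (pi c (pi b w)) by rewrite W0.
    by exists c.
  case: (irr N) => [|N0|NT].
  + split => [c|k u' v' hu' hv' c|c v' hv' c']; first exact: pl0.
      by rewrite pl hu' hv' scaler0 addr0.
    by rewrite hv' pl0.
  + by apply: hw; move: bN; rewrite N0.
  + by apply: nz; have : N v0 by rewrite NT.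
- apply: hu; have : W u by rewrite WT.
  by move=> [c _ <-].
Qed.

Record primitive_spectrum := PrimitiveIdeal {
  prim_set :> set A;
  prim_setP : primitive_ideal prim_set }.

HB.instance Definition _ := gen_eqMixin primitive_spectrum.
HB.instance Definition _ := gen_choiceMixin primitive_spectrum.

Definition hull_kernel (E : set primitive_spectrum) : set primitive_spectrum :=
  [set P | \bigcap_(Q in E) (Q : set A) `<=` P].

Lemma subset_hull_kernel E : E `<=` hull_kernel E.
Proof. by move=> P EP a; exact. Qed.

Lemma hull_kernelS E F : E `<=` F -> hull_kernel E `<=` hull_kernel F.
Proof. by move=> EF P hP a Fa; apply: hP => Q /EF; exact: Fa. Qed.

Lemma hull_kernelK E : hull_kernel (hull_kernel E) `<=` hull_kernel E.
Proof. by move=> P hP a Ea; apply: hP => Q; exact. Qed.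

Lemma hull_kernelU E F :
  hull_kernel (E `|` F) `<=` hull_kernel E `|` hull_kernel F.
Proof.
move=> P hP; apply: contrapT => /not_orP[].
move=> /existsNP[a /not_implyP[Ea Pa]] /existsNP[b /not_implyP[Fb Pb]].
have [c hc] := primitive_prime (prim_setP P) Pa Pb.
apply: hc; apply: hP => Q [EQ|FQ]; have [M [pi [[rpi _ _] Qpi]]] := prim_setP Q;
  rewrite Qpi.
  by do 2 apply: rep_ker_idealr => //; rewrite -Qpi; exact: Ea.
by apply: rep_ker_ideall => //; rewrite -Qpi; exact: Fb.
Qed.

(* U is open when its complement is equal to its own hull-kernel closure; see
   closure_hull_kernel below. *)
Definition hk_open (U : set primitive_spectrum) := hull_kernel (~` U) `<=` ~` U.

Fact hk_openT : hk_open setT.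
Proof.
move=> P hP _; have [E [pi [[_ [a [v av]] _] PE]]] := prim_setP P.
have : (P : set A) a by apply: hP => Q /(_ I).
by rewrite PE => /(_ v).
Qed.

Fact hk_openI U V : hk_open U -> hk_open V -> hk_open (U `&` V).
Proof.
move=> oU oV; rewrite /hk_open setCI => P /hull_kernelU[/oU|/oV]; first by left.
by right.
Qed.

Fact hk_open_bigU (I : Type) (f : I -> set primitive_spectrum) :
  (forall i, hk_open (f i)) -> hk_open (\bigcup_i f i).
Proof.
move=> of_ P; rewrite setC_bigcup => hP i _; apply: of_.
by apply: hull_kernelS hP => Q; exact.
Qed.

HB.instance Definition _ := isOpenTopological.Build primitive_spectrum
  hk_openT hk_openI hk_open_bigU.

Lemma closure_hull_kernel (E : set primitive_spectrum) : closure E = hull_kernel E.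
Proof.
apply/seteqP; split; last first.
  move=> P hP; rewrite closureE => F [cF EF].
  have /= : hk_open (~` F) by move: cF; rewrite -openC.
  by rewrite /hk_open setCK; apply; exact: hull_kernelS hP.
move=> P; rewrite closureE; apply; split; last exact: subset_hull_kernel.
rewrite -openC /open/= /hk_open setCK; exact: hull_kernelK.
Qed.

End PrimitiveSpectrum.
Arguments primitive_spectrum {K} A.

Definition homeomorphism (T U : topologicalType) (f : T -> U) :=
  continuous f /\ exists g, [/\ continuous g, cancel f g & cancel g f].

Definition homeomorphic (T U : topologicalType) := exists f : T -> U, homeomorphism f.

Definition metrizable (R : realType) (T : topologicalType) :=
  exists M : metricType R, homeomorphic T M.

Definition topological_sum (I : choiceType) (T : I -> topologicalType) : topologicalType :=
  {i & T i}.

Definition unit_circle (R : realType) : set R[i] := [set z | `|z| = 1].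

Arguments unit_circle : clear implicits.

Section Orbits.
Context {X : dynsys}.
Implicit Types (x : X) (S : set X).

Definition dyn_orbit x : set X := range (fun n => dyn_iter n x).
Definition Per : set X := [set x | finite_set (dyn_orbit x)].
Definition Aper : set X := [set x | infinite_set (dyn_orbit x)].
Definition Per_ (p : nat) : set X := [set x | (dyn_orbit x #= `I_p)%card].
Definition invariant_set S := @dyn_map X @` S = S.

Definition orbit_rel S (x y : S) : bool := `[< dyn_orbit (\val x) (\val y) >].

Fact orbit_rel_refl S : reflexive (@orbit_rel S).
Proof. by move=> x; apply/asboolP; exists 0. Qed.

Fact orbit_rel_sym S : symmetric (@orbit_rel S).
Proof.
move=> x y; apply/asboolP/asboolP => -[n _ h]; exists (- n) => //;
  by rewrite -h -dyn_iterD addNr.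
Qed.

Fact orbit_rel_trans S : transitive (@orbit_rel S).
Proof.
move=> y x z /asboolP[m _ h] /asboolP[n _ h']; apply/asboolP; exists (n + m) => //.
by rewrite dyn_iterD h.
Qed.

Definition orbit_equiv S : equiv_rel (set_type S) :=
  EquivRel (@orbit_rel S) (@orbit_rel_refl S) (@orbit_rel_sym S)
    (@orbit_rel_trans S).

Definition orbit_space S : topologicalType :=
  quotient_topology {eq_quot orbit_equiv S}%qT.

Definition to_orbit S (x : S) : orbit_space S := (\pi_({eq_quot orbit_equiv S}) x)%qT.

End Orbits.
Arguments Per : clear implicits.
Arguments Per_ : clear implicits.

Section Ideals.
Context {R : realType} {X : dynsys}.
Local Notation A := (ell1 R X).

Definition ell1_delta : A := ell1_single (@cst_continuous X R[i] 1) 1.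
Definition ell1_fct (g : X -> R[i]) (cg : continuous g) : A := ell1_single cg 0.

Lemma ell1_singleE (g : X -> R[i]) (cg : continuous g) (n m : int) x :
  (ell1_single cg n : A) m x = if m == n then g x else 0.
Proof. by rewrite /ell1_single/=; case: ifP. Qed.

(* The operator pi_{x,lam}(a) = sum_n pi(f_n) pi(delta)^n, where a(n) = f_n: since
   pi(delta)^n e_j = lam^q e_i for j + n = q p + i with 0 <= i < p, the
   coefficient of e_i in pi(f_n delta^n) e_j is f_n(sigma^i x) lam^q.
   See per_rep_fct, per_rep_delta and per_rep_delta_last for the generators. *)
Definition per_mx (p : nat) (x : X) (lam : R[i]) (a : A) : 'M[R[i]]_p :=
  \matrix_(i, j) zsum (fun n : int =>
    if ((j%:Z + n) %% p%:Z)%Z == i%:Z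
    then a n (dyn_iter i x) * lam ^ ((j%:Z + n) %/ p%:Z)%Z else 0).

Definition per_rep (p : nat) (x : X) (lam : R[i]) (a : A) (v : 'cV[R[i]]_p) :
  'cV[R[i]]_p := per_mx p x lam a *m v.

Definition per_ideal (p : nat) (x : X) (lam : R[i]) : set A :=
  rep_ker (@per_rep p x lam).

Definition ell1Z (v : int -> R[i]) :=
  (\esum_(k in [set: int]) (normc (v k))%:E < +oo)%E.

(* pi_x^1(a) v = sum_n pi(f_n) pi(delta)^n v, where a(n) = f_n; see aper_rep_fct
   and aper_rep_delta for the generators. *)
Definition aper_rep (x : X) (a : A) (v : int -> R[i]) (m : int) : R[i] :=
  zsum (fun n => a n (dyn_iter m x) * v (m - n)).

Definition aper_ideal (x : X) : set A :=
  [set a | forall v, ell1Z v -> aper_rep x a v = fun=> 0].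

Definition Pi_ell1 (S : set X) : set (primitive_spectrum A) :=
  [set P | (exists p x (lam : R[i]), [/\ dyn_orbit x `<=` S, Per_ X p x,
               unit_circle R lam & P = per_ideal p x lam :> set A]) \/
           (exists x, [/\ dyn_orbit x `<=` S, Aper x & P = aper_ideal x :> set A])].

Lemma aper_rep_fct (x : X) (g : X -> R[i]) (cg : continuous g) (k : int) :
  aper_rep x (ell1_fct cg) (fun m => (m == k)%:R) =
  fun m => g (dyn_iter k x) * (m == k)%:R.
Proof.
apply/funext => m; apply: zsumE.
rewrite (_ : _ * _ = (ell1_fct cg : A) 0 (dyn_iter m x) * (m - 0 == k)%:R).
  by apply: (has_sum1 (i0 := 0 : int)) => n n0; rewrite ell1_singleE (negPf n0) mul0r.
rewrite ell1_singleE eqxx subr0.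
by case: (eqVneq m k) => [->|_]; rewrite ?mulr0.
Qed.

Lemma aper_rep_delta (x : X) (k : int) :
  aper_rep x ell1_delta (fun m => (m == k)%:R) = fun m => (m == k + 1)%:R.
Proof.
apply/funext => m; apply: zsumE.
rewrite (_ : _%:R = (ell1_delta : A) 1 (dyn_iter m x) * (m - 1 == k)%:R).
  by apply: (has_sum1 (i0 := 1 : int)) => n n0; rewrite ell1_singleE (negPf n0) mul0r.
by rewrite ell1_singleE eqxx mul1r subr_eq.
Qed.

Lemma per_rep_fct p (x : X) lam (g : X -> R[i]) (cg : continuous g) (j : 'I_p) :
  per_rep x lam (ell1_fct cg) (delta_mx j 0) =
  g (dyn_iter j x) *: (delta_mx j 0 : 'cV_p).
Proof.
apply/colP => i; rewrite /per_rep -colE !mxE eqxx andbT; apply: zsumE.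
pose F (n : int) := if ((j%:Z + n) %% p%:Z)%Z == i%:Z
  then (ell1_fct cg : A) n (dyn_iter i x) * lam ^ ((j%:Z + n) %/ p%:Z)%Z else 0.
rewrite (_ : _ * _ = F 0).
  apply: has_sum1 => n n0; rewrite /F ell1_singleE (negPf n0) mul0r.
  by case: ifP.
rewrite /F addr0 ell1_singleE eqxx modz_small ?divz_small ?ltz_nat ?ltn_ord//.
rewrite expr0z mulr1 eqz_nat eq_sym; case: (eqVneq (j : nat) i) => [ji|ji].
  by rewrite (val_inj ji) eqxx mulr1.
by rewrite -(inj_eq val_inj) /= (negPf ji) mulr0.
Qed.

Lemma per_rep_deltaE p (x : X) lam (i j : 'I_p) :
  (per_rep x lam ell1_delta (delta_mx j 0 : 'cV_p)) i 0 =
  if (j.+1 %% p == i)%N then lam ^+ (j.+1 %/ p)%N else 0.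
Proof.
rewrite /per_rep -colE !mxE; apply: zsumE.
pose F (n : int) := if ((j%:Z + n) %% p%:Z)%Z == i%:Z
  then (ell1_delta : A) n (dyn_iter i x) * lam ^ ((j%:Z + n) %/ p%:Z)%Z else 0.
rewrite (_ : (if _ then _ else _) = F 1).
  apply: has_sum1 => n n0; rewrite /F ell1_singleE (negPf n0) mul0r.
  by case: ifP.
by rewrite /F ell1_singleE eqxx mul1r -PoszD addn1 modz_nat divz_nat eqz_nat.
Qed.

Lemma per_rep_delta p (x : X) lam (j k : 'I_p) : k = j.+1 :> nat ->
  per_rep x lam ell1_delta (delta_mx j 0) = delta_mx k 0.
Proof.
move=> kj; have jp : (j.+1 < p)%N by rewrite -kj.
apply/colP => i; rewrite per_rep_deltaE modn_small// divn_small// expr0.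
by rewrite mxE eqxx andbT -kj eq_sym -(inj_eq val_inj)/=; case: eqP.
Qed.

Lemma per_rep_delta_last p (x : X) lam (j k : 'I_p) : j.+1 = p -> k = 0%N :> nat ->
  per_rep x lam ell1_delta (delta_mx j 0) = lam *: delta_mx k 0.
Proof.
move=> jp k0; have p0 : (0 < p)%N by rewrite -jp.
apply/colP => i; rewrite per_rep_deltaE jp modnn divnn p0 expr1.
rewrite !mxE eqxx andbT eq_sym -(inj_eq val_inj)/= k0.
by case: eqP; rewrite ?mulr1 ?mulr0.
Qed.

End Ideals.
Arguments Pi_ell1 R {X} S.

(* Main.v *)
Require Import Defs.
Set Warnings "-notation-overridden,-ambiguous-paths,-notation-incompatible-prefix".
Set Warnings "-redundant-canonical-projection,-projection-no-head-constant".
From HB Require Import structures.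
From mathcomp Require Import all_boot all_order all_algebra finmap.
From mathcomp Require Import generic_quotient.
From mathcomp Require Import all_classical all_reals all_analysis.
From mathcomp Require Import complex lra ring zify.

Set Implicit Arguments.
Unset Strict Implicit.
Unset Printing Implicit Defensive.
Import Order.TTheory GRing.Theory Num.Theory numFieldNormedType.Exports.

Local Open Scope classical_set_scope.
Local Open Scope ring_scope.
Local Open Scope complex_scope.

Local Notation normc := (@ComplexField.Normc.normc _).
Local Notation normcM := ComplexField.Normc.normcM.

(* Write pi_x for the action of l^1(Sigma) on bounded sequences v by
   (pi_x(a) v)(m) = sum_n a(n)(sigma^m x) v(m - n). The sequences with
   v(m + p) = lam^-1 v(m) span a p-dimensional space on which pi_x is pi_{x,lam}, and
   pi_x^1 is the restriction to l^1(Z); so one Fubini argument makes both representations,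
   and per_ideal depends on the orbit only because shifts preserve that space.

   For the compactness of Pi(X), take an ultrafilter of ideals Q with parameters
   (x_Q, p_Q, lam_Q), and let x_Q -> y and lam_Q -> lam. If p_Q is eventually a constant p,
   then by continuity every a that is eventually in Q kills the
   sequences of quasi-period (p, lam) at y; the minimal period r of y divides p, and a is
   in P_{y,mu} when mu^(p/r) = lam. Otherwise the periods tend to infinity, and a vanishes
   on the orbit of y. In both cases the ultrafilter converges to an ideal at y.

   For the map Psi, the matrix entries of pi_{x,lam}(a) depend continuously on (x, lam), so
   Psi is continuous on a compact space, and the point is that Pi(S) is Hausdorff. Different
   orbits are separated by (|d| + d) and (|d| - d) for a continuous sigma-invariant d.
   For different lam, mu on one orbit, put t(z) = Re(conj(w) z) with w = (mu - lam)/2;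
   then |t| + t and |t| - t have absolutely summable Fourier coefficients, since
   |t| = sqrt(1 - (1 - t^2)) and 1 - t^2 has coefficients of total mass at most 1: the
   iteration q -> (q^2 + (1 - t^2))/2 converges in l^1 to 1 - |t|, with increments dominated by
   those of the scalar iteration s -> (s^2 + 1)/2. *)

(** * Summable families: tails and the Weierstrass M-test *)

Section Summation.
Context {R : realType}.

Lemma has_sum_nat (K : numFieldType) (f : nat -> K) s : has_sum f s ->
  forall e : K, 0 < e ->
  exists N, forall n, (N <= n)%N -> `|\sum_(k < n) f k - s| < e.
Proof.
move=> hs e /hs[A hA]; exists (\max_(k <- A) k.+1)%N => n hn.
have -> : \sum_(k < n) f k = \sum_(k <- [fset k | k in iota 0 n]%fset) f k.
  rewrite -(big_mkord xpredT f) /index_iota subn0.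
  apply: perm_big; apply: uniq_perm; [exact: iota_uniq|exact: fset_uniq|].
  by move=> k; rewrite !inE.
apply: hA; apply/fsubsetP => k kA; rewrite !inE mem_iota/= add0n.
by apply: leq_trans hn; rewrite (big_rem k)//= leq_maxl.
Qed.

Lemma bsum_nat (f : nat -> R) M : (forall k, 0 <= f k) ->
  (forall n, \sum_(k < n) f k <= M) -> bsum f.
Proof.
move=> f0 hM; exists M => A; apply: le_trans (hM (\max_(k <- A) k.+1)%N).
set N := (\max_(_ <- _) _)%N.
have -> : \sum_(k < N) f k = \sum_(k <- [fset k | k in iota 0 N]%fset) f k.
  rewrite -(big_mkord xpredT f) /index_iota subn0.
  apply: perm_big; apply: uniq_perm; [exact: iota_uniq|exact: fset_uniq|].
  by move=> k; rewrite !inE.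
apply: ler_sum_fset => //; apply/fsubsetP => k kA; rewrite !inE mem_iota/= add0n.
by rewrite /N (big_rem k)//= leq_maxl.
Qed.

Lemma big_fsetU_disjoint {I : choiceType} (g : I -> R) (A B : {fset I}) :
  [disjoint A & B]%fset ->
  \sum_(i <- (A `|` B)%fset) g i = \sum_(i <- A) g i + \sum_(i <- B) g i.
Proof.
move=> AB; rewrite -big_cat/=; apply: perm_big; apply: uniq_perm.
- exact: fset_uniq.
- rewrite cat_uniq !fset_uniq/= andbT; apply/hasPn => i iB.
  by apply: contraTN AB => iA; apply/fdisjointP => /(_ i iA); rewrite iB.
- by move=> i; rewrite mem_cat in_fsetU.
Qed.

(** Cauchy criterion: when all sums over supersets of [A] are within e/2 of the total, a sum over a
    set disjoint from [A] is a difference of two such sums. *)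
Lemma bsum_tail {I : choiceType} (g : I -> R) (e : R) : (forall i, 0 <= g i) ->
  bsum g -> 0 < e -> exists A : {fset I}, forall B : {fset I},
    [disjoint A & B]%fset -> \sum_(i <- B) g i <= e.
Proof.
move=> g0 bg e0; have [s hs] := bsum_has_sum0 g0 bg.
have [A hA] := hs _ (divr_gt0 e0 (ltr0Sn R 1)); exists A => B AB.
have := hA _ (fsubset_refl A); have := hA (A `|` B)%fset (fsubsetUl _ _).
rewrite big_fsetU_disjoint// => h1 h2.
have -> : \sum_(i <- B) g i =
    \sum_(i <- A) g i + \sum_(i <- B) g i - s - (\sum_(i <- A) g i - s).
  by ring.
apply: le_trans (ler_norm _) _; apply: le_trans (ler_normB _ _) _.
by rewrite [leRHS]splitr lerD// ltW.
Qed.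

Lemma bsum_pair {I J : choiceType} (g : I * J -> R) (M : I -> R) :
  (forall p, 0 <= g p) ->
  (forall i (B : {fset J}), \sum_(j <- B) g (i, j) <= M i) -> bsum M -> bsum g.
Proof.
move=> g0 hM [N hN]; exists N => A.
pose B := ([fset x.1 | x in A] `*` [fset x.2 | x in A])%fset.
apply: (@le_trans _ _ (\sum_(p <- B) g p)).
  apply: ler_sum_fset => //; apply/fsubsetP => p pA; rewrite in_fsetM.
  by apply/andP; split; apply/imfsetP; exists p.
rewrite big_fsetM; apply: le_trans (hN [fset x.1 | x in A]%fset).
by apply: ler_sum => i _; exact: hM.
Qed.

Lemma has_sumZr {K : numFieldType} {I : choiceType} (c : K) (f : I -> K) s :
  has_sum f s -> has_sum (fun i => f i * c) (s * c).
Proof.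
by move/(has_sumZ c); rewrite mulrC; congr has_sum; apply/funext => i; rewrite mulrC.
Qed.

Lemma has_sum_swap {K : numFieldType} {I J : choiceType} (F : I * J -> K) s :
  has_sum F s -> has_sum (fun p : J * I => F (p.2, p.1)) s.
Proof.
pose h (p : J * I) := (p.2, p.1); pose h' (p : I * J) := (p.2, p.1).
by apply: (@has_sum_reindex _ _ _ h h'); case.
Qed.

Lemma normcB (z w : R[i]) : normc (z - w) = normc (w - z).
Proof. by apply: complexI; rewrite -!normcE' distrC. Qed.

(** Weierstrass M-test: outside a finite set [A] the tail is at most e/4 for all points at once, so
    [s] is uniformly within e/4 of a finite sum of continuous functions. *)
Lemma continuous_has_sum {I : choiceType} {Y : topologicalType}
    (g : I -> Y -> R[i]) (m : I -> R) (s : Y -> R[i]) :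
  (forall k, continuous (g k)) -> (forall k y, normc (g k y) <= m k) -> bsum m ->
  (forall y, has_sum (fun k => g k y) (s y)) -> continuous s.
Proof.
move=> cg gm bm hs x; apply/(@cvgrPdist_lt _ R[i] _ (nbhs x)) => e' /gt0_realC[e -> e0].
have m0 k : 0 <= m k by apply: le_trans (gm k x); exact: normc_ge0.
have e4 : 0 < e / 4 by rewrite divr_gt0.
have [A hA] := bsum_tail m0 bm e4.
pose p y := \sum_(k <- A) g k y.
have hp y : normc (s y - p y) <= e / 4.
  have : `|s y - p y| <= (e / 4)%:C.
    apply: (has_sum_le (A := A) (f := fun k => g k y - (if k \in A then g k y else 0))).
      apply: (has_sumD (hs y) (t := - p y) (g := fun k => - if k \in A then _ else _)).
      apply: has_sumN => d d0; exists A => B AB.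
      rewrite -big_mkcond /= (_ : \sum_(i <- B | i \in A) _ = p y) ?subrr ?normr0//.
      rewrite -big_filter; apply: perm_big; apply: uniq_perm => //.
        by rewrite filter_uniq.
      move=> k; rewrite mem_filter; case: (boolP (k \in A)) => // kA.
      by move/fsubsetP: AB => ->.
    move=> B AB; rewrite (big_fsetID _ (mem A))/= [X in X + _]big1_fset ?add0r; last first.
      by move=> k; rewrite !inE => /andP[_ kA] _; rewrite kA subrr.
    apply: le_trans (ler_norm_sum _ _ _) _.
    under eq_bigr do rewrite normcE'.
    rewrite -rmorph_sum/= lecR; apply: le_trans (hA [fset k in B | k \notin A]%fset _).
      rewrite big_seq [leRHS]big_seq; apply: ler_sum => k; rewrite !inE => /andP[_ /negPf ->].
      by rewrite subr0.
    by apply/fdisjointP => k kA; rewrite !inE kA andbF.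
  by rewrite normcE' lecR.
have cp : continuous p.
  rewrite /p; elim: (enum_fset A) => [|k r ih].
    by under eq_fun do rewrite big_nil; exact: cst_continuous.
  under eq_fun do rewrite big_cons.
  by apply: continuousCD ih; exact: cg.
have e4C : 0 < (e / 4)%:C :> R[i] by rewrite -[0]/(0%:C) ltcR.
near=> y.
have : `|p x - p y| < (e / 4)%:C.
  by near: y; move/cvgrPdist_lt : (cp x) => /(_ _ e4C).
rewrite !normcE' !ltcR => h1.
have -> : s x - s y = (s x - p x) + (p x - p y) + (p y - s y) by ring.
apply: le_lt_trans (normcD' _ _) _.
have hpy : normc (p y - s y) <= e / 4 by rewrite normcB.
have := normcD' (s x - p x) (p x - p y); have := hp x.
move: hpy h1 e0; move: (normc _) (normc _) (normc _) (normc _) => *; lra.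
Unshelve. all: by end_near. Qed.

End Summation.

(** * The action of l^1(Sigma) on bounded sequences *)

Section BoundedRep.
Context {R : realType} {X : dynsys}.
Local Notation A := (ell1 R X).
Implicit Types (a b : A) (x : X) (v : int -> R[i]).

(** The norm estimate ||a|| <= M, phrased by finite partial sums: this is the form that [bsum] and
    [has_sum_normc] work with. *)
Definition ell1_bound a (M : R) := forall B : {fset int}, \sum_(n <- B) supnorm (a n) <= M.

Lemma ell1_bound_ge0 a M : ell1_bound a M -> 0 <= M.
Proof. by move=> /(_ fset0); rewrite big_seq_fset0. Qed.

Lemma ell1_boundD a b M N :
  ell1_bound a M -> ell1_bound b N -> ell1_bound (a + b) (M + N).
Proof.
move=> hM hN B; apply: le_trans (lerD (hM B) (hN B)); rewrite -big_split/=.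
apply: ler_sum => n _; apply: supnorm_le => x; apply: le_trans (normcD' _ _) _.
by apply: lerD; exact: ell1_le.
Qed.

Lemma ell1_boundZ c a M : ell1_bound a M -> ell1_bound (c *: a) (normc c * M).
Proof.
move=> hM B; apply: le_trans (ler_wpM2l (normc_ge0 c) (hM B)); rewrite mulr_sumr.
apply: ler_sum => n _; apply: supnorm_le => x.
by rewrite normcM ler_wpM2l ?normc_ge0//; exact: ell1_le.
Qed.

(** The norm is submultiplicative: in the double sum of [supnorm (a k) * supnorm (b (n - k))] the
    sum over n comes first, and reindexing by n - k bounds it by [N]. *)
Lemma ell1_boundM a b M N :
  ell1_bound a M -> ell1_bound b N -> ell1_bound (a * b) (M * N).
Proof.
move=> hM hN.
have M0 := ell1_bound_ge0 hM; have N0 := ell1_bound_ge0 hN.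
have g0 k n : 0 <= supnorm (a k) * supnorm (b (n - k)).
  by rewrite mulr_ge0 ?supnorm_ge0.
have /boolp.choice[h hh] (n : int) : exists s,
    has_sum (fun k => supnorm (a k) * supnorm (b (n - k))) s.
  exact: bsum_has_sum0 (ell1_convB1 a b n).
have hle n : supnorm ((a * b) n) <= h n.
  apply: supnorm_le => x; apply: (has_sum_normc (ell1_conv_sum a b n x)) => B.
  apply: le_trans (ler_sum _ (fun k _ => ell1_conv_le a b n x k)) _.
  apply/ler_addgt0Pr => e e0; have [D hD] := hh n _ e0.
  apply: (@le_trans _ _ (\sum_(k <- (B `|` D)%fset) supnorm (a k) * supnorm (b (n - k)))).
    by apply: ler_sum_fset => //; exact: fsubsetUl.
  rewrite -lerBlDl; apply: le_trans (ler_norm _) (ltW (hD _ _)).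
  exact: fsubsetUr.
move=> B; apply: le_trans (ler_sum _ (fun n _ => hle n)) _.
apply: le_trans (ler_norm _) _.
apply: (has_sum_le (has_sum_sum B hh) (A := fset0)) => D _; rewrite ger0_norm; last first.
  by apply: sumr_ge0 => k _; apply: sumr_ge0 => m _; exact: g0.
apply: (@le_trans _ _ (\sum_(k <- D) supnorm (a k) * N)); last first.
  by rewrite -mulr_suml ler_wpM2r.
apply: ler_sum => k _; rewrite -mulr_sumr ler_wpM2l ?supnorm_ge0//.
have := hN [fset n - k | n in B]%fset; rewrite big_imfset//=.
by move=> n n' _ _ /addIr.
Qed.

Lemma ell1_bound_ex a : exists M, ell1_bound a M.
Proof. exact: ell1_bsum. Qed.

Lemma ell1_bound_single (g : X -> R[i]) (cg : continuous g) n M :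
  (forall x, normc (g x) <= M) -> ell1_bound (ell1_single cg n) M.
Proof.
move=> gM B; have gM' := supnorm_le gM.
pose F m := supnorm ((ell1_single cg n : A) m).
have F0 m : m != n -> F m = 0.
  by move=> /negPf mn; rewrite /F /ell1_single/= mn supnorm0.
have Fn : F n = supnorm g by rewrite /F /ell1_single/= eqxx.
rewrite -[leLHS]/(\sum_(i <- B) F i); case: (boolP (n \in B)) => nB.
  by rewrite (bigD1_seq n nB (fset_uniq B))/= Fn big1 ?addr0// => i /F0.
rewrite big_seq_cond big1 => [|i /andP[iB _]]; first exact: le_trans (supnorm_ge0 _) gM'.
by apply: F0; apply: contraNneq nB => <-.
Qed.

Section Bounded.
Variables (v : int -> R[i]) (c : R).
Hypothesis vc : forall m, normc (v m) <= c.

Let c0 : 0 <= c. Proof. exact: le_trans (normc_ge0 _) (vc 0). Qed.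

Lemma aper_rep_term a x m n :
  normc (a n (dyn_iter m x) * v (m - n)) <= c * supnorm (a n).
Proof. by rewrite normcM mulrC ler_pM ?normc_ge0//; exact: ell1_le. Qed.

Lemma aper_rep_sum a x m :
  has_sum (fun n => a n (dyn_iter m x) * v (m - n)) (aper_rep x a v m).
Proof. exact: bsum_zsum (aper_rep_term a x m) (bsumZ c0 (ell1_bsum a)). Qed.

Lemma aper_rep_bound a x M m :
  ell1_bound a M -> normc (aper_rep x a v m) <= M * c.
Proof.
move=> aM; apply: (has_sum_normc (aper_rep_sum a x m)) => B.
apply: le_trans (ler_sum _ (fun n _ => aper_rep_term a x m n)) _.
by rewrite -mulr_sumr mulrC ler_wpM2r.
Qed.

Lemma aper_repDl a b x m :
  aper_rep x (a + b) v m = aper_rep x a v m + aper_rep x b v m.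
Proof.
apply: has_sum_unique (aper_rep_sum (a + b) x m) _.
have := has_sumD (aper_rep_sum a x m) (aper_rep_sum b x m).
by congr has_sum; apply/funext => n; rewrite -mulrDl.
Qed.

Lemma aper_repZl k a x m : aper_rep x (k *: a) v m = k * aper_rep x a v m.
Proof.
apply: has_sum_unique (aper_rep_sum (k *: a) x m) _.
have := has_sumZ k (aper_rep_sum a x m).
by congr has_sum; apply/funext => n; rewrite mulrA.
Qed.

Lemma aper_repB a b x m :
  aper_rep x (a - b) v m = aper_rep x a v m - aper_rep x b v m.
Proof. by rewrite aper_repDl -[- b]scaleN1r aper_repZl mulN1r. Qed.

Lemma aper_rep_single (g : X -> R[i]) (cg : continuous g) n x m :
  aper_rep x (ell1_single cg n) v m = g (dyn_iter m x) * v (m - n).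
Proof.
apply: has_sum_unique (aper_rep_sum _ x m) _.
rewrite (_ : _ * _ = (ell1_single cg n : A) n (dyn_iter m x) * v (m - n)); last first.
  by rewrite ell1_singleE eqxx.
by apply: has_sum1 => k /negPf kn; rewrite ell1_singleE kn mul0r.
Qed.

Lemma aper_rep1 x m : aper_rep x 1 v m = v m.
Proof. by rewrite -[1]/(ell1_single _ 0) aper_rep_single mul1r subr0. Qed.

(** Both sides are iterated sums of one absolutely summable family [F] over pairs (n, k). The right
    side appears after the reindexing (k, l) -> (k + l, k). *)
Lemma aper_repM a b x : aper_rep x (a * b) v = aper_rep x a (aper_rep x b v).
Proof.
apply/funext => m.
pose F (p : int * int) := a p.2 (dyn_iter m x) *
  b (p.1 - p.2) (dyn_iter (m - p.2) x) * v (m - p.1).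
have FG p : normc (F p) <= c * (supnorm (a p.2) * supnorm (b (p.1 - p.2))).
  rewrite /F !normcM mulrC; apply: ler_pM; rewrite ?mulr_ge0 ?normc_ge0//.
  by apply: ler_pM; rewrite ?normc_ge0//; exact: ell1_le.
have [s hs] := bsum_has_sum FG (bsumZ c0 (ell1_convB a b)).
transitivity s.
  apply: has_sum_unique (aper_rep_sum (a * b) x m) _.
  apply: (has_sum_fubini hs) => n.
  have := has_sumZr (v (m - n)) (ell1_conv_sum a b n (dyn_iter m x)).
  by congr has_sum; apply/funext => k; rewrite /F/= -dyn_iterD [- k + m]addrC.
have [N bN] := ell1_bound_ex b.
apply: esym; apply: zsumE.
pose hh (q : int * int) := (q.1 + q.2, q.1).
pose hh' (q : int * int) := (q.2, q.1 - q.2).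
have hK : cancel hh hh' by move=> [k l]; rewrite /hh/hh'/= addrAC subrr add0r.
have hK' : cancel hh' hh by move=> [k l]; rewrite /hh/hh'/= addrC subrK.
apply: (has_sum_fubini (has_sum_reindex hK hK' hs)) => k.
have := has_sumZ (a k (dyn_iter m x)) (aper_rep_sum b x (m - k)).
congr has_sum; apply/funext => l; rewrite /F/= mulrA.
by rewrite [k + l - k]addrAC subrr add0r opprD addrA.
Qed.

End Bounded.

Lemma aper_repDr a x v w c d :
  (forall m, normc (v m) <= c) -> (forall m, normc (w m) <= d) -> forall m,
  aper_rep x a (fun m => v m + w m) m = aper_rep x a v m + aper_rep x a w m.
Proof.
move=> vc wd m; apply: zsumE.
have := has_sumD (aper_rep_sum vc a x m) (aper_rep_sum wd a x m).
by congr has_sum; apply/funext => n; rewrite -mulrDr.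
Qed.

Lemma aper_repZr k a x v c : (forall m, normc (v m) <= c) -> forall m,
  aper_rep x a (fun m => k * v m) m = k * aper_rep x a v m.
Proof.
move=> vc m; apply: zsumE; have := has_sumZ k (aper_rep_sum vc a x m).
by congr has_sum; apply/funext => n; rewrite mulrCA.
Qed.

(** Moves the base point along its orbit. It makes [per_ideal] independent of the point of the orbit
    and lets [aper_idealP] read off single coefficients. *)
Lemma aper_rep_shift a x v (k m : int) :
  aper_rep (dyn_iter k x) a v m = aper_rep x a (fun l => v (l - k)) (m + k).
Proof.
rewrite /aper_rep; congr zsum; apply/funext => n; rewrite -dyn_iterD.
by congr (_ * v _); rewrite addrAC addrK.
Qed.

(** Completeness of l^1(Sigma) in the form needed later. The coefficients of [b] are pointwise sums,
    continuous by the M-test, and Fubini over pairs (k, n) lets the action pass through the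
    series. *)
Lemma ell1_series (h : nat -> A) (M : nat -> R) :
  (forall k, ell1_bound (h k) (M k)) -> bsum M ->
  exists b : A, forall x v c m, (forall m, normc (v m) <= c) ->
    has_sum (fun k => aper_rep x (h k) v m) (aper_rep x b v m).
Proof.
move=> hM bM.
have bp : bsum (fun p : nat * int => supnorm (h p.1 p.2)).
  by apply: (bsum_pair _ _ bM) => [p|k B]; [exact: supnorm_ge0|exact: hM].
have M0 k : 0 <= M k := ell1_bound_ge0 (hM k).
have hMn k n : supnorm (h k n) <= M k.
  by have := hM k [fset n]%fset; rewrite big_seq_fset1.
have bk n : bsum (fun k => supnorm (h k n)) by apply: bsum_le bM => k.
have /boolp.choice[f hf] (n : int) : exists f : X -> R[i],
    forall x, has_sum (fun k => h k n x) (f x).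
  have [f hf] := boolp.choice (fun x =>
    bsum_has_sum (fun k => ell1_le (h k) n x) (bk n)).
  by exists f.
have cf n : continuous (f n).
  apply: (continuous_has_sum _ _ (bk n) (hf n)) => k; first exact: ell1_continuous.
  by move=> x; exact: ell1_le.
have sf : bsum (fun n => supnorm (f n)).
  have [N hN] := bM; exists N => B.
  have /boolp.choice[s hs] (n : int) : exists s, has_sum (fun k => supnorm (h k n)) s.
    by apply: bsum_has_sum0 (bk n) => k; exact: supnorm_ge0.
  have le_s n : supnorm (f n) <= s n.
    apply: supnorm_le => x; apply: (has_sum_normc (hf n x)) => D.
    apply: le_trans (ler_sum _ (fun k _ => ell1_le (h k) n x)) _.
    apply/ler_addgt0Pr => e e0; have [E hE] := hs n _ e0.
    apply: (@le_trans _ _ (\sum_(k <- (D `|` E)%fset) supnorm (h k n))).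
      by apply: ler_sum_fset => [k|]; [exact: supnorm_ge0|exact: fsubsetUl].
    rewrite -lerBlDl; apply: le_trans (ler_norm _) (ltW (hE _ _)).
    exact: fsubsetUr.
  apply: le_trans (ler_sum _ (fun n _ => le_s n)) _.
  apply: le_trans (ler_norm _) _.
  apply: (has_sum_le (has_sum_sum B hs) (A := fset0)) => D _; rewrite ger0_norm.
    by apply: le_trans (hN D); apply: ler_sum => k _; exact: hM.
  by apply: sumr_ge0 => k _; apply: sumr_ge0 => n _; exact: supnorm_ge0.
pose b : A := Ell1 cf (bsum_ell1 sf); exists b => x v c m vc.
have c0 : 0 <= c := le_trans (normc_ge0 _) (vc 0).
pose F (p : nat * int) := h p.1 p.2 (dyn_iter m x) * v (m - p.2).
have [s hs] := @bsum_has_sum _ _ F _ (fun p => aper_rep_term vc (h p.1) x m p.2) (bsumZ c0 bp).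
have -> : aper_rep x b v m = s.
  apply: has_sum_unique (aper_rep_sum vc b x m) _.
  apply: (has_sum_fubini (has_sum_swap hs)) => n.
  by have := has_sumZr (v (m - n)) (hf n (dyn_iter m x)).
apply: (has_sum_fubini hs) => k.
by have := aper_rep_sum vc (h k) x m.
Qed.

End BoundedRep.

(** * Periods of points *)

Section Periods.
Context {X : dynsys}.
Implicit Types x y : X.

(** Arithmetic form of [Per_ X p x], which is stated by cardinality; [Per_P] proves the
    equivalence. *)
Definition minimal_period (p : nat) x :=
  [/\ (0 < p)%N, dyn_iter p x = x &
      forall m : nat, (0 < m < p)%N -> dyn_iter m x <> x].

Lemma dyn_iterK (n : int) : cancel (@dyn_iter X n) (dyn_iter (- n)).
Proof. by move=> x; rewrite -dyn_iterD addNr. Qed.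

Lemma dyn_iter_inj (n : int) : injective (@dyn_iter X n).
Proof. exact: can_inj (dyn_iterK n). Qed.

Lemma dyn_iter_period (p n : int) x : dyn_iter p x = x -> dyn_iter (n * p) x = x.
Proof.
move=> px; have nat_case (m : nat) : dyn_iter (m%:Z * p) x = x.
  elim: m => [|m ih]; first by rewrite mul0r.
  by rewrite intS mulrDl mul1r dyn_iterD ih.
case: n => [m|m]; first exact: nat_case.
by apply: (@dyn_iter_inj (m.+1%:Z * p)); rewrite -dyn_iterD NegzE mulNr subrr nat_case.
Qed.

Lemma dyn_iter_modz (p : nat) (n : int) x : dyn_iter p x = x ->
  dyn_iter n x = dyn_iter (n %% p)%Z x.
Proof.
by move=> px; rewrite {1}(divz_eq n p) addrC dyn_iterD dyn_iter_period.
Qed.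

Lemma minimal_period_inj p x (m n : nat) : minimal_period p x ->
  (m < p)%N -> (n < p)%N -> dyn_iter m x = dyn_iter n x -> m = n.
Proof.
move=> [_ _ hp]; wlog mn : m n / (m <= n)%N => [H mp np e|].
  by have [/H|/ltnW/H] := leqP m n; [exact|move/(_ np mp (esym e))].
move=> _ np e; have [//|mn'] := eqVneq m n.
case: (hp (n - m)%N); first by lia.
apply: (@dyn_iter_inj m%:Z); rewrite -dyn_iterD e; congr dyn_iter; lia.
Qed.

Lemma minimal_period_orbit p x : minimal_period p x ->
  dyn_orbit x = [set dyn_iter i%:Z x | i in `I_p].
Proof.
move=> [p0 px _]; apply/seteqP; split=> [_ [n _ <-]|_ [i _ <-]]; last by exists i%:Z.
have h0 := modz_ge0 n (_ : p%:Z != 0); have h1 := ltz_pmod n (_ : 0 < p%:Z).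
exists `|(n %% p)%Z|%N; first by rewrite /=; lia.
by rewrite (dyn_iter_modz n px); congr dyn_iter; lia.
Qed.

Lemma minimal_period_Per p x : minimal_period p x -> Per_ X p x.
Proof.
move=> px; rewrite /Per_ /= (minimal_period_orbit px); apply: inj_card_eq => m n.
by rewrite !inE /=; exact: minimal_period_inj px.
Qed.

(** The least positive period divides [n], because a nonzero remainder of [n] would be a smaller
    positive period. *)
Lemma periodic_minimal_period (n : nat) x : (0 < n)%N -> dyn_iter n x = x ->
  exists2 p, minimal_period p x & (p %| n)%N.
Proof.
move=> n0 nx.
have ex : exists n : nat, (0 < n)%N && `[< dyn_iter n x = x >].
  by exists n; rewrite n0; apply/asboolP.
case: (ex_minnP ex) => p /andP[p0 /asboolP px] hp; exists p.
  split=> // m /andP[m0 mp] mx; have := hp m; rewrite m0 leqNgt mp.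
  by move=> H; have : false by apply: H; apply/asboolP.
rewrite /dvdn; apply: contraT; rewrite -lt0n => r0.
have /hp : (0 < n %% p)%N && `[< dyn_iter (n %% p)%N x = x >].
  by rewrite r0; apply/asboolP; rewrite -modz_nat -dyn_iter_modz.
by rewrite leqNgt ltn_mod p0.
Qed.

(** Without a positive period, n -> sigma^n x is injective on the naturals, and the orbit is
    infinite. *)
Lemma Per_minimal_period x : Per X x -> exists p, minimal_period p x.
Proof.
move=> fx; suff [n n0 nx] : exists2 n : nat, (0 < n)%N & dyn_iter n x = x.
  by have [p] := periodic_minimal_period n0 nx; exists p.
apply: contrapT => h; have := infinite_nat; apply.
have inj : {in [set: nat] &, injective (fun n : nat => dyn_iter n x)}.
  move=> m n _ _; wlog mn : m n / (m <= n)%N => [H e|].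
    by have [/H|/ltnW/H] := leqP m n; [exact|move/(_ (esym e))].
  move=> e; have [//|mn'] := eqVneq m n; case: h; exists (n - m)%N; first by lia.
  apply: (@dyn_iter_inj m%:Z); rewrite -dyn_iterD e; congr dyn_iter; lia.
rewrite -(eq_finite_set (inj_card_eq inj)).
by apply: sub_finite_set fx => _ [n _ <-]; exists n%:Z.
Qed.

Lemma Per_P p x : Per_ X p x <-> minimal_period p x.
Proof.
split; last exact: minimal_period_Per.
move=> hp; have [|q hq] := @Per_minimal_period x; first by apply/finite_setP; exists p.
have := minimal_period_Per hq; rewrite /Per_ /= => hq'; move: hp; rewrite /Per_/= => hp.
have : (`I_p #= `I_q)%card by apply: card_eq_trans hq'; rewrite card_eq_sym.
by move=> /card_eq_II ->.
Qed.

Lemma minimal_period_unique p q x : minimal_period p x -> minimal_period q x -> p = q.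
Proof.
move=> [p0 px hp] [q0 qx hq]; apply/eqP; rewrite eqn_leq; apply/andP; split.
  by rewrite leqNgt; apply/negP => pq; apply: (hp q) => //; rewrite q0.
by rewrite leqNgt; apply/negP => pq; apply: (hq p) => //; rewrite p0.
Qed.

Lemma Aper_free (n : int) x : Aper x -> dyn_iter n x = x -> n = 0.
Proof.
move=> ax nx; apply: contrapT => /eqP n0; apply: ax.
have mx : dyn_iter `|n|%N x = x.
  case: n n0 nx => [m|m] _ mx; first by [].
  apply: (@dyn_iter_inj (Negz m)); rewrite mx -dyn_iterD.
  by rewrite (_ : Negz m + _ = 0) ?dyn_iter0//=; lia.
have [|p hp _] := periodic_minimal_period _ mx; first by rewrite absz_gt0.
exact/finite_setP/(ex_intro _ p)/minimal_period_Per.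
Qed.

Lemma minimal_period_shift p (k : int) x :
  minimal_period p x -> minimal_period p (dyn_iter k x).
Proof.
move=> [p0 px hp]; split=> //; first by rewrite -dyn_iterD addrC dyn_iterD px.
by move=> m /hp h; rewrite -dyn_iterD addrC dyn_iterD => /dyn_iter_inj.
Qed.

End Periods.

(** * Urysohn functions on X *)

Section Separation.
Context {R : realType} {X : dynsys}.

Lemma realC_continuous (Y : topologicalType) (f : Y -> R) :
  continuous f -> continuous (fun y => (f y)%:C).
Proof.
move=> cf y; apply/(@cvgrPdist_lt _ R[i] _ (nbhs y)) => e' /gt0_realC[e -> e0].
near=> z; rewrite -rmorphB normcE' ltcR /= expr0n/= addr0 sqrtr_sqr.
by near: z; move/cvgrPdist_lt : (cf y); exact.
Unshelve. all: by end_near. Qed.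

Lemma dyn_urysohn (A B : set X) : closed A -> closed B -> A `&` B = set0 ->
  exists f : X -> R, [/\ continuous f, forall x, 0 <= f x <= 1,
    forall x, A x -> f x = 0 & forall x, B x -> f x = 1].
Proof.
move=> cA cB AB; have := compact_normal (@dyn_hausdorff X) (@dyn_compact X).
move=> /(@normal_separatorP R)/(_ A B cA cB AB)/(@uniform_separatorP _ R).
move=> [f [cf f01 fA fB]]; exists f; split=> // x.
- by have := f01 (f x); rewrite /= in_itv/=; apply; exists x.
- by move=> Ax; apply: fA; exists x.
- by move=> Bx; apply: fB; exists x.
Qed.

Lemma dyn_finite_closed (A : set X) : finite_set A -> closed A.
Proof.
move: A; apply/accessible_finite_set_closed.
exact: hausdorff_accessible (@dyn_hausdorff X).
Qed.

Lemma dyn_bump (x : X) (A : set X) : finite_set A -> ~ A x ->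
  exists g : X -> R[i], [/\ continuous g, forall y, normc (g y) <= 1,
    g x = 1 & forall y, A y -> g y = 0].
Proof.
move=> fA Ax; have [|||f [cf f01 fA0 fx]] := @dyn_urysohn A [set x].
- exact: dyn_finite_closed.
- exact: dyn_finite_closed.
- by rewrite -subset0 => y [Ay /= yx]; apply: Ax; rewrite -yx.
exists (fun y => (f y)%:C); split; first exact: realC_continuous.
- move=> y; rewrite -lecR -normcE' normcE' lecR /= expr0n/= addr0 sqrtr_sqr.
  by have /andP[y0 y1] := f01 y; rewrite ger0_norm.
- by rewrite fx.
- by move=> y /fA0 ->.
Qed.

End Separation.

(** * Quasi-periodic sequences *)

Section QuasiPeriodic.
Context {R : realType}.
Implicit Types (v : int -> R[i]) (lam : R[i]).

Lemma unit_circle_normc lam : unit_circle R lam <-> normc lam = 1.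
Proof.
split=> [h|h]; first by apply: complexI; rewrite -normcE'.
by rewrite /unit_circle /= normcE' h.
Qed.

Lemma unit_circle_neq0 lam : unit_circle R lam -> lam != 0.
Proof. by move=> h; rewrite -normr_eq0 h oner_neq0. Qed.

Lemma unit_circleX lam (n : int) : unit_circle R lam -> unit_circle R (lam ^ n).
Proof.
move=> h; case: n => n; rewrite /unit_circle /=.
  by rewrite -exprnP normrX h expr1n.
by rewrite NegzE -invr_expz normfV -exprnP normrX h expr1n invr1.
Qed.

(* Coordinates in the identification e_(q p + i) = lam^q e_i, under which pi_x^1 becomes
   pi_{x,lam}. *)
Definition quasi_periodic (p : nat) lam v := forall m : int, v (m + p%:Z) = lam^-1 * v m.

(** For j < p these form the basis dual to the evaluations at 0, ..., p - 1; each further period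
    contributes a factor lam^-1. *)
Definition qp_delta (p : nat) lam (j : nat) (m : int) : R[i] :=
  if (m %% p)%Z == j then lam ^ (- (m %/ p)%Z) else 0.

Variables (p : nat) (lam : R[i]).
Hypotheses (p0 : (0 < p)%N) (lam1 : unit_circle R lam).

Lemma quasi_periodicE v (m q : int) : quasi_periodic p lam v ->
  v (m + q * p) = lam ^ (- q) * v m.
Proof.
have l0 := unit_circle_neq0 lam1; move=> hv.
have nat_case (n : nat) k : v (k + n%:Z * p) = lam ^ (- n%:Z) * v k.
  elim: n k => [|n ih] k; first by rewrite mul0r addr0 mul1r.
  by rewrite intS mulrDl mul1r addrCA addrC hv ih mulrA opprD expfzDr// exprN1.
case: q => n; first exact: nat_case.
rewrite NegzE opprK -[in RHS](subrK (n.+1%:Z * p) m) nat_case mulNr.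
by rewrite mulrA -expfzDr// subrr mul1r.
Qed.

Lemma quasi_periodic_modz v (m : int) : quasi_periodic p lam v ->
  v m = lam ^ (- (m %/ p)%Z) * v (m %% p)%Z.
Proof. by move=> hv; rewrite {1}(divz_eq m p) addrC quasi_periodicE. Qed.

Lemma modz_ord (m : int) : exists i : 'I_p, (m %% p)%Z = i%:Z.
Proof.
have h0 := modz_ge0 m (_ : p%:Z != 0); have h1 := ltz_pmod m (_ : 0 < p%:Z).
have hp : (`|(m %% p)%Z| < p)%N by lia.
by exists (Ordinal hp); rewrite /=; lia.
Qed.

Lemma quasi_periodic_bounded v : quasi_periodic p lam v ->
  forall m, normc (v m) <= \sum_(i < p) normc (v i).
Proof.
move=> hv m; rewrite (quasi_periodic_modz m hv) normcM.
have /unit_circle_normc -> := unit_circleX (- (m %/ p)%Z) lam1.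
have [i ->] := modz_ord m; rewrite mul1r (bigD1 i)//= lerDl.
by apply: sumr_ge0 => *; exact: normc_ge0.
Qed.

Lemma qp_delta_quasi_periodic j : quasi_periodic p lam (qp_delta p lam j).
Proof.
move=> m; rewrite /qp_delta modzDr; case: ifP => _; last by rewrite mulr0.
have -> : ((m + p) %/ p)%Z = (m %/ p)%Z + 1.
  have pn0 : p%:Z != 0 by lia.
  by have := divzMDl 1 m pn0; rewrite mul1r [p%:Z + m]addrC => ->; rewrite addrC.
by rewrite opprD addrC expfzDr ?unit_circle_neq0// exprN1.
Qed.

Lemma qp_delta_bound j m : normc (qp_delta p lam j m) <= 1.
Proof.
rewrite /qp_delta; case: ifP => _; last by rewrite ComplexField.Normc.normc0.
by have /unit_circle_normc -> := unit_circleX (- (m %/ p)%Z) lam1.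
Qed.

Lemma qp_deltaE (i j : 'I_p) : qp_delta p lam j i = (i == j)%:R.
Proof.
rewrite /qp_delta modz_small ?divz_small ?ltz_nat ?ltn_ord// eqz_nat.
by rewrite oppr0 expr0z -(inj_eq val_inj)/=; case: eqP.
Qed.

Lemma quasi_periodic_sum v : quasi_periodic p lam v ->
  forall m, v m = \sum_(j < p) v j * qp_delta p lam j m.
Proof.
move=> hv m; rewrite (quasi_periodic_modz m hv); have [i hi] := modz_ord m.
rewrite hi (bigD1 i)//= big1 ?addr0 => [|j /negPf ji].
  by rewrite /qp_delta hi eqxx mulrC.
by rewrite /qp_delta hi eqz_nat eq_sym (inj_eq val_inj) ji mulr0.
Qed.

End QuasiPeriodic.

(** * The ideals of periodic points *)

Section PeriodicIdeals.
Context {R : realType} {X : dynsys}.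
Local Notation A := (ell1 R X).
Implicit Types (a b : A) (x : X) (v : int -> R[i]) (lam : R[i]).

(** Modulo p, i - n = j holds exactly when j + n = i, and then the quotient of i - n by p is minus
    that of j + n. This identifies the matrix with the action on quasi-periodic sequences. *)
Lemma per_mxE p x lam a (i j : 'I_p) : (0 < p)%N ->
  per_mx p x lam a i j = aper_rep x a (qp_delta p lam j) i.
Proof.
move=> p0; rewrite mxE /aper_rep; congr zsum; apply/funext => n; rewrite /qp_delta.
have hi := ltn_ord i; have hj := ltn_ord j.
have pn0 : p%:Z != 0 by lia.
have -> : (((i%:Z - n) %% p)%Z == j) = (((j%:Z + n) %% p)%Z == i).
  have key m (k : 'I_p) : ((m %% p)%Z == k%:Z) = (p %| m - k%:Z)%Z.
    by rewrite -eqz_mod_dvd [(k%:Z %% p)%Z]modz_small// ltz_nat ltn_ord.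
  rewrite !key !dvdzE (_ : i%:Z - n - j%:Z = - (j%:Z + n - i%:Z)) ?abszN//; ring.
case: eqP => [e|_]; last by rewrite mulr0.
congr (_ * lam ^ _); have := divz_eq (j%:Z + n) p; rewrite e => h.
have -> : i%:Z - n = - ((j%:Z + n) %/ p)%Z * p + j by rewrite mulNr; lia.
by rewrite divzMDl// [(j%:Z %/ p)%Z]divz_small ?addr0 ?opprK.
Qed.

Variable p : nat.
Hypothesis p0 : (0 < p)%N.

Lemma aper_rep_qp x lam a v (i : 'I_p) : unit_circle R lam -> quasi_periodic p lam v ->
  aper_rep x a v i = \sum_(j < p) per_mx p x lam a i j * v j.
Proof.
(* Additivity of [aper_rep] asks for bounds on both summands, so the expansion of [v] in the basis
   is added up along a list, with [wb] bounding the partial sums. *)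
move=> lam1 hv; pose w (r : seq 'I_p) m := \sum_(j <- r) v j * qp_delta p lam j m.
have wb r m : normc (w r m) <= \sum_(j <- r) normc (v j).
  rewrite /w; elim: r => [|j r ih]; first by rewrite !big_nil ComplexField.Normc.normc0.
  rewrite !big_cons; apply: le_trans (normcD' _ _) _; apply: lerD => //.
  by rewrite normcM ler_piMr ?normc_ge0// qp_delta_bound.
have -> : v = w (index_enum 'I_p).
  by apply/funext => m; exact: quasi_periodic_sum.
suff -> r : aper_rep x a (w r) i = \sum_(j <- r) per_mx p x lam a i j * v j.
  apply: eq_bigr => j _; congr (_ * _).
  by rewrite [LHS](quasi_periodic_sum p0 lam1 hv).
elim: r => [|j r ih].
  rewrite big_nil; apply: zsumE; rewrite (_ : (fun _ => _) = fun=> 0).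
    exact: has_sum0.
  by apply/funext => n; rewrite /w big_nil mulr0.
rewrite big_cons -ih per_mxE// mulrC.
rewrite -(aper_repZr _ _ _ (qp_delta_bound p lam1 j)).
rewrite -(@aper_repDr _ _ a x _ (w r) (normc (v j)) _ _ (wb r)).
  by congr aper_rep; apply/funext => m; rewrite /w big_cons.
by move=> m; rewrite normcM ler_piMr ?normc_ge0// qp_delta_bound.
Qed.

(** The coefficients of [a] take the same values at sigma^(m + p) x and sigma^m x, so the action
    commutes with the shift by p. *)
Lemma aper_rep_quasi_periodic x lam a v : dyn_iter p x = x ->
  quasi_periodic p lam v -> unit_circle R lam -> quasi_periodic p lam (aper_rep x a v).
Proof.
move=> px hv lam1 m; have vb := quasi_periodic_bounded p0 lam1 hv.
apply: has_sum_unique (aper_rep_sum vb a x (m + p)) _.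
have := has_sumZ lam^-1 (aper_rep_sum vb a x m).
congr has_sum; apply/funext => n.
by rewrite mulrCA addrAC hv dyn_iterD px.
Qed.

(** A coordinate-free description, valid for every positive period p of x and not only the least
    one. This allows ideals at different base points and for different multiples of a period to be
    compared. *)
Lemma per_idealP x lam a : dyn_iter p x = x -> unit_circle R lam ->
  per_ideal p x lam a <->
  forall v, quasi_periodic p lam v -> forall m, aper_rep x a v m = 0.
Proof.
move=> px lam1; split=> [ha v hv m|ha u]; last first.
  apply/colP => i; rewrite /per_rep !mxE big1// => j _; rewrite per_mxE//.
  by rewrite ha ?mul0r//; exact: qp_delta_quasi_periodic.
have mx0 (i j : 'I_p) : per_mx p x lam a i j = 0.
  have /(congr1 (fun u : 'cV_p => u i 0)) := ha (delta_mx j 0).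
  by rewrite /per_rep -colE !mxE.
have hw := aper_rep_quasi_periodic a px hv lam1.
rewrite (quasi_periodic_modz lam1 m hw); have [i ->] := modz_ord p0 m.
by rewrite (aper_rep_qp _ _ _ lam1 hv) big1 ?mulr0// => j _; rewrite mx0 mul0r.
Qed.

Lemma per_mx_eq0 x lam a :
  per_ideal p x lam a <-> forall i j, per_mx p x lam a i j = 0.
Proof.
split=> [ha i j|ha u]; last first.
  by apply/colP => i; rewrite /per_rep !mxE big1// => j _; rewrite ha mul0r.
have /(congr1 (fun u : 'cV_p => u i 0)) := ha (delta_mx j 0).
by rewrite /per_rep -colE !mxE.
Qed.

Lemma per_ideal_shift x lam (k : int) : dyn_iter p x = x -> unit_circle R lam ->
  per_ideal p (dyn_iter k x) lam = per_ideal p x lam :> set A.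
Proof.
have sub y (n : int) : dyn_iter p y = y -> unit_circle R lam ->
    (per_ideal p y lam : set A) `<=` per_ideal p (dyn_iter n y) lam.
  move=> py lam1 a /(per_idealP _ py lam1) ha.
  apply/per_idealP => // [|v hv m]; first by rewrite -dyn_iterD addrC dyn_iterD py.
  by rewrite aper_rep_shift ha// => l; rewrite addrAC hv.
move=> px lam1; apply/seteqP; split; last exact: sub.
rewrite -{2}[x](dyn_iterK k); apply: sub => //.
by rewrite -dyn_iterD addrC dyn_iterD px.
Qed.

Lemma per_mxM x lam a b : dyn_iter p x = x -> unit_circle R lam ->
  per_mx p x lam (a * b) = per_mx p x lam a *m per_mx p x lam b.
Proof.
move=> px lam1; apply/matrixP => i j; rewrite per_mxE// mxE.
have qj := @qp_delta_quasi_periodic _ p lam p0 lam1 j.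
rewrite (aper_repM (qp_delta_bound p lam1 j)).
rewrite (aper_rep_qp _ _ _ lam1 (aper_rep_quasi_periodic b px qj lam1)).
by apply: eq_bigr => l _; rewrite [per_mx _ _ _ b _ _]per_mxE.
Qed.

Lemma per_rep_representation x lam : dyn_iter p x = x -> unit_circle R lam ->
  representation (@per_rep R X p x lam).
Proof.
move=> px lam1; split=> [a k u v|v k a b|a b v]; rewrite /per_rep.
- by rewrite mulmxDr -scalemxAr.
- rewrite scalemxAl -mulmxDl; congr (_ *m _); apply/matrixP => i j.
  have bj := qp_delta_bound p lam1 j; rewrite [RHS]mxE [X in _ = X + _]mxE !per_mxE//.
  by rewrite (aper_repDl bj) (aper_repZl bj).
- by rewrite per_mxM// mulmxA.
Qed.

Lemma per_mx_single x lam (g : X -> R[i]) (cg : continuous g) (n : int) (i j : 'I_p) :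
  unit_circle R lam ->
  per_mx p x lam (ell1_single cg n) i j = g (dyn_iter i x) * qp_delta p lam j (i%:Z - n).
Proof.
by move=> lam1; rewrite per_mxE// (aper_rep_single (qp_delta_bound p lam1 j)).
Qed.

(** The matrix unit comes from g delta^(i - j), where g is 1 at sigma^i x and 0 at the other points
    of the orbit. *)
Lemma per_mx_delta x lam (i j : 'I_p) : minimal_period p x -> unit_circle R lam ->
  exists a, per_mx p x lam a = delta_mx i j.
Proof.
move=> px lam1.
pose F := [set dyn_iter m%:Z x | m in `I_p `\ (i : nat)].
have [||g [cg _ gi gF]] := @dyn_bump R X (dyn_iter i x) F.
- by apply: finite_image; exact: finite_setD (finite_II p).
- by move=> [m [/= mp mi]] /(minimal_period_inj px mp (ltn_ord i)).
exists (ell1_single cg (i%:Z - j%:Z)); apply/matrixP => k l.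
rewrite per_mx_single// mxE; have [->|ki] := eqVneq k i.
  by rewrite gi mul1r subKr qp_deltaE eq_sym.
rewrite gF ?mul0r//; exists (k : nat) => //; split; first exact: ltn_ord.
by move=> /= /val_inj ki'; rewrite ki' eqxx in ki.
Qed.

(** Matrix units carry a nonzero coordinate of any vector to every basis vector, so a nonzero
    invariant subspace is everything. *)
Lemma per_ideal_primitive x lam : minimal_period p x -> unit_circle R lam ->
  primitive_ideal (per_ideal p x lam : set A).
Proof.
move=> px lam1; exists 'cV_p, (per_rep x lam); split=> //.
have [_ px' _] := px; split; first exact: per_rep_representation.
  have i := Ordinal p0; have [a ha] := per_mx_delta i i px lam1.
  exists a, (delta_mx i 0); rewrite /per_rep ha mul_delta_mx.
  by move=> /(congr1 (fun u : 'cV_p => u i 0)) /eqP; rewrite !mxE !eqxx oner_eq0.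
move=> W [W0 Wl Wa]; have [->|WN] := eqVneq W [set 0]; [by left|right].
have [w Ww /eqP/cV0Pn[j wj]] : exists2 w, W w & w <> 0.
  apply: contrapT => h; move/eqP: WN; apply; apply/seteqP; split=> [w Ww /=|w ->//].
  by apply: contrapT => w0; apply: h; exists w.
have We (i : 'I_p) : W (delta_mx i 0).
  have [a ha] := per_mx_delta i j px lam1.
  have := Wl (w j 0)^-1 _ 0 (Wa a _ Ww) W0; rewrite addr0 /per_rep ha.
  rewrite (_ : _ *: _ = delta_mx i 0)//; apply/colP => k; rewrite !mxE.
  rewrite (bigD1 j)//= big1 ?addr0 => [|l /negPf lj]; last by rewrite !mxE lj andbF mul0r.
  by rewrite !mxE eqxx !andbT mulrCA mulVf ?mulr1.
apply/seteqP; split=> // u _.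
rewrite (matrix_sum_delta u); elim/big_ind: _ => // [v v' Wv Wv'|i _].
  by have := Wl 1 _ _ Wv Wv'; rewrite scale1r.
by rewrite big_ord1; have := Wl (u i 0) _ 0 (We i) W0; rewrite addr0.
Qed.

End PeriodicIdeals.

(** * The space l^1(Z) *)

Section SummableSequences.
Context {R : realType}.

Definition ell1Z_pred : {pred int -> R[i]} := fun v => `[< ell1Z v >].

Lemma ell1ZP (v : int -> R[i]) : ell1Z v <-> bsum (fun n => normc (v n)).
Proof. by rewrite /ell1Z; apply: esum_bsum => n; exact: normc_ge0. Qed.

Lemma ell1Z_bounded (v : int -> R[i]) : ell1Z v -> exists c, forall m, normc (v m) <= c.
Proof.
move=> /ell1ZP[c hc]; exists c => m.
by have := hc [fset m]%fset; rewrite big_seq_fset1.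
Qed.

Fact ell1Z_submod_closed : submod_closed ell1Z_pred.
Proof.
split=> [|k u v /asboolP/ell1ZP hu /asboolP/ell1ZP hv]; apply/asboolP/ell1ZP.
  by exists 0 => A; rewrite big1// => n _; rewrite ComplexField.Normc.normc0.
apply: bsum_le (bsumD (bsumZ (normc_ge0 k) hu) hv) => n.
by apply: le_trans (normcD' _ _) _; rewrite -normcM.
Qed.

HB.instance Definition _ := GRing.isSubmodClosed.Build R[i] (int -> R[i]) ell1Z_pred
  ell1Z_submod_closed.

(** A type rather than a set of sequences, because [primitive_ideal] asks for a representation on an
    [lmodType]. *)
Record ell1Z_space := Ell1ZSpace {
  ell1Z_val :> int -> R[i];
  ell1Z_valP : ell1Z_val \in ell1Z_pred }.

HB.instance Definition _ := [isSub for ell1Z_val].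
HB.instance Definition _ := [Choice of ell1Z_space by <:].
HB.instance Definition _ := [SubChoice_isSubLmodule of ell1Z_space by <:].

End SummableSequences.

(** * The ideals of aperiodic points *)

Section AperiodicIdeals.
Context {R : realType} {X : dynsys}.
Local Notation A := (ell1 R X).
Implicit Types (a b : A) (x : X) (u v w : int -> R[i]).

Fact ell1_cst_continuous v (n : int) : continuous (fun _ : X => v n).
Proof. exact: cst_continuous. Qed.

Fact ell1_cst_summable v : ell1Z v ->
  (\esum_(n in [set: int]) (supnorm (fun _ : X => v n))%:E < +oo)%E.
Proof.
by move=> /ell1ZP hv; apply: bsum_ell1; apply: bsum_le hv => n; exact: supnorm_le.
Qed.

(* sum_n v_n delta^n *)
Definition ell1_cst v (hv : ell1Z v) : A :=
  Ell1 (@ell1_cst_continuous v) (ell1_cst_summable hv).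

(** The action is read off from the product of [a] with sum_n v_n delta^n, so summability of the
    result is inherited from l^1(Sigma). *)
Lemma aper_rep_mul a v (hv : ell1Z v) x m :
  aper_rep x a v m = (a * ell1_cst hv) m (dyn_iter m x).
Proof. by []. Qed.

Lemma aper_rep_ell1Z a v x : ell1Z v -> ell1Z (aper_rep x a v).
Proof.
move=> hv; apply/ell1ZP; apply: bsum_le (ell1_bsum (a * ell1_cst hv)) => n.
by rewrite aper_rep_mul; exact: ell1_le.
Qed.

Definition delta0 (m : int) : R[i] := (m == 0)%:R.

Lemma delta0_bound m : normc (delta0 m) <= 1.
Proof. by rewrite /delta0 -lecR -normcE' normr_nat; case: eqP; rewrite ?lexx ?ler01. Qed.

Lemma ell1Z_delta0 : ell1Z delta0.
Proof.
apply/ell1ZP; exists 1 => B.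
have d0 n : n != 0 -> normc (delta0 n) = 0.
  by rewrite /delta0 => /negPf ->; exact: ComplexField.Normc.normc0.
have [B0|B0] := boolP (0 \in B).
  rewrite (bigD1_seq 0 B0 (fset_uniq B)) big1 => [|n /d0 //].
  by rewrite -[leLHS]/(normc (delta0 0) + 0) addr0 delta0_bound.
rewrite big_seq_cond big1 ?ler01// => n /andP[nB _]; apply: d0.
by apply: contraNneq B0 => <-.
Qed.

Lemma ell1Z_shift k v : ell1Z v -> ell1Z (fun n => v (n - k)).
Proof. by move=> /ell1ZP hv; apply/ell1ZP; exact: bsum_inj (@addIr _ (- k)) hv. Qed.

Lemma aper_rep_delta0 a x m : aper_rep x a delta0 m = a m (dyn_iter m x).
Proof.
apply: zsumE; rewrite (_ : a m _ = a m (dyn_iter m x) * delta0 (m - m)); last first.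
  by rewrite subrr /delta0 eqxx mulr1.
by apply: has_sum1 => n nm; rewrite /delta0 subr_eq0 eq_sym (negPf nm) mulr0.
Qed.

(** The ideal consists of the elements whose coefficients all vanish along the orbit; the unit
    vectors serve as test vectors. *)
Lemma aper_idealP x a : aper_ideal x a <-> forall n k : int, a n (dyn_iter k x) = 0.
Proof.
split=> [ha n k|ha v hv]; last first.
  apply/funext => m; have [c vc] := ell1Z_bounded hv.
  apply: has_sum_unique (aper_rep_sum vc a x m) _.
  rewrite (_ : (fun _ => _) = fun=> 0); first exact: has_sum0.
  by apply/funext => n; rewrite ha mul0r.
(* On the unit vector at k - n, the k-th coordinate of the result is exactly [a n] at sigma^k x. *)
have hd := ell1Z_shift (k - n) ell1Z_delta0.
have /(congr1 (@^~ k)) := ha _ hd.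
have := aper_rep_shift a x delta0 (k - n) n.
by rewrite subrKC aper_rep_delta0 -dyn_iterD subrKC => <-.
Qed.

Lemma half_sum n : \sum_(k < n) 2^-1 ^+ k <= 2 :> R.
Proof.
suff -> : \sum_(k < n) 2^-1 ^+ k = 2 - 2 * 2^-1 ^+ n :> R.
  by rewrite lerBlDr lerDl mulr_ge0// exprn_ge0.
elim: n => [|n ih]; first by rewrite big_ord0 expr0; ring.
by rewrite big_ord_recr/= ih exprS; field.
Qed.

(* The Neumann series of the convolution operator by [u = delta_0 - r], [|r| <= 1/2]. *)
Lemma aper_rep_near_delta0 x u : ell1Z u -> u 0 = 1 ->
  (forall B : {fset int}, 0 \notin B -> \sum_(n <- B) normc (u n) <= 2^-1) ->
  exists b, aper_rep x b u = delta0.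
Proof.
move=> hu u0 hB; pose c := ell1_cst hu; pose r := 1 - c.
have rE n y : r n y = delta0 n - u n.
  rewrite /r -[RHS]/((fun=> delta0 n - u n) y) ell1_addE; congr (_ + _).
    by rewrite -[1]/ell1_one ell1_oneE /delta0; case: eqP.
  by rewrite -scaleN1r ell1_scaleE mulN1r.
have rD : r = 1 - c by [].
(* Since u 0 = 1, the zeroth coefficient of [r] vanishes and only the mass of [u] off 0 remains. *)
clearbody r; have rb : ell1_bound r 2^-1.
  move=> B; apply: le_trans (hB [fset n in B | n != 0]%fset _); last by rewrite !inE eqxx andbF.
  rewrite (big_fsetID _ (fun n => n != 0))/= [X in _ + X]big1_fset ?addr0.
    rewrite big_seq [leRHS]big_seq; apply: ler_sum => n; rewrite !inE => /andP[_ /negPf n0].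
    by apply: supnorm_le => y; rewrite rE /delta0 n0 sub0r -[- _]sub0r normcB subr0.
  move=> n; rewrite !inE negbK => /andP[_ /eqP n0] _.
  apply/eqP; rewrite eq_le supnorm_ge0 andbT; apply: supnorm_le => y.
  by rewrite rE n0 u0 /delta0 eqxx subrr ComplexField.Normc.normc0.
have rkb k : ell1_bound (r ^+ k) (2^-1 ^+ k).
  elim: k => [|k ih]; last by rewrite !exprS; exact: ell1_boundM.
  rewrite !expr0 -[1]/(ell1_single _ 0); apply: ell1_bound_single => y.
  by rewrite ComplexField.Normc.normc1.
have [|b hb] := @ell1_series R X _ _ rkb; first by apply: bsum_nat half_sum => k; exact: exprn_ge0.
exists b; apply/funext => m; have [d ud] := ell1Z_bounded hu.
have /has_sum_nat hs := hb x u d m ud.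
have uE : u = aper_rep x c delta0 by apply/funext => l; rewrite aper_rep_delta0.
(* As [u] is the image of [delta0] under c = 1 - r, the series of the r^k applied to [u] telescopes
   to [delta0] minus a remainder of size at most 2^-n. *)
have step k : aper_rep x (r ^+ k) u m =
    aper_rep x (r ^+ k) delta0 m - aper_rep x (r ^+ k.+1) delta0 m.
  have cE : r ^+ k * c = r ^+ k - r ^+ k.+1.
    by rewrite exprSr (_ : c = 1 - r) ?mulrBr ?mulr1// rD subKr.
  by rewrite {1}uE -(aper_repM delta0_bound) cE (aper_repB delta0_bound).
have partial n : \sum_(k < n) aper_rep x (r ^+ k) u m =
    delta0 m - aper_rep x (r ^+ n) delta0 m.
  elim: n => [|n ih].
    by rewrite big_ord0 expr0 (aper_rep1 delta0_bound) subrr.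
  by rewrite big_ord_recr/= ih step addrA subrK.
apply/eqP; rewrite -subr_eq0 -normr_le0; apply/ler_addgt0Pl => e e0; rewrite addr0.
have [e' ee' e'0] := gt0_realC e0.
have [N hN] := hs _ (divr_gt0 e0 (ltr0Sn _ 1)).
have [M hM] : exists M, forall n, (M <= n)%N -> 2^-1 ^+ n <= e' / 2.
  have /cvgrPdist_le/(_ (e' / 2)) : (2^-1 ^+ n @[n --> \oo] --> (0 : R)).
    by apply: cvg_expr; rewrite ger0_norm ?invr_ge0// invf_lt1// ltr1n.
  move=> /(_ (divr_gt0 e'0 (ltr0Sn _ 1))) [M _ hM]; exists M => n /hM.
  by rewrite sub0r normrN ger0_norm// exprn_ge0.
have := hN (maxn N M) (leq_maxl _ _); rewrite partial => h1.
have h2 := aper_rep_bound delta0_bound x m (rkb (maxn N M)).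
have {}h2 : `|aper_rep x (r ^+ maxn N M) delta0 m| <= e / 2.
  rewrite normcE' ee' (_ : e'%:C / 2 = (e' / 2)%:C) ?lecR; last first.
    by rewrite rmorphM/= fmorphV rmorph_nat.
  by apply: le_trans h2 _; rewrite mulr1; exact: hM (leq_maxr _ _).
rewrite distrC in h1.
rewrite (_ : _ - _ = (aper_rep x b u m - (delta0 m - aper_rep x (r ^+ maxn N M) delta0 m))
   - aper_rep x (r ^+ maxn N M) delta0 m); last by ring.
by apply: le_trans (ler_normB _ _) _; rewrite [leRHS]splitr; apply: lerD => //; exact: ltW.
Qed.

Definition aper_space_rep x a (v : @ell1Z_space R) : @ell1Z_space R :=
  Ell1ZSpace (introT (asboolP _) (aper_rep_ell1Z a x (elimT (asboolP _) (ell1Z_valP v)))).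

Lemma aper_space_repE x a (v : @ell1Z_space R) :
  aper_space_rep x a v = aper_rep x a v :> (int -> R[i]).
Proof. by []. Qed.

Lemma ell1Z_spaceP (v : @ell1Z_space R) : ell1Z v.
Proof. exact/asboolP/ell1Z_valP. Qed.

Lemma aper_ideal_rep_ker x : aper_ideal x = rep_ker (aper_space_rep x) :> set A.
Proof.
apply/seteqP; split=> a ha.
  move=> v; apply: val_inj => /=.
  by rewrite ha//; exact: ell1Z_spaceP.
move=> v hv; have /(congr1 ell1Z_val) := ha (Ell1ZSpace (introT (asboolP _) hv)).
by rewrite aper_space_repE.
Qed.

Lemma aper_space_representation x : representation (aper_space_rep x).
Proof.
split=> [a k u v|v k a b|a b v]; apply/val_inj/funext => m /=.
- have [c uc] := ell1Z_bounded (ell1Z_spaceP u).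
  have [d vd] := ell1Z_bounded (ell1Z_spaceP v).
  have kuc l : normc (k * u l) <= normc k * c by rewrite normcM ler_wpM2l ?normc_ge0.
  by rewrite -[RHS]/(k * aper_rep x a u m + aper_rep x a v m)
    -(aper_repZr _ _ _ uc) -(aper_repDr _ _ kuc vd).
- have [c vc] := ell1Z_bounded (ell1Z_spaceP v).
  by rewrite (aper_repDl vc) (aper_repZl vc).
- have [c vc] := ell1Z_bounded (ell1Z_spaceP v).
  by rewrite (aper_repM vc).
Qed.

(** A nonzero invariant [W] contains some [w] with w_j <> 0. Shift position j to 0, divide by w_j,
    and multiply by a bump that is 1 at x and 0 at sigma^n x for the finitely many n <> 0 outside
    which the tail is small; aperiodicity keeps these points away from x. The result is so close to
    [delta0] that the Neumann series carries it to [delta0]. *)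
Lemma aper_ideal_primitive x : Aper x -> primitive_ideal (aper_ideal x : set A).
Proof.
move=> ax; exists (@ell1Z_space R), (aper_space_rep x); split; last exact: aper_ideal_rep_ker.
pose d0 := Ell1ZSpace (introT (asboolP _) ell1Z_delta0).
split; first exact: aper_space_representation.
  exists 1, d0 => /(congr1 (fun v : ell1Z_space => v 0)); rewrite aper_space_repE.
  by rewrite (aper_rep1 delta0_bound) /delta0 eqxx => /eqP; rewrite oner_eq0.
move=> W [W0 Wl Wa]; have [->|WN] := eqVneq W [set 0]; [by left|right].
have [w Ww [j wj]] : exists2 w, W w & exists j, w j <> 0.
  apply: contrapT => h; move/eqP: WN; apply; apply/seteqP; split=> [w Ww /=|w ->//].
  apply: contrapT => w0; apply: h; exists w => //; apply/existsNP => h; apply: w0.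
  exact/val_inj/funext.
have hw := ell1Z_spaceP w; have [c wc] := ell1Z_bounded hw.
have wj0 : 0 < normc (w j).
  by rewrite lt_neqAle normc_ge0 andbT eq_sym; apply/eqP => /ComplexField.Normc.eq0_normc.
have bw : bsum (fun n => normc (w (n + j))).
  by move/ell1ZP: hw => /(bsum_inj (@addIr _ j)).
have [F hF] := bsum_tail (fun=> normc_ge0 _) bw (divr_gt0 wj0 (ltr0Sn _ 1)).
have [||g [cg g1 gx gF]] := @dyn_bump R X x [set dyn_iter n x | n in [set` F] `\ (0 : int)].
- by apply: finite_image; apply: finite_setD; exact: finite_fset.
- by move=> [n [/= _ n0]] /(Aper_free ax).
pose a : A := (w j)^-1 *: ell1_single cg (- j).
have uE m : aper_rep x a w m = (w j)^-1 * (g (dyn_iter m x) * w (m + j)).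
  by rewrite (aper_repZl wc) (aper_rep_single wc) opprK.
have [||b hb] := @aper_rep_near_delta0 x (aper_rep x a w) (aper_rep_ell1Z a x hw).
- by rewrite uE /= gx mul1r add0r mulVf//; apply/eqP.
- move=> B B0; apply: (@le_trans _ _ (\sum_(n <- B | n \notin F) normc (w (n + j)) / normc (w j))).
    rewrite [leRHS]big_mkcond big_seq [leRHS]big_seq; apply: ler_sum => n nB.
    have n0 : n != 0 by apply: contraNneq B0 => <-.
    rewrite uE !normcM; have -> : normc ((w j)^-1) = (normc (w j))^-1.
      by apply: complexI; rewrite fmorphV/= -!normcE' normfV.
    have [nF|nF] := boolP (n \in F).
      rewrite gF ?ComplexField.Normc.normc0 ?mul0r ?mulr0 ?divr_ge0 ?normc_ge0//.
      by exists n => //; split => //; apply/eqP.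
    by rewrite mulrC ler_wpM2r ?invr_ge0 ?normc_ge0// ler_piMl ?normc_ge0.
  rewrite -mulr_suml ler_pdivrMr// mulrC.
  rewrite (_ : \sum_(n <- B | _) _ = \sum_(n <- [fset n in B | n \notin F]%fset) normc (w (n + j))).
    by apply: hF; apply/fdisjointP => n nF; rewrite !inE nF andbF.
  rewrite -big_filter; apply: perm_big.
  apply: uniq_perm; [exact/filter_uniq/fset_uniq|exact: fset_uniq|].
  by move=> n; rewrite mem_filter !inE andbC.
apply/seteqP; split=> // v _.
have Wd : W d0.
  have := Wa b _ (Wa a _ Ww); congr W; apply: val_inj; exact: hb.
(* [delta0] is cyclic: sum_n v_n delta^n sends it to v. *)
have := Wa (ell1_cst (ell1Z_spaceP v)) _ Wd; congr W; apply/val_inj/funext => m /=.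
by rewrite aper_rep_delta0.
Qed.

End AperiodicIdeals.

(** * Compactness by ultrafilters, and the unit circle *)

Section Compactness.

Lemma fmap_ultra (T U : Type) (f : T -> U) (F : set_system T) :
  UltraFilter F -> UltraFilter (f @ F).
Proof.
move=> UF; have PF := @ultra_proper _ F UF; split; first exact: fmap_proper_filter.
move=> G PG FG; apply/seteqP; split=> // B GB.
have [//|FB] := in_ultra_setVsetC (f @^-1` B) UF.
have /filter_ex[x [Bx nBx]] : G (B `&` ~` B) by apply: filterI => //; exact: FG.
by [].
Qed.

Lemma compact_set_type (T : topologicalType) (A : set T) :
  compact A -> compact [set: A].
Proof.
rewrite compact_ultra => cA; rewrite compact_ultra => F UF _.
have /cA[|p [Ap Fp]] := @fmap_ultra A T \val F UF.
  by apply: (@filterS _ F _ setT); [move=> x _; exact: set_valP|exact: filterT].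
exists (SigSub (mem_set Ap)); split=> // U [V /= [[W oW <-] Wp]].
by move=> WU; apply: (@filterS _ F _ _ _ WU); apply: Fp; exact: open_nbhs_nbhs.
Qed.

Lemma compact_setTX (T U : topologicalType) :
  compact [set: T] -> compact [set: U] -> compact [set: T * U].
Proof.
rewrite !compact_ultra => cT cU F UF _.
have [p [_ Fp]] := cT _ (@fmap_ultra _ _ fst F UF) filterT.
have [q [_ Fq]] := cU _ (@fmap_ultra _ _ snd F UF) filterT.
exists (p, q); split=> //; have := cvg_pair Fp Fq.
rewrite (_ : (fun x => (x.1, x.2)) = id); last by apply/funext; case.
exact.
Qed.

Variable R : realType.

Lemma unit_circle_closed : closed (unit_circle R).
Proof.
rewrite (_ : unit_circle R = (normc : R[i] -> R) @^-1` [set x | x = 1]).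
  by apply: preimage_closed => [z _|]; [exact: normc_continuous|exact: closed_eq].
by apply/seteqP; split=> z /unit_circle_normc.
Qed.

Lemma unit_circle_compact : compact (unit_circle R).
Proof.
(* The circle is a closed subset of the image of the square [-1, 1]^2 under (a, b) -> a + ib. *)
pose f (p : `[-1, 1]%classic * `[-1, 1]%classic) : R[i] := (\val p.1)%:C + 'i * (\val p.2 : R)%:C.
have cf : continuous f.
  apply: continuousCD; last apply: continuousCM; [|exact: cst_continuous|];
    apply: realC_continuous => p; apply: continuous_comp;
    [exact: cvg_fst|exact: initial_continuous|exact: cvg_snd|exact: initial_continuous].
have ci := @compact_set_type R _ (@segment_compact R (-1) 1).
apply: (@subclosed_compact _ _ (range f)); first exact: unit_circle_closed.
  by apply: continuous_compact; [exact: continuous_subspaceT|exact: compact_setTX].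
move=> z /unit_circle_normc z1.
have bound (x : R) : x ^+ 2 <= 1 -> x \in `[-1, 1]%classic.
  by move=> x1; rewrite inE/= in_itv/= -ler_norml -(@expr_le1 _ 2)// real_normK ?num_real.
have z2 : complex.Re z ^+ 2 + complex.Im z ^+ 2 = 1.
  move: z1; case: (z) => a b /= z1.
  by rewrite -[LHS]sqr_sqrtr ?addr_ge0 ?sqr_ge0// z1 expr1n.
have Re1 : complex.Re z ^+ 2 <= 1 by rewrite -z2 lerDl sqr_ge0.
have Im1 : complex.Im z ^+ 2 <= 1 by rewrite -z2 lerDr sqr_ge0.
by exists (SigSub (bound _ Re1), SigSub (bound _ Im1)); rewrite // /f/= -complexE.
Qed.

End Compactness.

(** * Continuous dependence of the periodic representations on their parameters *)

Section ContinuousDependence.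
Context {R : realType} {X : dynsys} {Y : topologicalType}.
Local Notation A := (ell1 R X).
Variables (xi : Y -> X) (ell : Y -> R[i]).
Hypotheses (cxi : continuous xi) (cell : continuous ell).
Hypothesis ell1' : forall y, unit_circle R (ell y).

(** The n-th term of the series is at most [supnorm (a n)] whatever the parameters, because |lam| =
    1; the M-test applies. *)
Lemma per_mx_continuous (p : nat) (a : A) (i j : 'I_p) :
  continuous (fun y => per_mx p (xi y) (ell y) a i j).
Proof.
have p0 : (0 < p)%N by apply: leq_ltn_trans (ltn_ord i).
pose g (n : int) y := a n (dyn_iter i (xi y)) * qp_delta p (ell y) j (i%:Z - n).
have cV : continuous (fun y => (ell y)^-1).
  move=> y; apply: (@cvgV R[i] _ (nbhs y) _ ell); last exact: cell.
  by apply: unit_circle_neq0.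
have cX f (cf : continuous f) (m : nat) : continuous (fun y : Y => (f y : R[i]) ^+ m).
  elim: m => [|m ih]; first by under eq_fun do rewrite expr0; exact: cst_continuous.
  by under eq_fun do rewrite exprS; exact: continuousCM.
apply: (@continuous_has_sum R _ _ g _ _ _ _ (ell1_bsum a)) => [n|n y|y].
- apply: continuousCM.
    move=> y; apply: (@continuous_comp _ _ _ xi (a n \o dyn_iter i)); first exact: cxi.
    by apply: continuous_comp; [exact: dyn_iter_continuous|exact: ell1_continuous].
  rewrite /qp_delta; case: eqP => _; last exact: cst_continuous.
  case: (- _)%R => m; first exact: (cX _ cell).
  by under eq_fun do rewrite /exprz -exprVn; exact: (cX _ cV).
- rewrite /g normcM -[leRHS]mulr1; apply: ler_pM; rewrite ?normc_ge0 ?ell1_le//.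
  exact: qp_delta_bound.
- by rewrite per_mxE//; apply: aper_rep_sum; exact: qp_delta_bound.
Qed.

Lemma per_ideal_closed (p : nat) (a : A) :
  closed [set y | per_ideal p (xi y) (ell y) a].
Proof.
rewrite (_ : [set _ | _] = \bigcap_(ij in [set: 'I_p * 'I_p])
    (fun y => per_mx p (xi y) (ell y) a ij.1 ij.2) @^-1` [set 0]); last first.
  apply/seteqP; split=> y /=; first by move=> /per_mx_eq0 h [i j] _; exact: h.
  by move=> h; apply/per_mx_eq0 => i j; exact: (h (i, j)).
apply: closed_bigI => ij _; apply: preimage_closed => [y _|].
  exact: per_mx_continuous.
by apply: accessible_closed_set1; apply: hausdorff_accessible; exact: norm_hausdorff.
Qed.

End ContinuousDependence.

(** * Compactness of the space of ideals *)

Section SpectrumCompact.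
Context {R : realType} {X : dynsys}.
Local Notation A := (ell1 R X).
Local Notation T := (unit_circle R).

(** Test [a] on the quasi-periodic sequence supported on k - n + pZ. The k-th coordinate is 0, and
    it is the value of [a n] at sigma^k x plus terms of index m congruent to n modulo p. Those with
    m <> n lie outside [B], so they add up to at most e. *)
Lemma per_ideal_coef_le (p : nat) (x : X) (lam : R[i]) (a : A) (n k : int)
    (B : {fset int}) (e : R) :
  (0 < p)%N -> dyn_iter p x = x -> T lam -> per_ideal p x lam a ->
  (forall m, m \in B -> (`|m - n| < p)%N) ->
  (forall D, [disjoint B & D]%fset -> \sum_(m <- D) supnorm (a m) <= e) ->
  normc (a n (dyn_iter k x)) <= e.
Proof.
move=> p0 px lam1 /(per_idealP p0 a px lam1) ha Bp Be.
pose v m := qp_delta p lam 0 (m - (k - n)).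
have hv : quasi_periodic p lam v.
  by move=> m; rewrite /v addrAC (@qp_delta_quasi_periodic _ p lam p0 lam1 0).
have v1 m : normc (v m) <= 1 by exact: qp_delta_bound.
have vE m : v (k - m) = qp_delta p lam 0 (n - m).
  by rewrite /v; congr qp_delta; ring.
have h0 := aper_rep_sum v1 a x k; rewrite (ha v hv k) in h0.
pose c m : R[i] := if m == n then a n (dyn_iter k x) else 0.
have hc : has_sum c (c n) by apply: has_sum1 => m /negPf mn; rewrite /c mn.
have := has_sum_normc (M := e) (has_sumD h0 (has_sumN hc)).
rewrite add0r /c eqxx -[- _]sub0r normcB subr0; apply=> D.
rewrite (big_fsetID _ (mem B))/= big1_fset ?add0r => [|m]; last first.
  rewrite !inE/= => /andP[_ mB] _; rewrite vE; case: eqP => [->|/eqP mn].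
    rewrite /qp_delta subrr mod0z div0z oppr0 expr0z mulr1 subrr.
    exact: ComplexField.Normc.normc0.
  rewrite /qp_delta; case: eqP => [/dvdz_mod0P|_]; last first.
    by rewrite mulr0 subrr ComplexField.Normc.normc0.
  rewrite dvdzE -[n - m]opprB abszN => /dvdn_leq; rewrite absz_gt0 subr_eq0 mn.
  by move=> /(_ isT); rewrite leqNgt Bp.
apply: le_trans (Be [fset m in D | m \notin B]%fset _); last first.
  by apply/fdisjointP => m mB; rewrite !inE mB andbF.
apply: ler_sum => m _; case: eqP => [->|_].
  by rewrite vE /qp_delta subrr mod0z div0z oppr0 expr0z mulr1 subrr
    ComplexField.Normc.normc0 supnorm_ge0.
by rewrite subr0; have := aper_rep_term v1 a x k m; rewrite mul1r.
Qed.

(** One parameter type for both kinds of ideals, so that an ultrafilter of ideals can be pushed to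
    the compact space X x T; period 0 encodes an infinite orbit. *)
Definition prim_data (P : set A) (d : nat * (X * T)) :=
  (d.1 = 0%N /\ Aper d.2.1 /\ P = aper_ideal d.2.1) \/
  (minimal_period d.1 d.2.1 /\ P = per_ideal d.1 d.2.1 (\val d.2.2)).

Lemma unit_circle1 : T 1. Proof. by rewrite /unit_circle/= normr1. Qed.

Lemma Pi_ell1_prim_data (S : set X) P : Pi_ell1 R S P -> exists d, prim_data P d.
Proof.
move=> [[p [x [lam [_ /Per_P px lam1 ->]]]]|[x [_ ax ->]]].
  by exists (p, (x, SigSub (mem_set lam1))); right.
by exists (0%N, (x, SigSub (mem_set unit_circle1))); left.
Qed.

Lemma per_ideal_Pi_ell1 (p : nat) (x : X) (lam : R[i]) :
  minimal_period p x -> T lam ->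
  exists2 P, Pi_ell1 R [set: X] P & P = per_ideal p x lam :> set A.
Proof.
move=> px lam1; have [p0 _ _] := px.
exists (PrimitiveIdeal (per_ideal_primitive p0 px lam1)) => //.
by left; exists p, x, lam; split=> //; apply/Per_P.
Qed.

Lemma aper_ideal_Pi_ell1 (x : X) : Aper x ->
  exists2 P, Pi_ell1 R [set: X] P & P = aper_ideal x :> set A.
Proof.
move=> ax; exists (PrimitiveIdeal (aper_ideal_primitive ax)) => //.
by right; exists x; split.
Qed.

(** With mu a root of lam of order q/p, every sequence of quasi-period (p, mu) also has quasi-period
    (q, lam), hence is killed. *)
Lemma per_ideal_minimal (q p : nat) (x : X) (lam : R[i]) :
  (0 < q)%N -> minimal_period p x -> (p %| q)%N -> T lam ->
  exists2 mu, T mu & (per_ideal q x lam : set A) `<=` per_ideal p x mu.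
Proof.
move=> q0 px pq lam1; have [p0 px' _] := px.
have k0 : (0 < q %/ p)%N by rewrite divn_gt0// dvdn_leq.
pose mu := (q %/ p)%N.-root lam.
have mul : mu ^+ (q %/ p) = lam by exact: rootCK.
have mu1 : T mu by rewrite /unit_circle/= norm_rootC lam1 rootC1.
exists mu => // a; have qx : dyn_iter q x = x.
  by rewrite -(divnK pq) PoszM dyn_iter_period.
move=> /(per_idealP q0 a qx lam1) ha; apply/per_idealP => // v hv; apply: ha => m.
rewrite -(divnK pq) PoszM (quasi_periodicE mu1 _ _ hv).
by rewrite -invr_expz -exprnP mul.
Qed.

Lemma aper_sub_per_ideal (p : nat) (x : X) (lam : R[i]) : (0 < p)%N ->
  T lam -> aper_ideal x `<=` (per_ideal p x lam : set A).
Proof.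
move=> p0 lam1 a /aper_idealP ha; apply/per_mx_eq0 => // i j; rewrite per_mxE//.
apply: has_sum_unique (aper_rep_sum (qp_delta_bound p lam1 j) a x i) _.
rewrite (_ : (fun _ => _) = fun=> 0); first exact: has_sum0.
by apply/funext => n; rewrite ha mul0r.
Qed.

Lemma Pi_ell1_compact : compact (Pi_ell1 R [set: X]).
Proof.
rewrite compact_ultra => F UF FPi; have PF := @ultra_proper _ F UF.
pose J : set A := [set a | F [set Q | prim_set Q a]].
(* Containing [J] is enough for convergence to [P]: if the complement of an open [V] around [P]
   belonged to [F], each element common to the ideals in that complement would be in [J], hence in
   [P], and [P] would lie in the closure of that complement. *)
suff [P PiP JP] : exists2 P, Pi_ell1 R [set: X] P & J `<=` P.
  exists P; split=> // U; rewrite nbhsE => -[V [oV VP] VU]; apply: (filterS VU).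
  have [//|FV] := in_ultra_setVsetC V UF; exfalso.
  have : (~` V) P by apply: oV => a Va; apply: JP; apply: filterS FV => Q /Va.
  exact.
have /boolp.choice[d hd] (Q : primitive_spectrum A) :
    exists d, Pi_ell1 R [set: X] Q -> prim_data Q d.
  have [PQ|nPQ] := pselect (Pi_ell1 R [set: X] Q).
    by have [d hd] := Pi_ell1_prim_data PQ; exists d.
  have [x _] := dyn_nonempty X.
  by exists (0%N, (x, SigSub (mem_set unit_circle1))).
have cXT : compact [set: X * T].
  by apply: compact_setTX; [exact: dyn_compact|exact/compact_set_type/unit_circle_compact].
move: cXT; rewrite compact_ultra => cXT.
have [[y lam] [_ dy]] := cXT _ (@fmap_ultra _ _ (snd \o d) F UF) filterT.
have lam1 : T (\val lam) := set_valP lam.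
have cfst : continuous (fst : X * T -> X) by move=> z; exact: cvg_fst.
have csnd : continuous (fun z : X * T => \val z.2 : R[i]).
  by move=> z; apply: continuous_comp; [exact: cvg_snd|exact: initial_continuous].
have closedF (D : set (X * T)) : closed D -> F ((snd \o d) @^-1` D) -> D (y, lam).
  move=> cD FD; apply: contrapT => nD.
  have : nbhs (y, lam) (~` D) by apply: open_nbhs_nbhs; split=> //; exact: closed_openC.
  move=> /dy FnD.
  have FF : F ((snd \o d) @^-1` D `&` (snd \o d) @^-1` (~` D)) by exact: filterI.
  by have [Q [DQ /(_ DQ)]] := filter_ex FF.
(* Either one positive period occurs along the ultrafilter, or every bounded range of positive
   periods is eventually avoided. *)
have [[p [p0 Fp]]|nF] := pselect (exists p, (0 < p)%N /\ F [set Q | (d Q).1 = p]).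
  have FQ : F [set Q | Pi_ell1 R [set: X] Q /\ (d Q).1 = p] by exact: filterI.
  have data Q : Pi_ell1 R [set: X] Q /\ (d Q).1 = p ->
      minimal_period p (d Q).2.1 /\ Q = per_ideal p (d Q).2.1 (\val (d Q).2.2) :> set A.
    by move=> [/hd[[d0 _]|+] dp]; [rewrite -dp d0 in p0|rewrite dp].
  have py : dyn_iter p y = y.
    have xy : (d Q).2.1 @[Q --> F] --> y by apply: cvg_comp dy _; exact: (cfst (y, lam)).
    have py : dyn_iter p (d Q).2.1 @[Q --> F] --> dyn_iter p y.
      by apply: cvg_comp xy _; exact: dyn_iter_continuous.
    apply: (cvg_unique (@dyn_hausdorff X) py); apply: cvg_trans xy.
    by apply: near_eq_cvg; apply: filterS FQ => Q /data[[]].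
  have Jy : J `<=` per_ideal p y (\val lam).
    move=> a Ja; apply: (@closedF [set z | per_ideal p z.1 (\val z.2) a]).
      by apply: per_ideal_closed => // z; exact: set_valP.
    by apply: filterS (filterI FQ Ja) => Q [/data[_ QE]] /=; rewrite QE.
  (* The period may drop in the limit, to a divisor of p. *)
  have [q qy qp] := periodic_minimal_period p0 py.
  have [mu mu1 sub] := per_ideal_minimal p0 qy qp lam1.
  have [P PiP PE] := per_ideal_Pi_ell1 qy mu1.
  by exists P => //; rewrite PE; exact: subset_trans Jy sub.
(* The ultrafilter excludes the periods 1, ..., N one after the other; infinite orbits, coded by 0,
   stay. *)
have large N : F [set Q | Pi_ell1 R [set: X] Q /\ ((d Q).1 = 0%N \/ (N < (d Q).1)%N)].
  elim: N => [|N ih].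
    by apply: filterS FPi => Q PQ; split=> //; case: (d Q).1 => [|n]; [left|right].
  have [FN|FN] := in_ultra_setVsetC [set Q | (d Q).1 = N.+1] UF.
    by case: nF; exists N.+1.
  apply: filterS (filterI ih FN) => Q [[PQ [d0|dN]] /= dN']; split=> //; first by left.
  by right; rewrite ltn_neqAle dN andbT eq_sym; apply/eqP.
have Jy : J `<=` aper_ideal y.
  move=> a Ja; apply/aper_idealP => n k.
  suff h e : 0 < e -> normc (a n (dyn_iter k y)) <= e.
    apply: ComplexField.Normc.eq0_normc; apply/eqP; rewrite eq_le normc_ge0 andbT.
    by apply/ler_addgt0Pl => e e0; rewrite addr0; exact: h.
  (* All but e of the mass of [a] sits on [B]. A period beyond [N] exceeds every distance from n to
     [B], so the coefficient is at most e along the ultrafilter, a closed condition that passes to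
     y. *)
  move=> e0; have [B hB] := bsum_tail (fun m => supnorm_ge0 (a m)) (ell1_bsum a) e0.
  pose N := (\max_(m <- B) `|m - n|%N)%N.
  apply: (@closedF [set z | normc (a n (dyn_iter k z.1)) <= e]).
    apply: (@preimage_closed _ _ _ [set r : R | r <= e]); last exact: closed_le.
    move=> z _; apply: (@continuous_comp _ _ _ (a n \o dyn_iter k \o fst) normc).
      apply: (@continuous_comp _ _ _ fst (a n \o dyn_iter k)); first exact: cfst.
      by apply: continuous_comp; [exact: dyn_iter_continuous|exact: ell1_continuous].
    exact: normc_continuous.
  apply: filterS (filterI (large N) Ja) => Q [[/hd hQ NQ] Qa] /=.
  case: hQ => [[d0 [_ QE]]|[px QE]].
    move: Qa => /=; rewrite QE => /aper_idealP ->.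
    by rewrite ComplexField.Normc.normc0 ltW.
  have [p0 px' _] := px; case: NQ => [d0|NQ]; first by rewrite d0 in p0.
  have lamQ : T (\val (d Q).2.2) by exact: set_valP.
  rewrite /= QE in Qa; apply: (per_ideal_coef_le k p0 px' lamQ Qa _ hB) => m mB.
  by apply: leq_ltn_trans NQ; rewrite /N (big_rem m)//= leq_maxl.
(* At a periodic limit point, vanishing on the orbit puts [J] into the ideal for every circle
   parameter; 1 is one choice. *)
have [fy|ay] := pselect (Per X y).
  have [p py] := Per_minimal_period fy; have [p0 _ _] := py.
  have [P PiP PE] := per_ideal_Pi_ell1 py unit_circle1.
  exists P => //; rewrite PE; apply: subset_trans Jy _.
  exact: aper_sub_per_ideal unit_circle1.
by have [P PiP PE] := aper_ideal_Pi_ell1 ay; exists P; rewrite ?PE.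
Qed.

End SpectrumCompact.

(** * The scalar iteration for the square root *)

Section SquareRoot.
Context {R : realType}.

(* Converges to [1 - sqrt (1 - c)], the smaller fixed point. *)
Definition root_iter (c : R) (n : nat) : R := iter n (fun s => (s ^+ 2 + c) / 2) 0.

Lemma root_iterS c n : root_iter c n.+1 = (root_iter c n ^+ 2 + c) / 2.
Proof. by []. Qed.

(** The map s -> (s^2 + c)/2 is increasing for s >= 0 and fixes 1 - sqrt(1 - c). *)
Lemma root_iter_bounds c n : 0 <= c <= 1 ->
  0 <= root_iter c n <= 1 - Num.sqrt (1 - c).
Proof.
move=> /andP[c0 c1]; have c1' : 0 <= 1 - c by lra.
have h := sqr_sqrtr c1'; have h0 := sqrtr_ge0 (1 - c).
set r := Num.sqrt _ in h h0 *; have r1 : r <= 1 by nra.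
elim: n => [|n /andP[s0 sr]]; first by rewrite /root_iter/=; lra.
by rewrite root_iterS; move: (root_iter c n) s0 sr => s s0 sr; apply/andP; split; nra.
Qed.

(** The increment is ((1 - s)^2 - (1 - c))/2, nonnegative as s <= 1 - sqrt(1 - c). *)
Lemma root_iter_ndecr c n : 0 <= c <= 1 -> root_iter c n <= root_iter c n.+1.
Proof.
move=> c01; have := root_iter_bounds n c01; have /andP[c0 c1] := c01.
have c1' : 0 <= 1 - c by lra.
have h := sqr_sqrtr c1'; have h0 := sqrtr_ge0 (1 - c); rewrite root_iterS.
by move: (Num.sqrt _) (root_iter _ _) h h0 => r s h h0 /andP[s0 sr]; nra.
Qed.

(** The iteration is monotone and bounded. Its limit L satisfies (1 - L)^2 = 1 - c, and the upper
    bound on the iterates selects the smaller root. *)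
Lemma root_iter_cvg c : 0 <= c <= 1 -> root_iter c @ \oo --> 1 - Num.sqrt (1 - c).
Proof.
move=> c01; have /andP[c0 c1] := c01; have c1' : 0 <= 1 - c by lra.
have cv : cvgn (root_iter c).
  apply: nondecreasing_is_cvgn; first by apply/nondecreasing_seqP => n; exact: root_iter_ndecr.
  by exists (1 - Num.sqrt (1 - c)) => _ [n _ <-]; have /andP[] := root_iter_bounds n c01.
set L := limn (root_iter c) in cv *; suff -> : 1 - Num.sqrt (1 - c) = L by exact: cv.
have L1 : L <= 1 - Num.sqrt (1 - c).
  by apply: limr_le => //; near=> n; have /andP[] := root_iter_bounds n c01.
have LE : L = (L ^+ 2 + c) / 2.
  have cv' : (fun n => (root_iter c n ^+ 2 + c) / 2) @ \oo --> (L ^+ 2 + c) / 2.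
    apply: cvgMr_tmp; apply: cvgD; last exact: cvg_cst.
    by rewrite expr2; under eq_fun do rewrite expr2; exact: cvgM.
  apply: (cvg_unique (@Rhausdorff R) _ cv').
  by have := cv; rewrite -(cvg_shiftS (root_iter c)).
have h := sqr_sqrtr c1'; have h0 := sqrtr_ge0 (1 - c).
have : (1 - L) ^+ 2 = (Num.sqrt (1 - c)) ^+ 2 by rewrite h; nra.
move/eqP; rewrite eqrXn2 ?(subr_ge0)//; [by move/eqP => <-; ring|by lra].
Unshelve. all: by end_near. Qed.

End SquareRoot.

(** * Elements of l^1(Sigma) acting as |t| for t = Re(conj(w) lam) *)

Section Regularity.
Context {R : realType} {X : dynsys}.
Local Notation A := (ell1 R X).
Local Notation T := (unit_circle R).
Local Notation D := (@ell1_single R X _ (@cst_continuous X R[i] 1)).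

Variables (p : nat) (w : R[i]).
Hypotheses (p0 : (0 < p)%N) (w1 : normc w <= 1).

Lemma normc_conj (z : R[i]) : normc z^*%C = normc z.
Proof. by case: z => a b /=; rewrite sqrrN. Qed.

Lemma unit_circleV lam : T lam -> lam^-1 = lam^*%C.
Proof.
move=> lam1; apply: (mulfI (unit_circle_neq0 lam1)).
rewrite mulfV ?unit_circle_neq0//; have := lam1; rewrite /unit_circle/= => h.
by rewrite -sqr_normc h expr1n.
Qed.

(* The function of [lam] represented by [(conj w delta^p + w delta^(-p)) / 2]. *)
Definition re_dot (lam : R[i]) : R := complex.Re (w^*%C * lam).

Lemma re_dotE lam : T lam -> (re_dot lam)%:C = (w^*%C * lam + w * lam^-1) / 2.
Proof.
move=> lam1; rewrite /re_dot ReJ_add (unit_circleV lam1).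
by congr ((_ + _) / _); rewrite rmorphM/= conjcK.
Qed.

Definition re_dot_elt : A := (w^*%C / 2) *: D p%:Z + (w / 2) *: D (- p%:Z).

(** This is 1 - t^2 with the square expanded, so that its norm can be read off from the
    coefficients. *)
Definition sqr_compl : A :=
  (1 - (normc w ^+ 2 / 2)%:C) *: 1 - (w^*%C ^+ 2 / 4) *: D (p%:Z *+ 2)
  - (w ^+ 2 / 4) *: D (- (p%:Z *+ 2)).

Section Action.
Variables (x : X) (lam : R[i]) (v : int -> R[i]).
Hypotheses (lam1 : T lam) (hv : quasi_periodic p lam v).

Let vb := quasi_periodic_bounded p0 lam1 hv.

Lemma aper_rep_D (k m : int) : aper_rep x (D (k * p)) v m = lam ^ k * v m.
Proof.
by rewrite (aper_rep_single vb) mul1r -mulNr (quasi_periodicE lam1 _ _ hv) opprK.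
Qed.

Lemma aper_rep_re_dot m : aper_rep x re_dot_elt v m = (re_dot lam)%:C * v m.
Proof.
rewrite (aper_repDl vb) !(aper_repZl vb).
have := aper_rep_D 1 m; rewrite mul1r => ->; have := aper_rep_D (-1) m; rewrite mulN1r => ->.
by rewrite re_dotE// exprN1 expr1z; ring.
Qed.

Lemma aper_rep_sqr_compl m :
  aper_rep x sqr_compl v m = (1 - re_dot lam ^+ 2)%:C * v m.
Proof.
rewrite !(aper_repB vb) !(aper_repZl vb) (aper_rep1 vb).
have := aper_rep_D 2 m; rewrite mulr_natl => ->.
have := aper_rep_D (-2) m; rewrite mulNr mulr_natl => ->.
rewrite rmorphB rmorphXn/= re_dotE// -[lam ^ (-2)]/((lam ^+ 2)^-1) -exprnP.
have -> : (normc w ^+ 2 / 2)%:C = w * w^*%C / 2.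
  by rewrite rmorphM fmorphV rmorph_nat rmorphXn/= -normcE' sqr_normc.
by rewrite rmorph1; move: (w^*%C) => u; field; rewrite ?unit_circle_neq0.
Qed.

End Action.

(** The coefficients have total mass (1 - |w|^2/2) + |w|^2/4 + |w|^2/4 = 1; |w| <= 1 makes the first
    one nonnegative. *)
Lemma sqr_compl_bound : ell1_bound sqr_compl 1.
Proof.
have n1 : normc (1 : R[i]) <= 1 by rewrite ComplexField.Normc.normc1.
have D1 n : ell1_bound (D n) 1 by exact: ell1_bound_single.
have normcr (r : R) : normc r%:C = `|r| by rewrite /= expr0n/= addr0 sqrtr_sqr.
have n0 := normc_ge0 w.
have q4 (z : R[i]) : normc (- (z ^+ 2 / 4)) = normc z ^+ 2 / 4.
  apply: complexI; rewrite -normcE' normrN normrM normfV normrX normr_nat normcE'.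
  by rewrite rmorphM fmorphV rmorph_nat rmorphXn.
have -> : 1 = normc (1 - (normc w ^+ 2 / 2)%:C) * 1 + normc (- (w^*%C ^+ 2 / 4)) * 1
    + normc (- (w ^+ 2 / 4)) * 1.
  have n2 : normc w ^+ 2 <= 1 by rewrite expr_le1.
  have n3 : 0 <= 1 - normc w ^+ 2 / 2 by move: n2; move: (_ ^+ 2) => r; lra.
  rewrite !q4 normc_conj (_ : 1 - _%:C = (1 - normc w ^+ 2 / 2)%:C) ?normcr ?ger0_norm//.
    by field.
  by rewrite rmorphB rmorph1.
rewrite /sqr_compl -!scaleNr; apply: ell1_boundD; last exact: ell1_boundZ.
apply: ell1_boundD; last exact: ell1_boundZ.
by apply: ell1_boundZ; exact: (D1 0).
Qed.

Lemma re_dot_le1 lam : T lam -> `|re_dot lam| <= 1.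
Proof.
move=> /unit_circle_normc lam1; rewrite -lecR; apply: le_trans (normc_ge_Re _) _.
by rewrite normcE' lecR normcM lam1 mulr1 normc_conj.
Qed.

(** Together with [re_dot_elt] this gives elements acting as |t| + t and |t| - t, of which at least
    one vanishes at each lam. *)
Lemma ell1_abs_re_dot : exists b : A, forall x lam v, T lam -> quasi_periodic p lam v ->
  forall m, aper_rep x b v m = `|re_dot lam|%:C * v m.
Proof.
(* The square root iteration inside the algebra, for 1 - t^2; the scalar iteration [a] for c = 1
   dominates its norms. *)
pose q n : A := iter n (fun q => (2^-1 : R[i]) *: (q * q + sqr_compl)) 0.
pose a : nat -> R := root_iter 1.
have c1 : 0 <= (1 : R) <= 1 by apply/andP; split; lra.
have half : normc (2^-1 : R[i]) = 2^-1 :> R.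
  by apply: complexI; rewrite -normcE' fmorphV/= rmorph_nat normfV normr_nat.
have qb n : ell1_bound (q n) (a n).
  elim: n => [|n ih].
    move=> B; rewrite big1// => n _; apply/eqP; rewrite eq_le supnorm_ge0 andbT.
    by apply: supnorm_le => x; rewrite ell1_zeroE ComplexField.Normc.normc0.
  rewrite /a root_iterS [_ / 2]mulrC -half; apply: ell1_boundZ; apply: ell1_boundD sqr_compl_bound.
  by rewrite expr2; exact: ell1_boundM.
have hb n : ell1_bound (q n.+1 - q n) (a n.+1 - a n).
  elim: n => [|n ih].
    rewrite /a root_iterS /= subr0 expr0n/= add0r mul0r add0r subr0 mul1r.
    by have := ell1_boundZ (2^-1) sqr_compl_bound; rewrite half mulr1.
  (* A difference of squares without commutativity. Since [a] obeys the same recurrence, the norm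
     bounds propagate. *)
  have -> : q n.+2 - q n.+1 = (2^-1 : R[i]) *: ((q n.+1 - q n) * q n.+1 + q n * (q n.+1 - q n)).
    rewrite mulrBl mulrBr addrA subrK -scalerBr; congr (_ *: _).
    by rewrite opprD addrACA subrr addr0.
  have -> : a n.+2 - a n.+1 = 2^-1 * ((a n.+1 - a n) * a n.+1 + a n * (a n.+1 - a n)).
    by rewrite /a root_iterS [in X in _ - X]root_iterS; field.
  by rewrite -half; apply: ell1_boundZ; apply: ell1_boundD; exact: ell1_boundM.
have bM : bsum (fun n => a n.+1 - a n).
  apply: (@bsum_nat R _ 1) => [n|n]; first by rewrite subr_ge0 root_iter_ndecr.
  rewrite -(big_mkord xpredT (fun n => a n.+1 - a n)) telescope_sumr// subr0.
  have /andP[_ h] := root_iter_bounds n c1; apply: le_trans h _.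
  by rewrite lerBlDr lerDl sqrtr_ge0.
have [Q hQ] := ell1_series hb bM; exists (1 - Q) => x lam v lam1 hv m.
have vb := quasi_periodic_bounded p0 lam1 hv.
set t := re_dot lam.
have t1 : 0 <= 1 - t ^+ 2 <= 1.
  have t2 : t ^+ 2 <= 1 by rewrite -real_normK ?num_real// expr_le1// re_dot_le1.
  by have := sqr_ge0 t; move: (t ^+ 2) t2 => r *; apply/andP; split; lra.
pose s := root_iter (1 - t ^+ 2).
have qs n : aper_rep x (q n) v = fun m => (s n)%:C * v m.
  elim: n => [|n ih]; apply/funext => l.
    by rewrite -[q 0%N](scale0r 1) (aper_repZl vb) !mul0r.
  rewrite [q _]/= -/(q n) (aper_repZl vb) (aper_repDl vb) (aper_repM vb) ih.
  rewrite (aper_repZr _ _ _ vb) ih (aper_rep_sqr_compl _ lam1 hv) -/t.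
  have -> : (s n.+1)%:C = ((s n)%:C ^+ 2 + (1 - t ^+ 2)%:C) / 2.
    rewrite -[s n.+1]/((s n ^+ 2 + (1 - t ^+ 2)) / 2).
    by rewrite rmorphM fmorphV rmorph_nat rmorphD rmorphXn.
  by move: (s n)%:C (1 - _)%:C (v l) => z1 z2 z3; field.
(* The partial sums of the series telescope to [q n], which acts as the scalar [s n]; the limit is 1
   - sqrt(t^2) = 1 - |t|. *)
have : aper_rep x Q v m = (1 - `|t|)%:C * v m.
  have cv1 : (fun n => (s n)%:C * v m) @ \oo --> aper_rep x Q v m.
    apply/(@cvgrPdist_lt _ R[i] _ \oo) => e e0.
    have [N hN] := has_sum_nat (hQ x v _ m vb) e0; exists N => // n /= /hN.
    rewrite distrC; congr (`|_ - _| < _).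
    under eq_bigr do rewrite (aper_repB vb) !qs -mulrBl -rmorphB/=.
    rewrite -mulr_suml -rmorph_sum/= -(big_mkord xpredT (fun n => s n.+1 - s n)).
    by rewrite telescope_sumr// subr0.
  have cv2 : (fun n => (s n)%:C * v m) @ \oo --> (1 - `|t|)%:C * v m.
    have := root_iter_cvg t1; rewrite subKr sqrtr_sqr => cs.
    have cs' : (fun n => (s n)%:C : R[i]) @ \oo --> (1 - `|t|)%:C.
      by apply: (cvg_comp _ _ cs); exact: (realC_continuous (fun r => cvg_id)).
    by apply: (@cvgM R[i] nat \oo _ (fun n => (s n)%:C) (fun=> v m) _ _ cs'); exact: cvg_cst.
  by apply: (cvg_unique _ cv1 cv2); exact: norm_hausdorff.
rewrite (aper_repB vb) (aper_rep1 vb) => ->.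
by rewrite rmorphB/= mulrBl mul1r subKr.
Qed.

End Regularity.

(** * Homeomorphisms, compactness and the Hausdorff property *)

Section Homeomorphisms.

(** The map is closed: a closed subset of a compact space has a compact image, which is closed in a
    Hausdorff space. *)
Lemma homeomorphism_compact_hausdorff (T U : topologicalType) (f : T -> U) :
  compact [set: T] -> hausdorff_space U -> continuous f -> injective f ->
  (forall u, exists t, f t = u) -> homeomorphism f.
Proof.
move=> cT hU cf fi /boolp.choice[g gK]; split=> //; exists g; split=> //; last first.
  by move=> t; apply: fi; rewrite gK.
apply/continuous_closedP => C cC; rewrite (_ : g @^-1` C = f @` C); last first.
  apply/seteqP; split=> [u Cgu|_ [t Ct <-]]; first by exists (g u).
  by rewrite /= (_ : g (f t) = t)//; apply: fi; rewrite gK.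
apply: compact_closed => //; apply: continuous_compact; first exact: continuous_subspaceT.
exact: (subclosed_compact cC cT).
Qed.

Lemma homeomorphism_sym (T U : topologicalType) (f : T -> U) :
  homeomorphism f -> homeomorphic U T.
Proof. by move=> [cf [g [cg fg gf]]]; exists g; split=> //; exists f. Qed.

Lemma compact_surj (T U : topologicalType) (f : T -> U) : compact [set: T] ->
  continuous f -> (forall u, exists t, f t = u) -> compact [set: U].
Proof.
move=> cT cf fs; rewrite (_ : [set: U] = f @` [set: T]).
  by apply: continuous_compact cT; exact: continuous_subspaceT.
by apply/seteqP; split=> // u _; have [t <-] := fs u; exists t.
Qed.

Lemma hausdorff_separated (T U : topologicalType) : hausdorff_space U ->
  (forall x y : T, x <> y -> exists2 f : T -> U, continuous f & f x <> f y) ->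
  hausdorff_space T.
Proof.
move=> hU sep x y xy; apply: contrapT => /sep[f cf]; apply; apply: hU => A B Ax By.
by have [z [Az Bz]] := xy _ _ (cf x A Ax) (cf y B By); exists (f z).
Qed.

Lemma hausdorff_setX (T U : topologicalType) :
  hausdorff_space T -> hausdorff_space U -> hausdorff_space (T * U)%type.
Proof.
move=> hT hU [x y] [x' y'] h; congr pair.
  apply: hT => A B Ax Bx; have [||z [Az Bz]] := h (A `*` setT) (B `*` setT).
  - by exists (A, setT) => //; split=> //; exact: filterT.
  - by exists (B, setT) => //; split=> //; exact: filterT.
  - by exists z.1; split; [case: Az|case: Bz].
apply: hU => A B Ax Bx; have [||z [Az Bz]] := h (setT `*` A) (setT `*` B).
- by exists (setT, A) => //; split=> //; exact: filterT.
- by exists (setT, B) => //; split=> //; exact: filterT.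
- by exists z.2; split; [case: Az|case: Bz].
Qed.

Lemma hausdorff_set_type (T : topologicalType) (A : set T) :
  hausdorff_space T -> hausdorff_space A.
Proof.
move=> hT; apply: (hausdorff_separated hT) => x y xy; exists \val.
  exact: initial_continuous.
by move=> h; apply: xy; exact: val_inj.
Qed.

Lemma continuous_set_type (T U : topologicalType) (A : set U) (f : T -> A) :
  continuous (\val \o f) -> continuous f.
Proof. exact: (@continuous_comp_initial A T U \val f). Qed.

End Homeomorphisms.

(** * Closed sets of ideals *)

Section SpectrumTopology.
Context {R : realType} {X : dynsys}.
Local Notation A := (ell1 R X).

Lemma containing_closed (a : A) : closed [set P : primitive_spectrum A | prim_set P a].
Proof.
rewrite -openC /open/= /hk_open setCK => P hP; apply: hP.
by move=> Q.
Qed.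

(** Reduces continuity of a map into the spectrum to closedness of the conditions that a fixed [a]
    lies in the ideal. *)
Lemma closed_primE (E : set (primitive_spectrum A)) : closed E ->
  E = \bigcap_(a in \bigcap_(Q in E) prim_set Q) [set P | prim_set P a].
Proof.
move=> /closure_id cE; apply/seteqP; split=> [P EP a /(_ P EP)//|P hP].
by rewrite cE closure_hull_kernel => a Ea; exact: hP.
Qed.

End SpectrumTopology.

(** With w = (mu - lam)/2 the two values are -|mu - lam|^2/4 and |mu - lam|^2/4, because lam and mu
    have modulus 1. *)
Lemma re_dot_chord (R : realType) (lam mu : R[i]) :
  unit_circle R lam -> unit_circle R mu -> lam <> mu ->
  re_dot ((2^-1)%:C * (mu - lam)) lam < 0 /\ 0 < re_dot ((2^-1)%:C * (mu - lam)) mu.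
Proof.
have sqr_unit (z : R[i]) : unit_circle R z -> complex.Re z ^+ 2 + complex.Im z ^+ 2 = 1.
  move=> /unit_circle_normc; case: z => a b /= h.
  by rewrite -[LHS]sqr_sqrtr ?addr_ge0 ?sqr_ge0// h expr1n.
move=> /sqr_unit + /sqr_unit; case: lam mu => [a b] [c d] /= h1 h2 ne.
have : 0 < (c - a) ^+ 2 + (d - b) ^+ 2.
  rewrite lt_neqAle eq_sym addr_ge0 ?sqr_ge0// andbT paddr_eq0 ?sqr_ge0//.
  rewrite !sqrf_eq0 !subr_eq0; apply/negP => /andP[/eqP ca /eqP db].
  by apply: ne; rewrite ca db.
by rewrite /re_dot /= => h; split; nra.
Qed.

(** * Separation of ideals over a union of pieces of constant period *)

Section PeriodicPieces.
Context {R : realType} {X : dynsys}.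
Local Notation A := (ell1 R X).
Local Notation T := (unit_circle R).

Lemma invariant_dyn_iter (S : set X) x (k : int) :
  invariant_set S -> S x -> S (dyn_iter k x).
Proof.
move=> iS Sx; have mapS y : S y -> S (dyn_map y) by move=> Sy; rewrite -iS; exists y.
have invS y : S y -> S (dyn_inv y).
  by rewrite -{1}iS => -[z Sz <-]; rewrite dyn_mapK.
by case: k => m; elim: m => [|m ih] //=; [exact: mapS|exact: invS|exact/invS].
Qed.

Lemma per_ideal_fct (q : nat) x (lam : R[i]) (f : X -> R[i]) (cf : continuous f) :
  minimal_period q x -> T lam ->
  per_ideal q x lam (ell1_fct cf : A) <-> forall k : int, f (dyn_iter k x) = 0.
Proof.
move=> [q0 qx _] lam1; split=> [h k|h].
  have h1 := @qp_delta_quasi_periodic _ q lam q0 lam1 0.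
  have h2 : quasi_periodic q lam (fun m => qp_delta q lam 0 (m - k)).
    by move=> m; rewrite addrAC h1.
  have h3 m : normc (qp_delta q lam 0 (m - k)) <= 1 by exact: qp_delta_bound.
  move/(per_idealP q0 _ qx lam1): h => /(_ _ h2 k).
  rewrite (aper_rep_single h3) subr0 subrr /qp_delta mod0z div0z oppr0 expr0z.
  by rewrite mulr1.
apply/(per_idealP q0 _ qx lam1) => v hv m.
by rewrite (aper_rep_single (quasi_periodic_bounded q0 lam1 hv)) h mul0r.
Qed.

Variables (n : nat) (S_ : 'I_n -> set X) (p : 'I_n -> nat) (S : set X).
Hypotheses (hS : S = \bigcup_i S_ i) (trivS : trivIset [set: 'I_n] S_).
Hypothesis hyp : forall i, [/\ (0 < p i)%N, invariant_set (S_ i), closed (S_ i) &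
  S_ i `<=` Per_ X (p i)].

Lemma piece_minimal_period i x : S_ i x -> minimal_period (p i) x.
Proof. by have [_ _ _ h] := hyp i; move=> /h/Per_P. Qed.

Lemma piece_dyn_iter i x (k : int) : S_ i x -> S_ i (dyn_iter k x).
Proof. by have [_ h _ _] := hyp i; exact: invariant_dyn_iter. Qed.

Lemma piece_unique i j x : S_ i x -> S_ j x -> i = j.
Proof. by move=> ix jx; apply: trivS => //; exists x. Qed.

Lemma union_closed : closed S.
Proof.
rewrite hS; apply: closed_bigcup => [|i _]; first exact: finite_finset.
by have [_ _ h _] := hyp i.
Qed.

Lemma union_piece x : S x -> exists i, S_ i x.
Proof. by rewrite hS => -[i _ ix]; exists i. Qed.

Lemma piece_union i x : S_ i x -> S x.
Proof. by rewrite hS; exists i. Qed.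

Lemma union_dyn_iter x (k : int) : S x -> S (dyn_iter k x).
Proof. by move=> /union_piece[i /(piece_dyn_iter k)/piece_union]. Qed.

Lemma union_minimal_period x : S x -> exists q, minimal_period q x.
Proof. by move=> /union_piece[i /piece_minimal_period]; exists (p i). Qed.

(** Sum a Urysohn function along sigma over [N] steps, where [N] is a common period of all points of
    [S]. The sum is 0 at x, and at y it is at least 1. *)
Lemma invariant_separation x y : S x -> ~ dyn_orbit x y ->
  exists u : X -> R, [/\ continuous u, u x != u y &
    forall z (k : int), S z -> u (dyn_iter k z) = u z].
Proof.
move=> Sx nxy; have [q qx] := union_minimal_period Sx.
have [|||f [cf f01 fx fy]] := @dyn_urysohn R X (dyn_orbit x) [set y].
- apply: dyn_finite_closed; apply/finite_setP; exists q; exact: minimal_period_Per.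
- exact: dyn_finite_closed.
- by rewrite -subset0 => z [xz /= zy]; apply: nxy; rewrite -zy.
pose N := (\prod_i p i)%N.
have N0 : (0 < N)%N by apply: prodn_gt0 => i; have [] := hyp i.
have zN z : S z -> dyn_iter N z = z.
  move=> /union_piece[i /piece_minimal_period[_ pz _]].
  have -> : N = (\prod_(j | j != i) p j * p i)%N by rewrite /N (bigD1 i)//= mulnC.
  by rewrite PoszM dyn_iter_period.
pose u z := \sum_(0 <= k < N) f (dyn_iter k%:Z z).
have u1 z : S z -> u (dyn_map z) = u z.
  move=> Sz; rewrite /u; have fE k : f (dyn_iter k%:Z (dyn_map z)) = f (dyn_iter k.+1%:Z z).
    by rewrite -[dyn_map z]/(dyn_iter 1 z) -dyn_iterD -PoszD addn1.
  under eq_bigr do rewrite fE.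
  (* Applying sigma rotates the summands cyclically, as the term after the last one equals the
     first. *)
  case: (N) N0 (zN z Sz) => // M _ zM.
  pose F (k : nat) := f (dyn_iter k%:Z z).
  have FM : F M.+1 = F 0%N by rewrite /F zM.
  rewrite -[LHS]/(\sum_(0 <= k < M.+1) F k.+1) -[RHS]/(\sum_(0 <= k < M.+1) F k).
  by clearbody F; rewrite big_nat_recr//= big_nat_recl//= FM addrC.
exists u; split.
- rewrite /u; elim: (index_iota _ _) => [|k r ih].
    by under eq_fun do rewrite big_nil; exact: cst_continuous.
  under eq_fun do rewrite big_cons.
  move=> z; apply: cvgD; last exact: ih.
  by apply: (@continuous_comp _ _ _ (dyn_iter k%:Z) f); [exact: dyn_iter_continuous|exact: cf].
- have -> : u x = 0 by rewrite /u big1// => k _; apply: fx; exists k%:Z.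
  rewrite eq_sym gt_eqF// /u big_ltn//=; apply: ltr_pwDl; first by rewrite fy.
  by apply: sumr_ge0 => k _; have /andP[] := f01 (dyn_iter k y).
- have uN (m : nat) z : S z -> u (dyn_iter m z) = u z.
    by move=> Sz; elim: m => [//|m ih]; rewrite -ih /= u1//; exact: (union_dyn_iter m).
  move=> z [m|m] Sz; first exact: uN.
  have := uN m.+1 _ (union_dyn_iter (Negz m) Sz).
  by rewrite -dyn_iterD (_ : m.+1%:Z + Negz m = 0) ?dyn_iter0//; lia.
Qed.

(** The Hausdorff property in terms of elements: the ideals without [a] and the ideals without [b]
    form open sets, and no ideal over [S] is in both. *)
Lemma ideal_separation x1 x2 q1 q2 (lam1 lam2 : R[i]) :
  S x1 -> S x2 -> minimal_period q1 x1 -> minimal_period q2 x2 -> T lam1 -> T lam2 ->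
  ~ dyn_orbit x1 x2 \/ lam1 <> lam2 ->
  exists a b : A, [/\ ~ per_ideal q1 x1 lam1 a, ~ per_ideal q2 x2 lam2 b &
    forall x q lam, S x -> minimal_period q x -> T lam ->
      per_ideal q x lam a \/ per_ideal q x lam b].
Proof.
move=> Sx1 Sx2 qx1 qx2 l1 l2 dis.
have normr_cont (f : X -> R) : continuous f -> continuous (fun z => `|f z|).
  by move=> cf z; apply: (@cvg_norm _ R); exact: cf.
have [x12|/(invariant_separation Sx1)[u [cu u12 uinv]]] := pselect (dyn_orbit x1 x2); last first.
  (* Centring [u] at the midpoint of its two values makes [d] positive at x1 and negative at x2. *)
  pose d z := (u z - (u x1 + u x2) / 2) * (u x1 - u x2).
  have cd : continuous d.
    move=> z; apply: cvgMr_tmp; apply: cvgB; [exact: cu|exact: cvg_cst].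
  have e0 : 0 < (u x1 - u x2) ^+ 2 by rewrite exprn_even_gt0//= subr_eq0.
  have d1 : 0 < d x1 by rewrite /d; move: (u x1) (u x2) e0 => r s; nra.
  have d2 : d x2 < 0 by rewrite /d; move: (u x1) (u x2) e0 => r s; nra.
  have dinv z k : S z -> d (dyn_iter k z) = d z by move=> Sz; rewrite /d uinv.
  have cf : continuous (fun z => (`|d z| + d z)%:C).
    by apply: realC_continuous => z; apply: cvgD; [exact: normr_cont|exact: cd].
  have cg : continuous (fun z => (`|d z| - d z)%:C).
    by apply: realC_continuous => z; apply: cvgB; [exact: normr_cont|exact: cd].
  exists (ell1_fct cf), (ell1_fct cg); split.
  - move=> /(per_ideal_fct cf qx1 l1)/(_ 0)/complexI/=.
    by rewrite gtr0_norm// => /eqP; rewrite gt_eqF//; lra.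
  - move=> /(per_ideal_fct cg qx2 l2)/(_ 0)/complexI/=.
    by rewrite ltr0_norm// => /eqP; rewrite gt_eqF//; lra.
  - move=> x q lam Sx qx lam'; have [dx|dx] := leP (d x) 0; [left|right].
      by apply/(per_ideal_fct cf qx lam') => k; rewrite dinv// ler0_norm// addNr.
    by apply/(per_ideal_fct cg qx lam') => k; rewrite dinv// gtr0_norm// subrr.
have {}dis : lam1 <> lam2 by case: dis.
have [i ix1] := union_piece Sx1.
(* [re_dot_elt] refers to one period, so the construction is localized to the piece of x1: [phi] is
   1 there and 0 on the other pieces. *)
have [|||phi [cphi phi01 phi0 phi1]] :=
    @dyn_urysohn R X (\bigcup_(j in [set j | j != i]) S_ j) (S_ i).
- by apply: closed_bigcup => [|j _]; [exact: finite_finset|have [_ _ h _] := hyp j].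
- by have [_ _ h _] := hyp i.
- by rewrite -subset0 => z [[j /= ji jz] iz]; rewrite (piece_unique jz iz) eqxx in ji.
have [p0 _ _ _] := hyp i.
(* The factor 1/2 ensures |w| <= 1, as [ell1_abs_re_dot] demands. *)
pose w := (2^-1)%:C * (lam2 - lam1).
have w1 : normc w <= 1.
  rewrite /w normcM /= expr0n/= addr0 sqrtr_sqr ger0_norm// mulrC ler_pdivrMr// mul1r.
  apply: le_trans (normcD' _ _) _; rewrite -[- lam1]sub0r normcB subr0.
  by move/unit_circle_normc: l1 => ->; move/unit_circle_normc: l2 => ->; lra.
have [b0 hb0] := @ell1_abs_re_dot R X (p i) w p0 w1.
pose th : A := re_dot_elt (p i) w.
have cphi' := realC_continuous cphi.
pose act (c : A) (al : R[i] -> R[i]) := forall x lam v, T lam ->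
  quasi_periodic (p i) lam v -> forall m, aper_rep x c v m = al lam * v m.
(* On [S_ i] the factor [phi] is 1, so the product acts as the scalar [al lam] and is in the ideal
   exactly when this scalar is 0. *)
have act_ideal c al : act c al -> forall x lam, S_ i x -> T lam ->
    (per_ideal (p i) x lam (ell1_fct cphi' * c) <-> al lam = 0).
  move=> hc x lam ix lam'; have [_ px _] := piece_minimal_period ix.
  have rep v m : quasi_periodic (p i) lam v ->
      aper_rep x (ell1_fct cphi' * c) v m = al lam * v m.
    move=> hv; have vb := quasi_periodic_bounded p0 lam' hv.
    have hcv := hc x lam v lam' hv.
    rewrite (aper_repM vb); have -> : aper_rep x c v = fun m => al lam * v m by apply/funext.
    rewrite (aper_repZr _ _ _ vb) (aper_rep_single vb) subr0 phi1 ?mul1r//.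
    exact: piece_dyn_iter.
  split=> [h|al0]; last first.
    by apply/(per_idealP p0 _ px lam') => v hv m; rewrite rep// al0 mul0r.
  have h1 := @qp_delta_quasi_periodic _ (p i) lam p0 lam' 0.
  move/(per_idealP p0 _ px lam'): h => /(_ _ h1 0); rewrite rep//.
  by rewrite /qp_delta mod0z div0z oppr0 expr0z mulr1.
have actB : act (b0 - th) (fun lam => (`|re_dot w lam| - re_dot w lam)%:C).
  move=> x lam v lam' hv m; rewrite (aper_repB (quasi_periodic_bounded p0 lam' hv)).
  by rewrite (hb0 x lam v lam' hv) (aper_rep_re_dot w p0 _ lam' hv) rmorphB/= mulrBl.
have actD : act (b0 + th) (fun lam => (`|re_dot w lam| + re_dot w lam)%:C).
  move=> x lam v lam' hv m; rewrite (aper_repDl (quasi_periodic_bounded p0 lam' hv)).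
  by rewrite (hb0 x lam v lam' hv) (aper_rep_re_dot w p0 _ lam' hv) rmorphD/= mulrDl.
have [t1 t2] : re_dot w lam1 < 0 /\ 0 < re_dot w lam2.
  exact: re_dot_chord.
have ix2 : S_ i x2 by case: x12 => k _ <-; exact: piece_dyn_iter.
have q1E := minimal_period_unique qx1 (piece_minimal_period ix1).
have q2E := minimal_period_unique qx2 (piece_minimal_period ix2).
(* These act as |t| - t, nonzero at lam1 where t < 0, and as |t| + t, nonzero at lam2 where t >
   0. *)
exists (ell1_fct cphi' * (b0 - th)), (ell1_fct cphi' * (b0 + th)); split.
- rewrite q1E => /(act_ideal _ _ actB x1 lam1 ix1 l1)/complexI.
  by rewrite ltr0_norm// => /eqP; rewrite gt_eqF//; lra.
- rewrite q2E => /(act_ideal _ _ actD x2 lam2 ix2 l2)/complexI.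
  by rewrite gtr0_norm// => /eqP; rewrite gt_eqF//; lra.
move=> x q lam Sx qx lam'; have [ix|nix] := pselect (S_ i x).
  rewrite (minimal_period_unique qx (piece_minimal_period ix)).
  have [t0|t0] := leP (re_dot w lam) 0; [right|left].
    by apply/(act_ideal _ _ actD x lam ix lam'); rewrite ler0_norm// addNr.
  by apply/(act_ideal _ _ actB x lam ix lam'); rewrite gtr0_norm// subrr.
left; have [q0 qx' _] := qx.
have rq : representation (@per_rep R X q x lam) by exact: per_rep_representation.
apply: rep_ker_idealr => //; apply/(per_ideal_fct cphi' qx lam') => k.
rewrite phi0//; have [j jx] := union_piece Sx; exists j; last exact: piece_dyn_iter.
by apply/eqP => ji; apply: nix; rewrite -ji.
Qed.

(** If the parameters differed, the common ideal would contain one of the two separating elements,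
    and it contains neither. *)
Lemma per_ideal_inj x y q r (lam mu : R[i]) :
  S x -> S y -> minimal_period q x -> minimal_period r y -> T lam -> T mu ->
  per_ideal q x lam = per_ideal r y mu :> set A -> dyn_orbit x y /\ lam = mu.
Proof.
move=> Sx Sy qx ry lam1 mu1 e; apply: contrapT => ne.
have [|a [b [ha hb hab]]] := ideal_separation Sx Sy qx ry lam1 mu1.
  have [xy|] := pselect (dyn_orbit x y); [right|by left].
  by move=> l; apply: ne.
have [] := hab _ _ _ Sx qx lam1; first exact: ha.
by rewrite e; exact: hb.
Qed.

(** * The map from orbits and circle parameters to ideals *)

Local Notation OT := (orbit_space S * unit_circle R)%type.

Lemma to_orbitP (x y : S) : to_orbit x = to_orbit y <-> dyn_orbit (\val x) (\val y).
Proof.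
split=> [h|h]; last by apply/eqmodP; apply/asboolP.
by apply/asboolP; apply/(@eqmodP _ (orbit_equiv S)).
Qed.

Lemma to_orbit_surj (o : orbit_space S) : exists x : S, to_orbit x = o.
Proof. by exists (repr o); exact: reprK. Qed.

Lemma to_orbit_continuous : continuous (@to_orbit X S).
Proof. exact: pi_continuous. Qed.

(** The functions of [invariant_separation] are constant on orbits in [S], so they descend to the
    quotient and separate its points. *)
Lemma orbit_space_hausdorff : hausdorff_space (orbit_space S).
Proof.
apply: (hausdorff_separated (@Rhausdorff R)) => o1 o2.
have [x <-] := to_orbit_surj o1; have [y <-] := to_orbit_surj o2 => xy.
have [|u [cu uxy uinv]] := invariant_separation (set_valP x) (y := \val y).
  by move=> /to_orbitP.
pose g (z : S) := u (\val z).
have gE (z z' : S) : to_orbit z = to_orbit z' -> g z = g z'.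
  by move=> /to_orbitP[k _ zz']; rewrite /g -zz' uinv//; exact: set_valP.
exists (g \o repr).
  apply: repr_comp_continuous => [|z z' /eqP/gE/eqP//].
  by move=> z; apply: continuous_comp; [exact: initial_continuous|exact: cu].
move=> h; move/eqP: uxy; apply; rewrite -[LHS]/(g x) -[RHS]/(g y).
transitivity ((g \o repr) (to_orbit x)); first by apply/esym/gE; exact: reprK.
by rewrite h; apply: gE; exact: reprK.
Qed.

Lemma subset_prod_compact : compact [set: (S * unit_circle R)%type].
Proof.
apply: compact_setTX; apply: compact_set_type; last exact: unit_circle_compact.
by apply: (subclosed_compact union_closed (@dyn_compact X)).
Qed.

Lemma orbit_prod_continuous :
  continuous (fun z : (S * unit_circle R)%type => (to_orbit z.1, z.2) : OT).
Proof.
move=> z; apply: (@cvg_pair _ _ _ (nbhs z) (nbhs (to_orbit z.1)) (nbhs z.2)); last exact: cvg_snd.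
by apply: (@continuous_comp _ _ _ fst (@to_orbit X S)); [exact: cvg_fst|exact: to_orbit_continuous].
Qed.

Lemma orbit_prod_compact : compact [set: OT].
Proof.
apply: (compact_surj subset_prod_compact orbit_prod_continuous); case=> o lam.
by have [x <-] := to_orbit_surj o; exists (x, lam).
Qed.

Lemma orbit_prod_hausdorff : hausdorff_space OT.
Proof.
apply: hausdorff_setX; first exact: orbit_space_hausdorff.
by apply: hausdorff_set_type; exact: norm_hausdorff.
Qed.

(** Ideals of infinite orbits do not occur, since every point of [S] is periodic. *)
Lemma Pi_ell1P (P : Pi_ell1 R S) : exists x q (lam : R[i]), [/\ S x,
  minimal_period q x, T lam & prim_set (\val P) = per_ideal q x lam].
Proof.
have := set_valP P; move=> [[q [x [lam [xS /Per_P qx lam1 ->]]]]|[x [xS ax _]]].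
  by exists x, q, lam; split=> //; apply: xS; exists 0.
have [i ix] : exists i, S_ i x by apply: union_piece; apply: xS; exists 0.
by case: ax; apply/finite_setP; exists (p i); exact/minimal_period_Per/piece_minimal_period.
Qed.

(** The ideal is chosen from one representative of the orbit; [per_ideal_shift] transfers the
    description to all the others. *)
Lemma spectrum_map_exists : exists Psi : OT -> Pi_ell1 R S,
  forall (x : S) (lam : unit_circle R) (q : nat), minimal_period q (\val x) ->
    prim_set (\val (Psi (to_orbit x, lam))) = per_ideal q (\val x) (\val lam).
Proof.
suff /boolp.choice[Psi hPsi] (z : OT) : exists P : Pi_ell1 R S,
    forall (x : S) (q : nat), to_orbit x = z.1 -> minimal_period q (\val x) ->
    prim_set (\val P) = per_ideal q (\val x) (\val z.2).
  by exists Psi => x lam q qx; exact: hPsi.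
case: z => o lam; have [x xo] := to_orbit_surj o.
have [q qx] := union_minimal_period (set_valP x); have [q0 qx' _] := qx.
have lam1 : T (\val lam) := set_valP lam.
pose P := PrimitiveIdeal (per_ideal_primitive q0 qx lam1).
have PS : Pi_ell1 R S P.
  left; exists q, (\val x), (\val lam); split=> //; last exact/Per_P.
  by move=> _ [k _ <-]; apply: union_dyn_iter; exact: set_valP.
exists (SigSub (mem_set PS)) => y q' /= yo q'y.
have /to_orbitP[k _ xy] : to_orbit x = to_orbit y by rewrite yo.
have qy := minimal_period_shift k qx; rewrite xy in qy.
by rewrite (minimal_period_unique q'y qy) -xy per_ideal_shift.
Qed.

Section SpectrumMap.
Variable Psi : OT -> Pi_ell1 R S.
Hypothesis PsiE : forall (x : S) (lam : unit_circle R) (q : nat),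
  minimal_period q (\val x) ->
  prim_set (\val (Psi (to_orbit x, lam))) = per_ideal q (\val x) (\val lam).

(** The preimage of the condition that [a] is in the ideal is the image of a closed set [D] in the
    compact space S x T. It is compact, hence closed in the Hausdorff space of parameters. *)
Lemma spectrum_map_continuous : continuous Psi.
Proof.
apply: continuous_set_type; apply/continuous_closedP => E /closed_primE ->.
rewrite preimage_bigcap; apply: closed_bigI => a _.
pose D := [set z : (S * unit_circle R)%type | exists i, S_ i (\val z.1) /\
  per_ideal (p i) (\val z.1) (\val z.2) a].
have cval : continuous (fun z : (S * unit_circle R)%type => \val z.1 : X).
  by move=> z; apply: continuous_comp; [exact: cvg_fst|exact: initial_continuous].
have clam : continuous (fun z : (S * unit_circle R)%type => \val z.2 : R[i]).
  by move=> z; apply: continuous_comp; [exact: cvg_snd|exact: initial_continuous].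
have cD : closed D.
  rewrite (_ : D = \bigcup_i ((fun z => \val z.1) @^-1` S_ i `&`
      [set z | per_ideal (p i) (\val z.1) (\val z.2) a])); last first.
    by apply/seteqP; split=> z; case=> i; [exists i|move=> _; exists i].
  apply: closed_bigcup => [|i _]; first exact: finite_finset.
  apply: closedI; last by apply: per_ideal_closed => // z; exact: set_valP.
  by apply: preimage_closed => [z _|]; [exact: cval|have [_ _ h _] := hyp i].
rewrite (_ : _ @^-1` _ = (fun z => (to_orbit z.1, z.2) : OT) @` D).
  apply: (compact_closed orbit_prod_hausdorff); apply: continuous_compact.
    exact/continuous_subspaceT/orbit_prod_continuous.
  exact: (subclosed_compact cD subset_prod_compact).
apply/seteqP; split=> [w|_ [[x lam] [i [ix ha]] <-] /=]; last first.
  by rewrite (PsiE lam (piece_minimal_period ix)).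
case: w => o lam /=; have [x <-] := to_orbit_surj o; have [i ix] := union_piece (set_valP x).
by rewrite (PsiE lam (piece_minimal_period ix)) => ha; exists (x, lam) => //; exists i.
Qed.

Lemma spectrum_map_surj (P : Pi_ell1 R S) : exists z, Psi z = P.
Proof.
have [x [q [lam [Sx qx lam1 PE]]]] := Pi_ell1P P.
exists (to_orbit (SigSub (mem_set Sx) : S), SigSub (mem_set lam1)).
apply/val_inj; have := @PsiE (SigSub (mem_set Sx)) (SigSub (mem_set lam1)) q qx.
move: PE; case: (\val P) (\val (Psi _)) => [P1 h1] [P2 h2] /= e1 e2.
by move: h1 h2; rewrite e1 e2 => h1 h2; congr PrimitiveIdeal; exact: Prop_irrelevance.
Qed.

Lemma spectrum_map_inj : injective Psi.
Proof.
case=> o1 lam1; case=> o2 lam2; have [x <-] := to_orbit_surj o1; have [y <-] := to_orbit_surj o2.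
have Sx := set_valP x; have Sy := set_valP y.
have [q qx] := union_minimal_period Sx; have [r ry] := union_minimal_period Sy.
move=> h; have := PsiE lam1 qx; rewrite h (PsiE lam2 ry).
case/(per_ideal_inj Sy Sx ry qx (set_valP lam2) (set_valP lam1)) => /to_orbitP -> /val_inj l.
by rewrite l.
Qed.

(** Distinct ideals have distinct parameters, so [ideal_separation] applies; the neighbourhoods are
    the ideals that omit [a] and those that omit [b]. *)
Lemma spectrum_hausdorff : hausdorff_space (Pi_ell1 R S).
Proof.
move=> P Q PQ; have [z zP] := spectrum_map_surj P; have [z' zQ] := spectrum_map_surj Q.
apply: contrapT => ne; case: z zP => o1 lam1; case: z' zQ => o2 lam2.
have [x <-] := to_orbit_surj o1; have [y <-] := to_orbit_surj o2 => yQ xP.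
have Sx := set_valP x; have Sy := set_valP y.
have [q qx] := union_minimal_period Sx; have [r ry] := union_minimal_period Sy.
have [|a [b [ha hb hab]]] :=
    ideal_separation Sx Sy qx ry (set_valP lam1) (set_valP lam2).
  have [xy|] := pselect (dyn_orbit (\val x) (\val y)); [right|by left].
  by move/to_orbitP: xy xP yQ => -> xP yQ /val_inj l; apply: ne; rewrite -xP -yQ l.
have nb (P0 : Pi_ell1 R S) c : ~ prim_set (\val P0) c ->
    nbhs P0 [set P : Pi_ell1 R S | ~ prim_set (\val P) c].
  move=> nc; apply: (@initial_continuous _ _ \val P0 [set P | ~ prim_set P c]).
  by apply: open_nbhs_nbhs; split=> //; exact/closed_openC/containing_closed.
have Pa : ~ prim_set (\val P) a by rewrite -xP (PsiE lam1 qx).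
have Qb : ~ prim_set (\val Q) b by rewrite -yQ (PsiE lam2 ry).
have [P0 [/= na nb']] := PQ _ _ (nb _ _ Pa) (nb _ _ Qb).
have [x0 [q0 [l0 [Sx0 qx0 l01 PE]]]] := Pi_ell1P P0.
by rewrite PE in na nb'; case: (hab _ _ _ Sx0 qx0 l01).
Qed.

Lemma spectrum_map_homeomorphism : homeomorphism Psi.
Proof.
apply: homeomorphism_compact_hausdorff; [exact: orbit_prod_compact
  |exact: spectrum_hausdorff|exact: spectrum_map_continuous|exact: spectrum_map_inj|].
exact: spectrum_map_surj.
Qed.

Lemma spectrum_compact : compact [set: Pi_ell1 R S].
Proof.
exact: compact_surj orbit_prod_compact spectrum_map_continuous spectrum_map_surj.
Qed.

End SpectrumMap.

End PeriodicPieces.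

(** * The case of one piece *)

Section SinglePiece.
Context {X : dynsys}.
Variables (q : nat) (C : set X).
Hypothesis hyp : [/\ (0 < q)%N, invariant_set C, closed C & C `<=` Per_ X q].

(** Presents [C] as a family over ['I_1], so that the results on unions apply to a piece by
    itself. *)
Lemma single_pieceE : C = \bigcup_(j : 'I_1) C.
Proof. by apply/seteqP; split=> y; [exists ord0|case]. Qed.

Lemma single_piece_triv : trivIset [set: 'I_1] (fun=> C).
Proof. by move=> j k _ _ _; rewrite (ord1 j) (ord1 k). Qed.

Variable R : realType.

Lemma single_piece_homeomorphic :
  homeomorphic (Pi_ell1 R C) (orbit_space C * unit_circle R)%type.
Proof.
have [Psi PsiE] := @spectrum_map_exists R X _ _ _ _ single_pieceE (fun=> hyp).
exact: homeomorphism_sym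
  (spectrum_map_homeomorphism single_pieceE single_piece_triv (fun=> hyp) PsiE).
Qed.

Lemma single_piece_compact : compact [set: Pi_ell1 R C].
Proof.
have [Psi PsiE] := @spectrum_map_exists R X _ _ _ _ single_pieceE (fun=> hyp).
exact: (spectrum_compact single_pieceE (fun=> hyp) PsiE).
Qed.

Lemma single_pieceP (P : Pi_ell1 R C) : exists x r (lam : R[i]), [/\ C x,
  minimal_period r x, unit_circle R lam & prim_set (\val P) = per_ideal r x lam].
Proof. exact: Pi_ell1P single_pieceE (fun=> hyp) P. Qed.

End SinglePiece.

(** * Decomposition as a topological sum *)

Lemma Pi_ell1_subset (R : realType) (X : dynsys) (C S : set X) :
  C `<=` S -> Pi_ell1 R C `<=` Pi_ell1 R S.
Proof.
move=> CS P [[q [x [lam [h qx l PE]]]]|[x [h ax PE]]].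
  by left; exists q, x, lam; split=> //; exact: subset_trans CS.
by right; exists x; split=> //; exact: subset_trans CS.
Qed.

(** The inclusions combine to a continuous map from a finite sum of compact spaces to a Hausdorff
    space. It is injective because an ideal determines its orbit, which lies in a single piece. *)
Lemma Pi_ell1_sum_homeomorphic (R : realType) (X : dynsys) (n : nat)
    (S_ : 'I_n -> set X) (p : 'I_n -> nat) (S : set X) :
  S = \bigcup_i S_ i -> trivIset [set: 'I_n] S_ ->
  (forall i, [/\ (0 < p i)%N, invariant_set (S_ i), closed (S_ i) &
                 S_ i `<=` Per_ X (p i)]) ->
  hausdorff_space (Pi_ell1 R S) ->
  homeomorphic (Pi_ell1 R S)
    (topological_sum (fun i => Pi_ell1 R (S_ i) : topologicalType)).
Proof.
move=> hS trivS hyp hPi.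
have iS i : S_ i `<=` S by move=> x ix; rewrite hS; exists i.
pose f i (P : Pi_ell1 R (S_ i)) : Pi_ell1 R S :=
  SigSub (mem_set (Pi_ell1_subset (iS i) (set_valP P))).
pose F (z : topological_sum (fun i => Pi_ell1 R (S_ i) : topologicalType)) :=
  f (projT1 z) (projT2 z).
apply: (@homeomorphism_sym _ _ F); apply: homeomorphism_compact_hausdorff => //.
- apply: sigT_compact => [|i]; first exact: finite_finset.
  exact: (single_piece_compact (hyp i)).
- have cf i : continuous (f i).
    by apply: continuous_set_type; exact: initial_continuous.
  by case=> i P; exact: (cf i P).
- case=> i P; case=> j Q /(congr1 \val) e; have {e}PQ : \val P = \val Q by exact: e.
  have [x [q [lam [ix qx lam1 PE]]]] := single_pieceP (hyp i) P.
  have [y [r [mu [jy ry mu1 QE]]]] := single_pieceP (hyp j) Q.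
  have [|xy _] := per_ideal_inj hS trivS hyp (iS i x ix) (iS j y jy) qx ry lam1 mu1.
    by rewrite -PE -QE PQ.
  have ij : i = j.
    apply: (piece_unique trivS _ jy); case: xy => k _ <-; exact: (piece_dyn_iter hyp).
  by move: Q PQ {jy QE}; rewrite -ij => Q PQ; congr existT; exact: val_inj.
- move=> P; have [x [q [lam [Sx qx lam1 PE]]]] := Pi_ell1P hS hyp P.
  have [i ix] := union_piece hS Sx.
  have Pi : Pi_ell1 R (S_ i) (\val P).
    left; exists q, x, lam; split=> //; last exact/Per_P.
    by move=> _ [k _ <-]; exact: (piece_dyn_iter hyp).
  by exists (existT _ i (SigSub (mem_set Pi))); exact: val_inj.
Qed.

Theorem theorem5p10 (R : realType) (X : dynsys) :
  (metrizable R X \/ [set: X] = Per X -> compact (Pi_ell1 R [set: X])) /\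
  (compact (Pi_ell1 R [set: X]) ->
   forall (n : nat) (S_ : 'I_n -> set X) (p : 'I_n -> nat),
     trivIset [set: 'I_n] S_ ->
     (forall i, [/\ (0 < p i)%N, invariant_set (S_ i), closed (S_ i) &
                    S_ i `<=` Per_ X (p i)]) ->
     let S := \bigcup_i S_ i in
     [/\ exists Psi : (orbit_space S * unit_circle R)%type -> Pi_ell1 R S,
           (forall (x : S) (lam : unit_circle R) (q : nat), Per_ X q (\val x) ->
              \val (Psi (to_orbit x, lam)) = per_ideal q (\val x) (\val lam)
                :> set (ell1 R X)) /\
           homeomorphism Psi,
         compact [set: (orbit_space S * unit_circle R)%type] /\
           hausdorff_space (orbit_space S * unit_circle R)%type,
         compact [set: Pi_ell1 R S] /\ hausdorff_space (Pi_ell1 R S),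
         homeomorphic (Pi_ell1 R S)
           (topological_sum (fun i => Pi_ell1 R (S_ i) : topologicalType)) &
         forall i, homeomorphic (Pi_ell1 R (S_ i))
                     (orbit_space (S_ i) * unit_circle R)%type]).
Proof.
split=> [_|_ n S_ p trivS hyp S]; first exact: Pi_ell1_compact.
have hS : S = \bigcup_i S_ i by [].
have [Psi PsiE] := @spectrum_map_exists R X _ _ _ _ hS hyp.
split.
- exists Psi; split; last exact: (spectrum_map_homeomorphism hS trivS hyp PsiE).
  by move=> x lam q /Per_P; exact: PsiE.
- by split; [exact: (orbit_prod_compact hS hyp)|exact: (orbit_prod_hausdorff hS hyp)].
- split; first exact: (spectrum_compact hS hyp PsiE).
  exact: (spectrum_hausdorff hS trivS hyp PsiE).
- apply: (Pi_ell1_sum_homeomorphic hS trivS hyp).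
  exact: (spectrum_hausdorff hS trivS hyp PsiE).
- by move=> i; exact: (single_piece_homeomorphic (hyp i)).
Qed.
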